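(* Let $R$ be a Noetherian domain containing $\mathbb{Q}$, let $B=\operatorname{Sym}_R(M)$ for some projective $R$-module $M$ of rank two, and let $D$ be a locally nilpotent $R$-derivation of $B$ such that for each $\mathfrak{p}\in\operatorname{Spec}(R)$ the induced locally nilpotent $R_{\mathfrak{p}}$-derivation $D_{\mathfrak{p}}$ of $B_{\mathfrak{p}}$ is irreducible. Then $\operatorname{Ker}(D)$ is isomorphic (as an $R$-algebra) to $\operatorname{Sym}_R(N)$ for some projective $R$-module $N$ of rank one if and only if $\operatorname{grade}(D(B)B,B)\in\{2,\infty\}$.
   Context: All rings are commutative with unity. $\operatorname{Sym}_R(M)$ is the symmetric algebra of the $R$-module $M$. An $R$-derivation $D:B\to B$ is an $R$-linear map satisfying the Leibniz rule; it is locally nilpotent if for each $b\in B$ there is $n\ge 0$ with $D^n(b)=0$; $\operatorname{Ker}(D)=\{b\in B: D(b)=0\}$. $D(B)B$ is the ideal of $B$ generated by the image of $D$. For $\mathfrak p\in\operatorname{Spec}(R)$, $B_{\mathfrak p}$ is the localization of $B$ at $R\setminus\mathfrak p$, and $D_{\mathfrak p}$ is the extension of $D$ to $B_{\mathfrak p}$. A derivation $D$ of a ring $B$ is reducible if there is a non-unit $b\in B$ with $D(B)\subseteq bB$, and irreducible otherwise. For an ideal $I$ of a Noetherian ring $S$, $\operatorname{grade}(I,S)$ is the length of a maximal $S$-regular sequence contained in $I$ if $I\ne S$, and is $\infty$ if $I=S$. *)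

(* Defs.v *)
From HB Require Import structures.
From mathcomp Require Import all_boot all_order all_algebra.
From mathcomp Require Import ring_quotient generic_quotient.
From mathcomp Require Import ring.
From mathcomp Require Import boolp classical_sets.

Set Implicit Arguments.
Unset Strict Implicit.
Unset Printing Implicit Defensive.

Import GRing.Theory.
Local Open Scope classical_set_scope.
Local Open Scope ring_scope.
Local Open Scope quotient_scope.

(* Unlike [idealr] of ring_quotient, the unit ideal is allowed. *)
Definition is_ideal (A : comPzRingType) (I : set A) : Prop :=
  [/\ I 0, forall x y, I x -> I y -> I (x + y)
    & forall a x, I x -> I (a * x)].

Definition ideal_gen (A : comPzRingType) (X : set A) : set A :=
  smallest (@is_ideal A) X.

Definition noetherian (A : comPzRingType) : Prop :=
  forall I : set A, is_ideal I -> exists s : seq A, I = ideal_gen [set` s].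

(* With i ranging below [size s], [s`_i] is a nonzerodivisor modulo the ideal
   generated by the preceding terms; the full quotient must be nonzero. *)
Definition regular_seq (A : comPzRingType) (s : seq A) : Prop :=
  (forall i, (i < size s)%N -> forall x : A,
     ideal_gen [set` take i s] (s`_i * x) -> ideal_gen [set` take i s] x)
  /\ ~ ideal_gen [set` s] 1.

Definition maximal_regular_seq (A : comPzRingType) (I : set A) (s : seq A)
    : Prop :=
  [/\ regular_seq s, [set` s] `<=` I
    & forall x : A, I x -> ~ regular_seq (rcons s x)].

(* None stands for infinity. Grade is a relation because the uniqueness of the
   length of a maximal regular sequence is a theorem on Noetherian rings. *)
Definition grade_is (A : comPzRingType) (I : set A) (g : option nat) : Prop :=
  match g with
  | Some n => I <> setT /\
      exists s : seq A, maximal_regular_seq I s /\ size s = n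
  | None => I = setT
  end.

Section Localization.
Variables (R : comNzRingType) (p : prime_idealr R).

Record loc_denom := LocDenom { denom_val :> R; _ : denom_val \notin p }.

HB.instance Definition _ := [isSub for denom_val].
HB.instance Definition _ := [Choice of loc_denom by <:].

Lemma denomP (s : loc_denom) : (s : R) \notin p.
Proof. by case: s. Qed.

Lemma denom1_subproof : (1 : R) \notin p.
Proof. by rewrite idealr1. Qed.

Lemma denomM_subproof (s t : loc_denom) : (s : R) * (t : R) \notin p.
Proof. by rewrite prime_idealrM negb_or !denomP. Qed.

Implicit Types s t u v w : loc_denom.

Definition denom1 := LocDenom denom1_subproof.
Definition denomM s t := LocDenom (denomM_subproof s t).

Section LocModule.
Variable M : lmodType R.

(* [loc M] is M_p: fractions m / s with m in M and s in R \ p; for an R-algebra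
   B, [loc B] is the localization of B at the image of R \ p. *)
Definition loc_rel (x y : M * loc_denom) : bool :=
  `[< exists u : loc_denom,
        (u : R) *: ((y.2 : R) *: x.1) = (u : R) *: ((x.2 : R) *: y.1) >].

Lemma loc_rel_refl : reflexive loc_rel.
Proof. by move=> x; apply/asboolP; exists denom1. Qed.

Lemma loc_rel_sym : symmetric loc_rel.
Proof.
by move=> x y; apply/asboolP/asboolP => -[u e]; exists u; rewrite e.
Qed.

Lemma loc_rel_trans : transitive loc_rel.
Proof.
move=> y x z /asboolP [u e] /asboolP [v f]; apply/asboolP.
exists (denomM (denomM u v) y.2) => /=; move: e f; rewrite !scalerA => e f.
have -> : (u : R) * (v : R) * (y.2 : R) * (z.2 : R) =
          ((v : R) * (z.2 : R)) * ((u : R) * (y.2 : R)) by ring.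
rewrite -scalerA e scalerA.
have -> : (v : R) * (z.2 : R) * ((u : R) * (x.2 : R)) =
          ((u : R) * (x.2 : R)) * ((v : R) * (z.2 : R)) by ring.
by rewrite -scalerA f scalerA; congr (_ *: _); ring.
Qed.

Canonical loc_equiv := EquivRel loc_rel loc_rel_refl loc_rel_sym loc_rel_trans.

Definition loc := {eq_quot loc_equiv}.
HB.instance Definition _ := Choice.on loc.

Definition frac (m : M) (s : loc_denom) : loc := \pi_loc (m, s).


Lemma fracE (x : loc) : exists m s, x = frac m s.
Proof. by elim/quotW: x => -[m s]; exists m, s. Qed.

Lemma frac_eq m s n t :
  frac m s = frac n t <->
  exists u : loc_denom, (u : R) *: ((t : R) *: m) = (u : R) *: ((s : R) *: n).
Proof.
split=> [/eqP|e]; first by rewrite eqmodE => /asboolP.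
by apply/eqP; rewrite eqmodE; apply/asboolP.
Qed.

Lemma frac_eqW m s n t : (t : R) *: m = (s : R) *: n -> frac m s = frac n t.
Proof. by move=> e; apply/frac_eq; exists denom1; rewrite e. Qed.

(* Operations are defined on chosen representatives; the [frac]-lemmas show
   that they do not depend on the choice. *)
Lemma repr_frac m s :
  exists u : loc_denom,
    (u : R) *: (((repr (frac m s)).2 : R) *: m) =
    (u : R) *: ((s : R) *: (repr (frac m s)).1).
Proof.
have : frac m s = frac (repr (frac m s)).1 (repr (frac m s)).2.
  by rewrite /frac -surjective_pairing reprK.
by move=> /frac_eq.
Qed.

Definition loc_add (x y : loc) : loc :=
  frac (((repr y).2 : R) *: (repr x).1 + ((repr x).2 : R) *: (repr y).1)
       (denomM (repr x).2 (repr y).2).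
Definition loc_opp (x : loc) : loc := frac (- (repr x).1) (repr x).2.
Definition loc_zero : loc := frac 0 denom1.

Lemma loc_addE m s n t :
  loc_add (frac m s) (frac n t) = frac ((t : R) *: m + (s : R) *: n) (denomM s t).
Proof.
rewrite /loc_add; have [u] := repr_frac m s; have [v] := repr_frac n t.
move: (repr (frac m s)) (repr (frac n t)) => [m' s'] [n' t'] /= e f.
apply/esym/frac_eq; exists (denomM u v) => /=.
rewrite !scalerDr !scalerA; congr (_ + _).
  transitivity (((v : R) * (t : R) * (t' : R)) *: ((u : R) *: ((s' : R) *: m))).
    by rewrite !scalerA; congr (_ *: _); ring.
  by rewrite f !scalerA; congr (_ *: _); ring.
transitivity (((u : R) * (s : R) * (s' : R)) *: ((v : R) *: ((t' : R) *: n))).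
  by rewrite !scalerA; congr (_ *: _); ring.
by rewrite e !scalerA; congr (_ *: _); ring.
Qed.

Lemma loc_oppE m s : loc_opp (frac m s) = frac (- m) s.
Proof.
rewrite /loc_opp; have [u] := repr_frac m s.
move: (repr (frac m s)) => [m' s'] /= e.
by apply/esym/frac_eq; exists u; rewrite !scalerN e.
Qed.

Lemma loc_addA : associative loc_add.
Proof.
move=> x y z; have [[m [s ->]] [n [t ->]] [q [w ->]]] :=
  And3 (fracE x) (fracE y) (fracE z).
rewrite !loc_addE; apply: frac_eqW => /=.
by rewrite !scalerDr !scalerA !addrA; congr (_ *: _ + _ *: _ + _ *: _); ring.
Qed.

Lemma loc_addC : commutative loc_add.
Proof.
move=> x y; have [[m [s ->]] [n [t ->]]] := conj (fracE x) (fracE y).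
rewrite !loc_addE; apply: frac_eqW => /=.
by rewrite !scalerDr !scalerA addrC; congr (_ *: _ + _ *: _); ring.
Qed.

Lemma loc_add0 : left_id loc_zero loc_add.
Proof.
move=> x; have [m [s ->]] := fracE x; rewrite loc_addE; apply: frac_eqW => /=.
by rewrite scaler0 add0r !scalerA; congr (_ *: _); ring.
Qed.

Lemma loc_addN : left_inverse loc_zero loc_opp loc_add.
Proof.
move=> x; have [m [s ->]] := fracE x; rewrite loc_oppE loc_addE.
by apply: frac_eqW => /=; rewrite scalerN addNr !scaler0.
Qed.

HB.instance Definition _ :=
  GRing.isZmodule.Build loc loc_addA loc_addC loc_add0 loc_addN.

Lemma fracD m s n t :
  frac m s + frac n t = frac ((t : R) *: m + (s : R) *: n) (denomM s t).
Proof. exact: loc_addE. Qed.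

End LocModule.

Section LocAlgebra.
Variable A : comAlgType R.
Notation locA := (loc A).

Definition loc_mul (x y : locA) : locA :=
  frac ((repr x).1 * (repr y).1) (denomM (repr x).2 (repr y).2).

Lemma loc_mulE (a b : A) s t :
  loc_mul (frac a s) (frac b t) = frac (a * b) (denomM s t).
Proof.
rewrite /loc_mul; have [u] := repr_frac a s; have [v] := repr_frac b t.
move: (repr (frac a s)) (repr (frac b t)) => [a' s'] [b' t'] /= e f.
apply/esym/frac_eq; exists (denomM u v) => /=.
transitivity (((u : R) *: ((s' : R) *: a)) * ((v : R) *: ((t' : R) *: b))).
  by rewrite !(scalerA, scalerAl, scalerAr) -!scalerAl -!scalerAr !scalerA;
    congr (_ *: _); ring.
by rewrite f e -!scalerAl -!scalerAr !scalerA; congr (_ *: _); ring.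
Qed.

Definition loc_one : locA := frac 1 denom1.

Lemma loc_mulA : associative loc_mul.
Proof.
move=> x y z; have [[m [s ->]] [n [t ->]] [q [w ->]]] :=
  And3 (fracE x) (fracE y) (fracE z).
by rewrite !loc_mulE; apply: frac_eqW => /=; rewrite !mulrA.
Qed.

Lemma loc_mulC : commutative loc_mul.
Proof.
move=> x y; have [[m [s ->]] [n [t ->]]] := conj (fracE x) (fracE y).
rewrite !loc_mulE; apply: frac_eqW => /=.
by rewrite (mulrC m) (mulrC (s : R)).
Qed.

Lemma loc_mul1 : left_id loc_one loc_mul.
Proof.
move=> x; have [m [s ->]] := fracE x.
by rewrite loc_mulE; apply: frac_eqW => /=; rewrite !mul1r.
Qed.

Lemma loc_mulDl : left_distributive loc_mul +%R.
Proof.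
move=> x y z; have [[m [s ->]] [n [t ->]] [q [w ->]]] :=
  And3 (fracE x) (fracE y) (fracE z).
rewrite !(loc_mulE, fracD) /=; apply: frac_eqW => /=.
rewrite !mulrDl !scalerDr -!scalerAl !scalerA.
by congr (_ *: _ + _ *: _); ring.
Qed.

HB.instance Definition _ := GRing.Zmodule_isComPzRing.Build locA
  loc_mulA loc_mulC loc_mul1 loc_mulDl.

Lemma fracM (a b : A) s t : frac a s * frac b t = frac (a * b) (denomM s t).
Proof. exact: loc_mulE. Qed.

End LocAlgebra.

Definition loc_ring : comPzRingType := loc R^o.

Section LocLmod.
Variable M : lmodType R.

Definition loc_scale (a : loc_ring) (x : loc M) : loc M :=
  frac (((repr a).1 : R) *: (repr x).1) (denomM (repr a).2 (repr x).2).

Lemma loc_scaleE (a : R) s (m : M) t :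
  loc_scale (frac (a : R^o) s) (frac m t) = frac (a *: m) (denomM s t).
Proof.
rewrite /loc_scale; have [u] := repr_frac (a : R^o) s.
have [v] := repr_frac m t.
move: (repr (frac (a : R^o) s)) (repr (frac m t)) => [a' s'] [m' t'] /= e.
rewrite /GRing.scale/= => f.
apply/esym/frac_eq; exists (denomM u v) => /=.
transitivity (((u : R) * ((s' : R) * a)) *: ((v : R) *: ((t' : R) *: m))).
  by rewrite !scalerA; congr (_ *: _); ring.
by rewrite f e !scalerA; congr (_ *: _); ring.
Qed.

Lemma loc_scaleA a b (x : loc M) :
  loc_scale a (loc_scale b x) = loc_scale (a * b) x.
Proof.
have [[m [s ->]] [n [t ->]] [q [w ->]]] := And3 (fracE a) (fracE b) (fracE x).
rewrite (loc_scaleE n t q w) (loc_scaleE m s) fracM loc_scaleE.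
apply: frac_eqW => /=.
by rewrite !scalerA; congr (_ *: _); rewrite !mulrA.
Qed.

Lemma loc_scale1 : left_id (1 : loc_ring) loc_scale.
Proof.
move=> x; have [m [s ->]] := fracE x.
by rewrite loc_scaleE; apply: frac_eqW => /=; rewrite scale1r mul1r.
Qed.

Lemma loc_scaleDr : right_distributive loc_scale +%R.
Proof.
move=> a x y.
have [[m [s ->]] [n [t ->]] [q [w ->]]] := And3 (fracE a) (fracE x) (fracE y).
rewrite fracD (loc_scaleE m s n) (loc_scaleE m s q) (loc_scaleE m s) fracD.
apply: frac_eqW => /=.
by rewrite !scalerDr !scalerA; congr (_ *: _ + _ *: _); ring.
Qed.

Lemma loc_scaleDl (x : loc M) : {morph loc_scale^~ x : a b / a + b}.
Proof.
move=> a b.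
have [[m [s ->]] [n [t ->]] [q [w ->]]] := And3 (fracE a) (fracE b) (fracE x).
rewrite fracD (loc_scaleE m s) (loc_scaleE n t) loc_scaleE fracD.
apply: frac_eqW => /=.
have -> : (t : R) *: m + (s : R) *: n = (t : R) * m + (s : R) * n :> R by [].
by rewrite !scalerDl !scalerDr !scalerA; congr (_ *: _ + _ *: _); ring.
Qed.

HB.instance Definition _ := GRing.Zmodule_isLmodule.Build loc_ring (loc M)
  loc_scaleA loc_scale1 loc_scaleDr loc_scaleDl.

Lemma fracZ (a : R) s (m : M) t :
  (frac (a : R^o) s : loc_ring) *: frac m t = frac (a *: m) (denomM s t).
Proof. exact: loc_scaleE. Qed.

End LocLmod.

Section LocMap.
Variables (M N : lmodType R) (f : {linear M -> N}).

(* The induced map m / s |-> f m / s; for f an R-derivation D of an R-algebra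
   this is D_p, since D kills the image of R. *)
Definition loc_map (x : loc M) : loc N := frac (f (repr x).1) (repr x).2.

Lemma loc_mapE m s : loc_map (frac m s) = frac (f m) s.
Proof.
rewrite /loc_map; have [u] := repr_frac m s.
move: (repr (frac m s)) => [m' s'] /= e.
by apply/esym/frac_eq; exists u; move: (congr1 f e); rewrite !(linearZZ f).
Qed.

Lemma loc_map_is_linear : linear loc_map.
Proof.
move=> a x y.
have [[m [s ->]] [n [t ->]] [q [w ->]]] := And3 (fracE a) (fracE x) (fracE y).
rewrite (fracZ m s n t) fracD (loc_mapE (_ + _)) (loc_mapE n) (loc_mapE q).
by rewrite linearD !(linearZZ f) (fracZ m s (f n) t) fracD.
Qed.

HB.instance Definition _ := GRing.isLinear.Build loc_ring (loc M) (loc N) _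
  loc_map loc_map_is_linear.

End LocMap.
End Localization.

Arguments loc_map {R} p {M N} f x.

Section SymmetricAlgebra.
Variables (R : comNzRingType) (M : lmodType R).

(* Sym_R(M) is the commutative R-algebra generated by the symbols
   [sym_gen_expr m], m in M, subject to R-linearity in m: polynomial
   expressions modulo the congruence generated by the axioms of commutative
   R-algebras and the linearity relations. *)
Inductive sym_expr : Type :=
| sym_const_expr of R
| sym_gen_expr of M
| sym_add_expr of sym_expr & sym_expr
| sym_mul_expr of sym_expr & sym_expr.

HB.instance Definition _ := gen_eqMixin sym_expr.
HB.instance Definition _ := gen_choiceMixin sym_expr.

Local Notation C := sym_const_expr.
Local Notation G := sym_gen_expr.
Local Notation "x [+] y" := (sym_add_expr x y) (at level 50, left associativity).
Local Notation "x [*] y" := (sym_mul_expr x y) (at level 40, left associativity).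

Inductive sym_eqv : sym_expr -> sym_expr -> Prop :=
| sym_refl x : sym_eqv x x
| sym_sym x y : sym_eqv x y -> sym_eqv y x
| sym_trans x y z : sym_eqv x y -> sym_eqv y z -> sym_eqv x z
| sym_congD x x' y y' :
    sym_eqv x x' -> sym_eqv y y' -> sym_eqv (x [+] y) (x' [+] y')
| sym_congM x x' y y' :
    sym_eqv x x' -> sym_eqv y y' -> sym_eqv (x [*] y) (x' [*] y')
| sym_addA x y z : sym_eqv (x [+] (y [+] z)) (x [+] y [+] z)
| sym_addC x y : sym_eqv (x [+] y) (y [+] x)
| sym_add0 x : sym_eqv (C 0 [+] x) x
| sym_mulA x y z : sym_eqv (x [*] (y [*] z)) (x [*] y [*] z)
| sym_mulC x y : sym_eqv (x [*] y) (y [*] x)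
| sym_mul1 x : sym_eqv (C 1 [*] x) x
| sym_mul0 x : sym_eqv (C 0 [*] x) (C 0)
| sym_mulDl x y z : sym_eqv ((x [+] y) [*] z) (x [*] z [+] y [*] z)
| sym_constD a b : sym_eqv (C (a + b)) (C a [+] C b)
| sym_constM a b : sym_eqv (C (a * b)) (C a [*] C b)
| sym_genD m n : sym_eqv (G (m + n)) (G m [+] G n)
| sym_genZ a m : sym_eqv (G (a *: m)) (C a [*] G m).

Definition sym_rel (x y : sym_expr) : bool := `[< sym_eqv x y >].

Lemma sym_rel_refl : reflexive sym_rel.
Proof. by move=> x; apply/asboolP; apply: sym_refl. Qed.

Lemma sym_rel_sym : symmetric sym_rel.
Proof. by move=> x y; apply/asboolP/asboolP; apply: sym_sym. Qed.

Lemma sym_rel_trans : transitive sym_rel.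
Proof.
by move=> y x z /asboolP e /asboolP f; apply/asboolP; apply: sym_trans e f.
Qed.

Canonical sym_equiv := EquivRel sym_rel sym_rel_refl sym_rel_sym sym_rel_trans.

Definition Sym := {eq_quot sym_equiv}.
HB.instance Definition _ := Choice.on Sym.

Definition sym_class (x : sym_expr) : Sym := \pi_Sym x.

Lemma sym_classP x y : sym_class x = sym_class y <-> sym_eqv x y.
Proof.
split=> [/eqP|e]; first by rewrite eqmodE => /asboolP.
by apply/eqP; rewrite eqmodE; apply/asboolP.
Qed.

Lemma sym_repr x : sym_eqv (repr (sym_class x)) x.
Proof. by apply/sym_classP; rewrite /sym_class reprK. Qed.

Lemma sym_classE (x : Sym) : exists y, x = sym_class y.
Proof. by elim/quotW: x => y; exists y. Qed.

Definition sym_add (x y : Sym) : Sym := sym_class (repr x [+] repr y).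
Definition sym_mul (x y : Sym) : Sym := sym_class (repr x [*] repr y).
Definition sym_const (a : R) : Sym := sym_class (C a).
Definition sym_gen (m : M) : Sym := sym_class (G m).
Definition sym_opp (x : Sym) : Sym := sym_mul (sym_const (-1)) x.
Definition sym_scale (a : R) (x : Sym) : Sym := sym_mul (sym_const a) x.

Lemma sym_addE x y : sym_add (sym_class x) (sym_class y) = sym_class (x [+] y).
Proof. by apply/sym_classP; apply: sym_congD; apply: sym_repr. Qed.

Lemma sym_mulE x y : sym_mul (sym_class x) (sym_class y) = sym_class (x [*] y).
Proof. by apply/sym_classP; apply: sym_congM; apply: sym_repr. Qed.

Lemma Sym_addA : associative sym_add.
Proof.
move=> x y z; have [[a ->] [b ->] [c ->]] :=
  And3 (sym_classE x) (sym_classE y) (sym_classE z).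
by rewrite !sym_addE; apply/sym_classP/sym_addA.
Qed.

Lemma Sym_addC : commutative sym_add.
Proof.
move=> x y; have [[a ->] [b ->]] := conj (sym_classE x) (sym_classE y).
by rewrite !sym_addE; apply/sym_classP/sym_addC.
Qed.

Lemma Sym_add0 : left_id (sym_const 0) sym_add.
Proof.
by move=> x; have [a ->] := sym_classE x; rewrite sym_addE; apply/sym_classP/sym_add0.
Qed.

Lemma Sym_mulA : associative sym_mul.
Proof.
move=> x y z; have [[a ->] [b ->] [c ->]] :=
  And3 (sym_classE x) (sym_classE y) (sym_classE z).
by rewrite !sym_mulE; apply/sym_classP/sym_mulA.
Qed.

Lemma Sym_mulC : commutative sym_mul.
Proof.
move=> x y; have [[a ->] [b ->]] := conj (sym_classE x) (sym_classE y).
by rewrite !sym_mulE; apply/sym_classP/sym_mulC.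
Qed.

Lemma Sym_mul1 : left_id (sym_const 1) sym_mul.
Proof.
by move=> x; have [a ->] := sym_classE x; rewrite sym_mulE; apply/sym_classP/sym_mul1.
Qed.

Lemma Sym_mul0 : left_zero (sym_const 0) sym_mul.
Proof.
by move=> x; have [a ->] := sym_classE x; rewrite sym_mulE; apply/sym_classP/sym_mul0.
Qed.

Lemma Sym_mulDl : left_distributive sym_mul sym_add.
Proof.
move=> x y z; have [[a ->] [b ->] [c ->]] :=
  And3 (sym_classE x) (sym_classE y) (sym_classE z).
by rewrite sym_addE !sym_mulE sym_addE; apply/sym_classP/sym_mulDl.
Qed.

Lemma Sym_constD a b : sym_const (a + b) = sym_add (sym_const a) (sym_const b).
Proof. by rewrite sym_addE; apply/sym_classP/sym_constD. Qed.

Lemma Sym_constM a b : sym_const (a * b) = sym_mul (sym_const a) (sym_const b).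
Proof. by rewrite sym_mulE; apply/sym_classP/sym_constM. Qed.

Lemma Sym_addN : left_inverse (sym_const 0) sym_opp sym_add.
Proof.
by move=> x; rewrite /sym_opp -{2}[x]Sym_mul1 -Sym_mulDl -Sym_constD addNr Sym_mul0.
Qed.

HB.instance Definition _ :=
  GRing.isZmodule.Build Sym Sym_addA Sym_addC Sym_add0 Sym_addN.

Fixpoint sym_eval (A : comNzRingType) (c : R -> A) (g : M -> A) (x : sym_expr)
    : A :=
  match x with
  | C a => c a
  | G m => g m
  | y [+] z => sym_eval c g y + sym_eval c g z
  | y [*] z => sym_eval c g y * sym_eval c g z
  end.

Lemma sym_eval_eqv (A : comNzRingType) (c : {rmorphism R -> A}) (g : M -> A) :
  (forall m n, g (m + n) = g m + g n) ->
  (forall a m, g (a *: m) = c a * g m) ->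
  forall x y, sym_eqv x y -> sym_eval c g x = sym_eval c g y.
Proof.
move=> gD gZ x y; elim=> //=.
- by move=> {}x {}y z _ -> _ ->.
- by move=> {}x x' {}y y' _ -> _ ->.
- by move=> {}x x' {}y y' _ -> _ ->.
- by move=> *; rewrite addrA.
- by move=> *; rewrite addrC.
- by move=> *; rewrite rmorph0 add0r.
- by move=> *; rewrite mulrA.
- by move=> *; rewrite mulrC.
- by move=> *; rewrite rmorph1 mul1r.
- by move=> *; rewrite rmorph0 mul0r.
- by move=> *; rewrite mulrDl.
- by move=> *; rewrite rmorphD.
- by move=> *; rewrite rmorphM.
Qed.

Lemma Sym_oner_neq0 : sym_const 1 != sym_const 0.
Proof.
apply/eqP => /sym_classP /(@sym_eval_eqv R idfun (fun=> 0)) /= e.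
by have /eqP := e (fun _ _ => esym (addr0 0)) (fun a _ => esym (mulr0 a));
  rewrite oner_eq0.
Qed.

HB.instance Definition _ := GRing.Zmodule_isComNzRing.Build Sym
  Sym_mulA Sym_mulC Sym_mul1 Sym_mulDl Sym_oner_neq0.

Lemma Sym_scaleA a b (x : Sym) :
  sym_scale a (sym_scale b x) = sym_scale (a * b) x.
Proof. by rewrite /sym_scale Sym_constM Sym_mulA. Qed.

Lemma Sym_scale1 : left_id 1 sym_scale.
Proof. exact: Sym_mul1. Qed.

Lemma Sym_scaleDr : right_distributive sym_scale +%R.
Proof. by move=> a x y; apply: mulrDr. Qed.

Lemma Sym_scaleDl (x : Sym) : {morph sym_scale^~ x : a b / a + b}.
Proof. by move=> a b; rewrite /sym_scale Sym_constD Sym_mulDl. Qed.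

HB.instance Definition _ := GRing.Zmodule_isLmodule.Build R Sym
  Sym_scaleA Sym_scale1 Sym_scaleDr Sym_scaleDl.

Lemma Sym_scaleAl (a : R) (x y : Sym) : a *: (x * y) = a *: x * y.
Proof. exact: Sym_mulA. Qed.

HB.instance Definition _ := GRing.Lmodule_isLalgebra.Build R Sym Sym_scaleAl.
HB.instance Definition _ := GRing.Lalgebra_isComAlgebra.Build R Sym.

Lemma sym_gen_is_linear : linear sym_gen.
Proof.
move=> a m n.
have -> : a *: sym_gen m + sym_gen n = sym_class (C a [*] G m [+] G n).
  by rewrite -sym_addE -sym_mulE.
apply/sym_classP/(sym_trans (sym_genD _ _)).
by apply: sym_congD; [apply: sym_genZ | apply: sym_refl].
Qed.

HB.instance Definition _ := GRing.isLinear.Build R M Sym _ sym_gen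
  sym_gen_is_linear.

Section Lift.
Variables (A : comAlgType R) (f : {linear M -> A}).

Definition sym_lift (x : Sym) : A := sym_eval (in_alg A) f (repr x).

Lemma sym_liftE x : sym_lift (sym_class x) = sym_eval (in_alg A) f x.
Proof.
apply: sym_eval_eqv (sym_repr x) => [m n|a m]; first exact: linearD.
by rewrite linearZZ mulr_algl.
Qed.

Lemma sym_lift_gen m : sym_lift (sym_gen m) = f m.
Proof. exact: sym_liftE. Qed.

Lemma sym_lift_is_linear : linear sym_lift.
Proof.
move=> a x y; have [[b ->] [c ->]] := conj (sym_classE x) (sym_classE y).
have -> : a *: sym_class b + sym_class c = sym_class (C a [*] b [+] c).
  by rewrite -sym_addE -sym_mulE.
by rewrite !sym_liftE /= mulr_algl.
Qed.

HB.instance Definition _ := GRing.isLinear.Build R Sym A _ sym_lift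
  sym_lift_is_linear.

Lemma sym_lift_is_monoid_morphism : monoid_morphism sym_lift.
Proof.
split=> [|x y]; first by rewrite sym_liftE /= scale1r.
have [[b ->] [c ->]] := conj (sym_classE x) (sym_classE y).
have -> : sym_class b * sym_class c = sym_class (b [*] c) by rewrite -sym_mulE.
by rewrite !sym_liftE.
Qed.

HB.instance Definition _ := GRing.isMonoidMorphism.Build Sym A sym_lift
  sym_lift_is_monoid_morphism.

Lemma sym_lift_unique (g : {lrmorphism Sym -> A}) :
  (forall m, g (sym_gen m) = f m) -> g =1 sym_lift.
Proof.
move=> gE x; have [y ->] := sym_classE x.
elim: y => [a|m|y IHy z IHz|y IHy z IHz].
- have -> : sym_class (C a) = a%:A by apply: esym (mulr1 (sym_const a)).
  by rewrite !linearZZ !rmorph1.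
- by rewrite gE sym_lift_gen.
- have -> : sym_class (y [+] z) = sym_class y + sym_class z.
    by rewrite -sym_addE.
  transitivity (g (sym_class y) + g (sym_class z)); first exact: raddfD.
  by rewrite IHy IHz; apply/esym/raddfD.
- have -> : sym_class (y [*] z) = sym_class y * sym_class z.
    by rewrite -sym_mulE.
  transitivity (g (sym_class y) * g (sym_class z)); first exact: rmorphM.
  by rewrite IHy IHz; apply/esym/rmorphM.
Qed.

End Lift.
End SymmetricAlgebra.

Definition projective (R : pzRingType) (P : lmodType R) : Prop :=
  forall (U V : lmodType R) (g : {linear U -> V}) (f : {linear P -> V}),
    (forall v, exists u, g u = v) ->
    exists h : {linear P -> U}, forall x, g (h x) = f x.

(* Finite generation is included in [projective_of_rank] below by convention;
   over a domain it follows from projectivity and finite rank. *)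
Definition finitely_generated (R : pzRingType) (P : lmodType R) : Prop :=
  exists (n : nat) (e : 'I_n -> P), forall x,
    exists a : 'I_n -> R, x = \sum_(i < n) a i *: e i.

Definition has_rank (R : comNzRingType) (P : lmodType R) (n : nat) : Prop :=
  forall p : prime_idealr R,
    exists f : {linear 'rV[loc_ring p]_n -> loc p P}, bijective f.

Definition projective_of_rank (R : comNzRingType) (P : lmodType R) (n : nat)
    : Prop :=
  [/\ finitely_generated P, projective P & has_rank P n].

Definition derivation (B : comPzRingType) (D : B -> B) : Prop :=
  (forall a b, D (a + b) = D a + D b) /\
  (forall a b, D (a * b) = D a * b + a * D b).

Definition locally_nilpotent (B : comPzRingType) (D : B -> B) : Prop :=
  forall b, exists n : nat, iter n D b = 0.

Definition Ker (B : comPzRingType) (D : B -> B) : set B := [set b | D b = 0].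

(* The first condition on b says that b is not a unit; no computable inverse is
   required of B. *)
Definition reducible (B : comPzRingType) (D : B -> B) : Prop :=
  exists b : B, (~ exists c, b * c = 1) /\ forall x, exists y, D x = b * y.

Definition irreducible (B : comPzRingType) (D : B -> B) : Prop := ~ reducible D.

Lemma loc_derivation (R : comNzRingType) (p : prime_idealr R) (B : comAlgType R)
    (D : {linear B -> B}) :
  derivation D -> derivation (loc_map p D).
Proof.
move=> [_ DM]; split=> [|x y]; first exact: linearD.
have [[a [s ->]] [b [t ->]]] := conj (fracE x) (fracE y).
rewrite fracM !loc_mapE DM (fracM (D a)) (fracM a) fracD.
apply: frac_eqW => /=; rewrite !scalerDr !scalerA.
by congr (_ *: _ + _ *: _); ring.
Qed.

(* Main.v *)
Require Import Defs.
From HB Require Import structures.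
From mathcomp Require Import all_boot all_order all_algebra.
From mathcomp Require Import ring_quotient boolp classical_sets.
From mathcomp Require Import ring zify.

(* Write B = Sym M and I = D(B)B. In a Noetherian domain grade(I) >= 2 means that
   no fraction outside B multiplies I into B, and grade(I) >= 3 is excluded (if
   I <> B) because I is locally generated by the two elements D x, D y, for x, y
   a local basis of M. Locally B = R[X, Y], and local nilpotence forces
   div D = 0, so D = F_Y d/dX - F_X d/dY for some F. If grade(I) >= 2 and D G = 0,
   then dG = P dF with P in B, and induction on the degree gives Ker D = R[F]
   locally; the local generators F normalized by F(0) = 0 then span an invertible
   module N with Ker D = Sym N. Conversely, if Ker D = R[F] locally, then
   irreducibility of D at p makes D a unit times F_Y d/dX - F_X d/dY. Over the
   fraction field K, grade(I) >= 2 follows from irreducibility since K[X, Y] is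
   factorial; modulo a nonzero a in R, McCoy's theorem reduces the claim to
   constants c with a | c dF, and then (c F - c F(0)) / a lies in Ker D = R[F],
   so that a | c. *)

Set Implicit Arguments.
Unset Strict Implicit.
Unset Printing Implicit Defensive.

Import GRing.Theory Defs.
Local Open Scope classical_set_scope.
Local Open Scope ring_scope.

(** * Ideals of Noetherian rings *)

(** Localized rings appear only where irreducibility or rank speaks of them. Every other local
    statement says that some t outside p makes t b have the wanted form; such statements are glued
    by [local_submodule], which rests on the fact that an ideal of R contained in no prime contains
    1. In the plane a multiplicative set W of denominators plays the same role. The obstacle in the
    converse is that R_p is merely a Noetherian domain, so prime factors are available only over K.
    A fraction u / v multiplying the ideal into B therefore first gets a denominator a in R, by
    factoriality of K[X, Y]; a is then removed as a whole, without being factored. Q enters through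
    antiderivatives, which turn dG = P dF into a polynomial in F, and through characteristic 0,
    which makes the order of local nilpotence additive on products. N is projective because it
    embeds in R as an ideal that is locally cyclic: its trace ideal is R, and in rank one this
    already gives a dual basis. *)

Section Ideals.
Variable A : comPzRingType.
Implicit Types (I J X : set A) (x y a : A) (s : seq A).

Lemma ideal_gen_is_ideal X : is_ideal (ideal_gen X).
Proof.
split=> [|x y Hx Hy|a x Hx] J [HJ XJ]; case: (HJ) => J0 JD JM //.
  by apply: JD; [apply: Hx | apply: Hy].
by apply: JM; apply: Hx.
Qed.

Lemma ideal_gen_sub X I : is_ideal I -> X `<=` I -> ideal_gen X `<=` I.
Proof. by move=> HI XI; apply: smallest_sub. Qed.

Lemma mem_ideal_gen X x : X x -> ideal_gen X x.
Proof. exact: sub_gen_smallest. Qed.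

Lemma ideal_sum (T : Type) (r : seq T) (P : pred T) (f : T -> A) I :
  is_ideal I -> (forall i, P i -> I (f i)) -> I (\sum_(i <- r | P i) f i).
Proof.
by case=> I0 ID _ fI; elim/big_ind: _ => // i Pi; apply: fI.
Qed.

Lemma ideal_opp I x : is_ideal I -> I x -> I (- x).
Proof. by case=> _ _ IM Ix; rewrite -mulN1r; apply: IM. Qed.

Lemma ideal_gen1P x y : ideal_gen [set` [:: x]] y <-> exists c, y = x * c.
Proof.
split=> [|[c ->]].
  apply: (@ideal_gen_sub _ [set y | exists c, y = x * c]).
    split=> [|_ _ [c ->] [d ->]|a _ [c ->]]; first by exists 0; rewrite mulr0.
      by exists (c + d); rewrite mulrDr.
    by exists (a * c); rewrite mulrCA.
  by move=> z /=; rewrite inE => /eqP ->; exists 1; rewrite mulr1.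
have [_ _ IM] := ideal_gen_is_ideal [set` [:: x]].
by rewrite mulrC; apply: IM; apply: mem_ideal_gen; rewrite /= inE.
Qed.

Lemma ideal_gen2P x y z :
  ideal_gen [set` [:: x; y]] z <-> exists c d, z = x * c + y * d.
Proof.
split=> [|[c [d ->]]].
  apply: (@ideal_gen_sub _ [set z | exists c d, z = x * c + y * d]).
    split=> [|_ _ [c [d ->]] [c' [d' ->]]|a _ [c [d ->]]].
    - by exists 0, 0; rewrite !mulr0 addr0.
    - by exists (c + c'), (d + d'); ring.
    - by exists (a * c), (a * d); ring.
  move=> w /=; rewrite !inE => /orP[] /eqP ->.
    by exists 1, 0; ring.
  by exists 0, 1; ring.
have [_ ID IM] := ideal_gen_is_ideal [set` [:: x; y]].
by apply: ID; rewrite mulrC; apply: IM; apply: mem_ideal_gen; rewrite /= !inE eqxx ?orbT.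
Qed.

Lemma ideal_gen0P x : ideal_gen [set` ([::] : seq A)] x <-> x = 0.
Proof.
split=> [|->]; last by have [] := ideal_gen_is_ideal [set` ([::] : seq A)].
apply: (@ideal_gen_sub _ [set 0]) => [|y //].
split=> [//|_ _ -> -> /=|a _ -> /=]; by rewrite ?addr0 ?mulr0.
Qed.

Lemma ideal_setT I : is_ideal I -> I 1 -> I = setT.
Proof.
case=> _ _ IM I1; apply/seteqP; split=> // x _.
by rewrite -[x]mulr1; apply: IM.
Qed.

Lemma noetherian_maximal (F : set (set A)) : noetherian A ->
  (forall I, F I -> is_ideal I) -> (exists I, F I) ->
  exists I, F I /\ forall J, F J -> I `<=` J -> J `<=` I.
Proof.
move=> An FI [I0 FI0].
(* The union of the empty chain is empty, so the empty set is adjoined to F. No ideal is empty,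
   hence it is not maximal once F is inhabited. *)
pose P I := I = set0 \/ F I.
have [C CP Ctot|I [PI Imax]] := @Zorn_bigcup _ P.
  case: (pselect (exists2 J0, C J0 & F J0)) => [[J0 CJ0 FJ0]|nC]; last first.
    left; apply/seteqP; split=> // x [J CJ Jx].
    case: (CP _ CJ) => [J0|FJ]; first by rewrite -J0.
    by case: nC; exists J.
  right; set U := \bigcup_(X in C) X.
  have FC J x : C J -> J x -> F J.
    by move=> CJ Jx; case: (CP _ CJ) => // J00; rewrite J00 in Jx.
  have IU : is_ideal U.
    split.
    - by exists J0 => //; have [] := FI _ FJ0.
    - move=> x y [J CJ Jx] [K CK Ky].
      have [JK|KJ] := Ctot J K CJ CK.
        by exists K => //; have [_ KD _] := FI _ (FC _ _ CK Ky); apply/KD/Ky/JK.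
      by exists J => //; have [_ JD _] := FI _ (FC _ _ CJ Jx); apply/JD/KJ.
    - move=> a x [J CJ Jx]; exists J => //.
      by have [_ _ JM] := FI _ (FC _ _ CJ Jx); apply: JM.
  have [s Us] := An _ IU.
  suff [J CJ [FJ sJ]] : exists2 J, C J & F J /\ [set` s] `<=` J.
    suff -> : U = J by [].
    apply/seteqP; split; last by move=> x Jx; exists J.
    by rewrite Us; apply: ideal_gen_sub => //; apply: FI.
  have : [set` s] `<=` U by rewrite Us; apply: sub_gen_smallest.
  elim: s {Us} => [|x s IHs] sU; first by exists J0.
  have [|J CJ [FJ sJ]] := IHs.
    by move=> y ys; apply: sU; rewrite /= inE; apply/orP; right.
  have [|K CK Kx] := sU x; first by rewrite /= inE eqxx.
  have [JK|KJ] := Ctot J K CJ CK.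
    exists K => //; split; first exact: FC Kx.
    by move=> y /=; rewrite inE => /orP[/eqP -> //|ys]; apply/JK/sJ.
  exists J => //; split=> // y /=; rewrite inE => /orP[/eqP ->|ys]; [exact: KJ|exact: sJ].
have {}FI1 : F I.
  case: PI => // I_0; case: (Imax I0); last by right.
  by rewrite I_0 properEneq; split=> //; apply/eqP => I00;
    have [] := FI _ FI0; rewrite -I00.
exists I; split=> // J FJ IJ; apply: contrapT => nJI.
by apply: (Imax J); [split | right].
Qed.

End Ideals.

Section PrimeIdeals.
Variable R : comNzRingType.

Lemma prime_idealr_exists (I : set R) : is_ideal I -> ~ I 1 ->
  (forall a b, I (a * b) -> I a \/ I b) ->
  exists p : prime_idealr R, forall x, x \in p <-> I x.
Proof.
move=> [I0 ID IM] I1 Ipr.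
pose S : R -> bool := fun x => `[< I x >].
have Sc : idealr_closed S.
  split; first by apply/asboolP.
    by apply/negP => /asboolP.
  move=> a u v /asboolP Hu /asboolP Hv.
  by apply/asboolP/ID => //; apply: IM.
have Sp : prime_idealr_closed S.
  by move=> u v /asboolP /Ipr[] H; apply/orP; [left|right]; apply/asboolP.
pose i1 := isIdealr.Build R S Sc.
pose i2 := isPrimeIdealrClosed.Build R S Sp.
pose p : prime_idealr R := HB.pack S i1 i2.
by exists p => x; split=> [/asboolP|H] //; apply/asboolP.
Qed.

(** If 1 were missing, an ideal maximal among the proper ideals above I would be prime, and no
    element of I would lie outside it. *)
Lemma ideal_unit_of_local (I : set R) : noetherian R -> is_ideal I ->
  (forall p : prime_idealr R, exists2 t, t \notin p & I t) -> I 1.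
Proof.
move=> Rn HI Hloc; apply: contrapT => I1.
pose F := [set J : set R | [/\ is_ideal J, I `<=` J & ~ J 1]].
have [J [[HJ IJ J1] Jmax]] : exists J, F J /\ forall K, F K -> J `<=` K -> K `<=` J.
  by apply: noetherian_maximal => // [J []|] //; exists I; split.
have [//|//| |p pJ] := @prime_idealr_exists J; last first.
  by have [t /negP tp /IJ/pJ] := Hloc p.
move=> a b Jab; apply: contrapT => /not_orP[nJa nJb].
have [J0 JD JM] := HJ.
have HK c : ~ J c -> exists x y, J x /\ 1 = x + y * c.
  move=> nJc; pose K := [set z | exists x y, J x /\ z = x + y * c].
  have KJ : J `<=` K by move=> x Jx; exists x, 0; split=> //; ring.
  apply: contrapT => K1; apply: nJc; apply: (Jmax K) => //.
    split=> //; last by move=> x /IJ/KJ.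
    split; first exact: KJ.
      move=> _ _ [x [y [Jx ->]]] [x' [y' [Jx' ->]]].
      by exists (x + x'), (y + y'); split; [apply: JD | ring].
    move=> u _ [x [y [Jx ->]]]; exists (u * x), (u * y); split; first exact: JM.
    by ring.
  by exists 0, 1; split=> //; ring.
have [x [y [Jx e]]] := HK _ nJa; have [x' [y' [Jx' e']]] := HK _ nJb.
apply: J1.
have -> : 1 = (x' + y' * b) * x + (y * a) * x' + (y * y') * (a * b) :> R.
  by rewrite -[LHS]mulr1 {1}e e'; ring.
by apply: (JD); [apply: (JD)|]; apply: (JM).
Qed.

End PrimeIdeals.

(** At this prime, local statements become statements over the fraction field. *)
Lemma zero_prime_idealr (R : idomainType) :
  exists p : prime_idealr R, forall x, x \in p <-> x = 0.
Proof.
apply: (@prime_idealr_exists R [set 0]).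
- by split=> [//|_ _ -> -> /=|a _ -> /=]; rewrite ?addr0 ?mulr0.
- by move=> /eqP; rewrite oner_eq0.
- by move=> a b /eqP; rewrite mulf_eq0 => /orP[] /eqP ->; [left|right].
Qed.

(** * Hilbert's basis theorem and Noetherianity of symmetric algebras *)

Section Hilbert.
Variable A : comNzRingType.

Lemma hilbert_basis : noetherian A -> noetherian {poly A}.
Proof.
move=> An J HJ; have [J0 JD JM] := HJ.
(* These ideals of leading coefficients increase with n, so they stabilize at some N; generators
   lifted from the degrees up to N generate J. *)
pose L n := [set a | exists f : {poly A}, [/\ J f, (size f <= n.+1)%N & f`_n = a]].
have L_ideal n : is_ideal (L n).
  split=> [|_ _ [f [Jf sf <-]] [g [Jg sg <-]]|a _ [f [Jf sf <-]]].
  - by exists 0; rewrite size_poly0 coef0.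
  - exists (f + g); rewrite coefD; split=> //; first exact: JD.
    by rewrite (leq_trans (size_polyD _ _)) // geq_max sf sg.
  - exists (a%:P * f); rewrite coefCM; split=> //; first exact: JM.
    by rewrite mul_polyC (leq_trans (size_scale_leq _ _)).
have L_mono n k : L n `<=` L (n + k)%N.
  move=> _ [f [Jf sf <-]]; exists ('X^k * f); split; first exact: JM.
    rewrite mulrC; apply: leq_trans (size_polyMleq _ _) _.
    by rewrite size_polyXn; lia.
  by rewrite coefXnM ltnNge leq_addl addnK.
have [_ [[N _ <-] Nmax]] : exists I, range L I /\
    forall K, range L K -> I `<=` K -> K `<=` I.
  apply: noetherian_maximal => //; first by move=> _ [n _ <-].
  by exists (L 0%N), 0%N.
have L_gen n : exists G : seq {poly A}, [set` G] `<=` J /\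
    forall a, L n a -> exists g, [/\ ideal_gen [set` G] g, (size g <= n.+1)%N & g`_n = a].
  have [s Ls] := An _ (L_ideal n).
  have /choice [F HF] : forall a, exists f : {poly A},
      L n a -> [/\ J f, (size f <= n.+1)%N & f`_n = a].
    move=> a; case: (pselect (L n a)) => [[f Hf]|nL]; first by exists f.
    by exists 0.
  have sL a : a \in s -> L n a by move=> sa; rewrite Ls; apply: mem_ideal_gen.
  exists (map F s); split.
    by move=> f /mapP[a /sL/HF[Jf _ _] ->].
  move=> a; rewrite Ls.
  apply: (@ideal_gen_sub _ _ [set a | exists g,
     [/\ ideal_gen [set` map F s] g, (size g <= n.+1)%N & g`_n = a]]) => {a} [|a sa].
    have [G0 GD GM] := ideal_gen_is_ideal [set` map F s].
    split=> [|_ _ [f [Jf sf <-]] [g [Jg sg <-]]|a _ [f [Jf sf <-]]].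
    - by exists 0; rewrite size_poly0 coef0.
    - exists (f + g); rewrite coefD; split=> //; first exact: GD.
      by rewrite (leq_trans (size_polyD _ _)) // geq_max sf sg.
    - exists (a%:P * f); rewrite coefCM; split=> //; first exact: GM.
      by rewrite mul_polyC (leq_trans (size_scale_leq _ _)).
  have [_ sF Fa] := HF _ (sL _ sa); exists (F a); split=> //.
  by apply: mem_ideal_gen; apply: map_f.
have [G [GJ HG]] : exists G : seq {poly A}, [set` G] `<=` J /\
    forall n, (n <= N)%N -> forall a, L n a ->
      exists g, [/\ ideal_gen [set` G] g, (size g <= n.+1)%N & g`_n = a].
  elim: N {Nmax} => [|N [G [GJ HG]]].
    have [G [GJ HG]] := L_gen 0%N; exists G; split=> // n.
    by rewrite leqn0 => /eqP ->.
  have [G' [GJ' HG']] := L_gen N.+1; exists (G ++ G'); split.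
    by move=> g /=; rewrite mem_cat => /orP[/GJ|/GJ'].
  have sub1 : [set` G] `<=` [set` G ++ G'] by move=> g /= gG; rewrite mem_cat gG.
  have sub2 : [set` G'] `<=` [set` G ++ G'].
    by move=> g /= gG; rewrite mem_cat gG orbT.
  move=> n; rewrite leq_eqVlt => /orP[/eqP ->|nN] a La.
    have [g [Gg sg ga]] := HG' _ La; exists g; split=> //.
    by apply: (ideal_gen_sub (ideal_gen_is_ideal _)) Gg => x /sub2/mem_ideal_gen.
  have [g [Gg sg ga]] := HG _ nN _ La; exists g; split=> //.
  by apply: (ideal_gen_sub (ideal_gen_is_ideal _)) Gg => x /sub1/mem_ideal_gen.
have HGi := ideal_gen_is_ideal [set` G]; have [G0 GD GM] := HGi.
have GJs := ideal_gen_sub HJ GJ.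
exists G; apply/seteqP; split=> // f.
have [n] := ubnP (size f); elim: n f => // n IHn f sf Jf.
have [->|f0] := eqVneq f 0; first exact: G0.
set m := (size f).-1; have fm : size f = m.+1 by rewrite prednK ?size_poly_gt0.
suff [g [Gg sg gm]] : exists g,
    [/\ ideal_gen [set` G] g, (size g <= m.+1)%N & g`_m = f`_m].
  rewrite -[f](subrK g); apply: (GD) => //; apply: IHn; last first.
    by apply: (JD) => //; apply: ideal_opp => //; apply: GJs.
  apply: leq_trans (_ : (m.+1 <= n)%N); last by lia.
  rewrite ltnS; apply/leq_sizeP => j; rewrite leq_eqVlt coefB => /orP[/eqP <-|mj].
    by rewrite gm subrr.
  by rewrite !nth_default ?subr0 ?fm ?(leq_trans sg).
have Lf : L m f`_m by exists f; rewrite fm.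
have [mN|Nm] := leqP m N; first exact: HG.
(* Beyond N the leading coefficient already occurs in degree N, and a power of X raises the degree
   again. *)
have LN : L N f`_m.
  apply: (Nmax (L m)) => //.
  by have := L_mono N (m - N)%N; rewrite subnKC // ltnW.
have [g [Gg sg gN]] := HG _ (leqnn N) _ LN.
exists ('X^(m - N) * g); split; first exact: GM.
  rewrite mulrC; apply: leq_trans (size_polyMleq _ _) _.
  by rewrite size_polyXn; lia.
by rewrite coefXnM ltnNge leq_subr /= subKn // ltnW.
Qed.

End Hilbert.

Lemma noetherian_surj (A : comNzRingType) (B : comNzRingType)
    (g : {rmorphism A -> B}) :
  (forall b, exists a, g a = b) -> noetherian A -> noetherian B.
Proof.
move=> gsurj An I HI; have [I0 ID IM] := HI.
have [s Is] : exists s : seq A, g @^-1` I = ideal_gen [set` s].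
  apply: An; split=> /= [|x y|a x]; rewrite ?rmorph0 ?rmorphD ?rmorphM //.
    exact: ID.
  exact: IM.
exists (map g s); have [G0 GD GM] := ideal_gen_is_ideal [set` map g s].
apply/seteqP; split=> [b Ib|].
  have [a ab] := gsurj b; rewrite -ab in Ib *.
  have : ideal_gen [set` s] a by rewrite -Is.
  apply: (@ideal_gen_sub _ _ (g @^-1` (ideal_gen [set` map g s]))) => [|x xs].
    split=> /= [|x y|c x]; rewrite ?rmorph0 ?rmorphD ?rmorphM //.
      exact: GD.
    exact: GM.
  by apply: mem_ideal_gen; apply: map_f.
apply: ideal_gen_sub => // _ /mapP[a sa ->].
have : (g @^-1` I) a by rewrite Is; apply: mem_ideal_gen.
by [].
Qed.

(** Polynomial variables are adjoined one at a time, each mapped to a generator of M, until an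
    iterated polynomial ring surjects onto [Sym M]. *)
Lemma sym_noetherian (R : comNzRingType) (M : lmodType R) :
  noetherian R -> finitely_generated M -> noetherian (Sym M).
Proof.
move=> Rn [n [e eM]].
have [A [An [g [gR ge]]]] : exists A : comNzRingType, noetherian A /\
    exists g : {rmorphism A -> Sym M}, (forall r : R, exists a, g a = r%:A) /\
      forall i : 'I_n, exists a, g a = sym_gen (e i).
  suff H : forall k, (k <= n)%N -> exists A : comNzRingType, noetherian A /\
    exists g : {rmorphism A -> Sym M}, (forall r : R, exists a, g a = r%:A) /\
      forall i : 'I_n, (i < k)%N -> exists a, g a = sym_gen (e i).
    have [A [An [g [gR ge]]]] := H n (leqnn n).
    by exists A; split=> //; exists g; split=> // i; apply: ge.
  elim=> [|k IHk] kn.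
    by exists R; split=> //; exists (in_alg (Sym M)); split=> // r; exists r.
  have [A [An [g [gR ge]]]] := IHk (ltnW kn).
  have cgu : commr_rmorph g (sym_gen (e (Ordinal kn))) by move=> x; apply: mulrC.
  exists {poly A}; split; first exact: hilbert_basis.
  exists (horner_morph cgu); split.
    by move=> r; have [a <-] := gR r; exists a%:P; rewrite /= horner_morphC.
  move=> i; rewrite ltnS leq_eqVlt => /orP[/eqP ik|ik].
    by exists 'X; rewrite /= horner_morphX; congr (sym_gen (e _)); apply: val_inj.
  by have [a <-] := ge i ik; exists a%:P; rewrite /= horner_morphC.
apply: (@noetherian_surj _ _ g) An => b; have [x ->] := sym_classE b.
elim: x => [r|m|y [a ga] z [b' gb]|y [a ga] z [b' gb]].
- have [a ga] := gR r; exists a; rewrite ga; exact: (mulr1 (sym_const M r)).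
- have [a ->] := eM m; rewrite -/(sym_gen _) linear_sum /=.
  have /choice [f gf] := ge; have /choice [h gh] := gR.
  exists (\sum_(i < n) h (a i) * f i); rewrite rmorph_sum; apply: eq_bigr => i _.
  by rewrite rmorphM gf gh mulr_algl -linearZ.
- by exists (a + b'); rewrite rmorphD ga gb -sym_addE.
- by exists (a * b'); rewrite rmorphM ga gb -sym_mulE.
Qed.

(** * Prime avoidance by maximal annihilators *)

Section RegularPair.
Variables (B : comPzRingType) (Bn : noetherian B) (I Q : set B).
Hypotheses (HI : is_ideal I) (HQ : is_ideal Q).
Hypothesis I_faithful : forall u, (forall y, I y -> Q (u * y)) -> Q u.

Let ann u := [set y | Q (u * y)].
Let max_ann u := ~ Q u /\ forall v, ~ Q v -> ann u `<=` ann v -> ann v `<=` ann u.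

Let ann_ideal u : is_ideal (ann u).
Proof.
have [Q0 QD QM] := HQ; rewrite /ann; split=> /= [|x y Hx Hy|a x Hx].
- by rewrite mulr0.
- by rewrite mulrDr; apply: QD.
- by rewrite mulrCA; apply: QM.
Qed.

(** If b does not annihilate u modulo Q, then u * b is outside Q and its annihilator contains that
    of u; by maximality the two agree, and a lies in the former. *)
Let max_ann_prime u a b : max_ann u -> ann u (a * b) -> ann u a \/ ann u b.
Proof.
have [Q0 QD QM] := HQ; move=> [nQu umax] uab.
case: (pselect (ann u b)) => [|nub]; first by right.
left; apply: (umax (u * b)) => // [y uy|]; rewrite /ann /=.
  by rewrite -mulrA mulrCA; apply: QM.
by rewrite -mulrA (mulrC b).
Qed.

Let max_ann_exists w : ~ Q w -> exists u, max_ann u /\ ann w `<=` ann u.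
Proof.
move=> nQw.
have [_ [[u [nQu wu ->]] umax]] : exists J,
    [set J | exists u, [/\ ~ Q u, ann w `<=` ann u & J = ann u]] J /\
    forall K, [set J | exists u, [/\ ~ Q u, ann w `<=` ann u & J = ann u]] K ->
      J `<=` K -> K `<=` J.
  apply: noetherian_maximal => //; first by move=> _ [u [_ _ ->]].
  by exists (ann w), w; split.
exists u; split=> //; split=> // v nQv uv; apply: umax => //.
by exists v; split=> // y /wu/uv.
Qed.

(* An element of I avoiding more and more maximal annihilators is built step by
   step. The ideals generated by the elements u with these annihilators strictly
   increase, so the process stops, at a nonzerodivisor. *)
Lemma nonzerodivisor_mod : exists2 y, I y & forall u, Q (y * u) -> Q u.
Proof.
have [Q0 QD QM] := HQ; have [I0 ID IM] := HI.
pose F := [set J : set B | exists (us : seq B) y,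
  [/\ J = ideal_gen [set` us], I y & forall u, u \in us -> max_ann u /\ ~ ann u y]].
have [_ [[us [y [-> Iy Hus]]] Jmax]] : exists J, F J /\
    forall K, F K -> J `<=` K -> K `<=` J.
  apply: noetherian_maximal => //.
    by move=> _ [us [y [-> _ _]]]; apply: ideal_gen_is_ideal.
  by exists (ideal_gen [set` ([::] : seq B)]), [::], 0; split=> // u; rewrite in_nil.
exists y => // w Qyw; apply: contrapT => nQw.
have [u [umax wu]] := max_ann_exists nQw.
have uy : ann u y by apply: wu; rewrite /ann /= mulrC.
(* No ann v with v in [us] is contained in ann u: by maximality they would be equal, but y lies only
   in ann u. The element c is a product of one witness for each v, kept outside ann u by
   primality. *)
have [c cus nuc] : exists2 c, (forall v, v \in us -> ann v c) & ~ ann u c.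
  have : {subset us <= us} by [].
  elim: {-2}us => [_|v vs IHvs vvs].
    exists 1; first by move=> v; rewrite in_nil.
    by rewrite /ann /= mulr1; case: umax.
  have [|c cvs nuc] := IHvs; first by move=> z zvs; apply: vvs; rewrite inE zvs orbT.
  have [vmax nvy] : max_ann v /\ ~ ann v y by apply/Hus/vvs; rewrite inE eqxx.
  have [d vd nud] : exists2 d, ann v d & ~ ann u d.
    apply: contrapT => nd; apply: nvy; apply: vmax.2 uy; first by case: umax.
    by move=> d vd; apply: contrapT => nud; apply: nd; exists d.
  exists (c * d).
    move=> z; rewrite inE => /orP[/eqP ->|/cvs zc].
      by have [_ _ M] := ann_ideal v; apply: M.
    by rewrite mulrC; have [_ _ M] := ann_ideal z; apply: M.
  by move=> /(max_ann_prime umax)[].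
have [z Iz nuz] : exists2 z, I z & ~ ann u z.
  apply: contrapT => nz; case: umax => nQu _; apply/nQu/I_faithful => z Iz.
  by apply: contrapT => nuz; apply: nz; exists z.
have ucz : ~ ann u (c * z) by move=> /(max_ann_prime umax)[].
have annB v a b : ann v (a + b) -> ann v b -> ann v a.
  have [_ vD _] := ann_ideal v; move=> vab vb.
  by rewrite -[a](addrK b); apply: (vD) => //; apply: ideal_opp.
(* The element y + c * z avoids ann u, which contains y but not c * z, and each ann v, which
   contains c * z but not y. Maximality of the ideal then puts u in it. *)
have uJ : ideal_gen [set` us] u.
  apply: (Jmax (ideal_gen [set` u :: us])).
  - exists (u :: us), (y + c * z); split=> //; first by apply: (ID) => //; apply: (IM).
    move=> v; rewrite inE => /orP[/eqP ->|vus].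
      by split=> //; rewrite addrC => /annB /(_ uy).
    have [vmax nvy] := Hus _ vus; split=> // /annB H; apply: nvy; apply: H.
    by have [_ _ M] := ann_ideal v; rewrite mulrC; apply: (M); apply: cus.
  - apply: ideal_gen_sub; first exact: ideal_gen_is_ideal.
    by move=> v vus; apply: mem_ideal_gen; rewrite /= inE; apply/orP; right.
  - by apply: mem_ideal_gen; rewrite /= inE eqxx.
(* Modulo Q, c annihilates [us], hence u as well, against its choice. *)
apply: nuc; rewrite /ann /=.
apply: (@ideal_gen_sub _ _ [set v | Q (v * c)] _ _ u uJ) => [|v /= /cus//].
split=> /= [|a b Ha Hb|a b Hb]; first by rewrite mul0r.
  by rewrite mulrDl; apply: QD.
by rewrite -mulrA; apply: QM.
Qed.

End RegularPair.

Lemma regular_seq2P (B : comPzRingType) (x y : B) :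
  regular_seq [:: x; y] <->
  [/\ forall u, x * u = 0 -> u = 0,
      forall u c, y * u = x * c -> exists d, u = x * d
    & ~ exists c d, 1 = x * c + y * d].
Proof.
split=> [[H H1]|[Hx Hy H1]].
  split=> [u xu|u c e|[c [d e]]].
  - by apply/ideal_gen0P; apply: (H 0%N) => //=; apply/ideal_gen0P.
  - by apply/ideal_gen1P; apply: (H 1%N) => //=; apply/ideal_gen1P; exists c.
  - by apply/H1/ideal_gen2P; exists c, d.
split; last by move/ideal_gen2P.
case=> [|[|//]] _ u /=.
  by move/ideal_gen0P/Hx ->; apply/ideal_gen0P.
by move/ideal_gen1P => [c /Hy H]; apply/ideal_gen1P.
Qed.

(** * Grade two in a Noetherian domain *)

Section Grade.
Variables (B : comPzRingType) (I : set B).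
Hypothesis B_domain : forall a b : B, a * b = 0 -> a = 0 \/ b = 0.
Hypothesis B_nontrivial : (1 : B) <> 0.
Hypothesis HI : is_ideal I.

(* For Noetherian B and I <> 0 this says that the grade of I is at least two. *)
Definition codivisor_free := forall u v : B, v <> 0 ->
  (forall y, I y -> exists c, u * y = v * c) -> exists c, u = v * c.

Lemma mulI_domain (a b c : B) : a <> 0 -> a * b = a * c -> b = c.
Proof.
move=> a0 e; have /B_domain[//|/eqP] : a * (b - c) = 0 by rewrite mulrBr e subrr.
by rewrite subr_eq0 => /eqP.
Qed.

(** For a regular sequence x, y in I, u x = v c1 and u y = v c2 give y c1 = x c2. So x divides c1,
    and the quotient is u / v. *)
Lemma grade_codivisor_free :
  grade_is I (Some 2) \/ grade_is I None -> codivisor_free.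
Proof.
move=> H u v v0 uv; case: H => [[_ [s [[Hreg sI _] ss]]]|IT]; last first.
  by have [|c] := uv 1; [rewrite IT | rewrite mulr1 => ->; exists c].
case: s ss Hreg sI => [|x [|y []]] //= _ Hreg sI.
have /regular_seq2P[Hx Hy _] := Hreg.
have [c1 e1] : exists c, u * x = v * c by apply/uv/sI; rewrite /= inE eqxx.
have [c2 e2] : exists c, u * y = v * c by apply/uv/sI; rewrite /= !inE eqxx orbT.
have x0 : x <> 0 by move=> x0; apply/B_nontrivial/Hx; rewrite x0 mul0r.
have /Hy[d e] : y * c1 = x * c2.
  by apply: (mulI_domain v0); rewrite mulrCA -e1 mulrCA mulrC -mulrA (mulrCA v) -e2; ring.
by exists d; apply: (mulI_domain x0); rewrite mulrC e1 e mulrCA.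
Qed.

(* If H_1(a, b; B/x) = 0 then x annihilating H_0 forces H_0(a, b; B) = 0; here
   everything is tracked up to powers of s. *)
Lemma koszul_two_generators (a b s x y z : B) :
  regular_seq [:: x; y; z] ->
  (forall w, w \in [:: x; y; z] -> exists c d, s * w = a * c + b * d) ->
  exists c d, s ^+ 3 = a * c + b * d.
Proof.
move=> [H _] sab.
have Hx u : x * u = 0 -> u = 0.
  by move=> xu; apply/ideal_gen0P; apply: (H 0%N) => //=; apply/ideal_gen0P.
have Hy u c : y * u = x * c -> exists d, u = x * d.
  by move=> e; apply/ideal_gen1P; apply: (H 1%N) => //=; apply/ideal_gen1P; exists c.
have Hz u c d : z * u = x * c + y * d -> exists c d, u = x * c + y * d.
  by move=> e; apply/ideal_gen2P; apply: (H 2%N) => //=; apply/ideal_gen2P; exists c, d.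
have [x1 [x2 ex]] : exists c d, s * x = a * c + b * d by apply: sab; rewrite inE eqxx.
have [y1 [y2 ey]] : exists c d, s * y = a * c + b * d.
  by apply: sab; rewrite !inE eqxx orbT.
have [z1 [z2 ez]] : exists c d, s * z = a * c + b * d.
  by apply: sab; rewrite !inE eqxx !orbT.
(* By Cramer's rule a w and b w lie in the ideal (x, y), hence so does z (s w); regularity then puts
   s w there. *)
pose w := y2 * x1 - y1 * x2.
have ew1 : b * w = y * (s * x1) - x * (s * y1).
  have -> : y * (s * x1) = (s * y) * x1 by ring.
  have -> : x * (s * y1) = (s * x) * y1 by ring.
  by rewrite ex ey /w; ring.
have ew2 : a * w = x * (s * y2) - y * (s * x2).
  have -> : y * (s * x2) = (s * y) * x2 by ring.
  have -> : x * (s * y2) = (s * x) * y2 by ring.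
  by rewrite ex ey /w; ring.
have [w1 [w2 ew]] : exists c d, s * w = x * c + y * d.
  apply: (Hz _ (z1 * s * y2 - z2 * s * y1) (z2 * s * x1 - z1 * s * x2)).
  have -> : z * (s * w) = (s * z) * w by ring.
  rewrite ez; have -> : (a * z1 + b * z2) * w = z1 * (a * w) + z2 * (b * w) by ring.
  by rewrite ew1 ew2; ring.
(* Multiples of the Koszul relation (b, -a) do not change a x1 + b x2. Subtracting w2 times it from
   s^2 (x1, x2) makes both entries divisible by x, which is finally cancelled from s^3 x. *)
have [p ep] : exists p, s * s * x1 - b * w2 = x * p.
  apply: (Hy _ (b * w1 + s * s * y1)).
  have -> : y * (s * s * x1 - b * w2) = s * (y * (s * x1)) - b * (y * w2) by ring.
  have -> : y * (s * x1) = b * w + x * (s * y1) by rewrite ew1; ring.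
  have -> : s * (b * w + x * (s * y1)) = b * (s * w) + x * (s * s * y1) by ring.
  by rewrite ew; ring.
have [q eq] : exists q, s * s * x2 + a * w2 = x * q.
  apply: (Hy _ (s * s * y2 - a * w1)).
  have -> : y * (s * s * x2 + a * w2) = s * (y * (s * x2)) + a * (y * w2) by ring.
  have -> : y * (s * x2) = x * (s * y2) - a * w by rewrite ew2; ring.
  have -> : s * (x * (s * y2) - a * w) = x * (s * s * y2) - a * (s * w) by ring.
  by rewrite ew; ring.
exists p, q; apply/eqP; rewrite -subr_eq0; apply/eqP/Hx.
have -> : x * (s ^+ 3 - (a * p + b * q)) = s * s * (s * x) - a * (x * p) - b * (x * q).
  by ring.
by rewrite -ep -eq ex; ring.
Qed.

(** For a nonzero x in I, [codivisor_free] with v = x is the faithfulness that [nonzerodivisor_mod]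
    needs to find y; the last hypothesis makes x, y maximal. *)
Lemma codivisor_free_grade : noetherian B ->
  codivisor_free -> (exists2 x, I x & x <> 0) ->
  (forall x y z, [set` [:: x; y; z]] `<=` I -> regular_seq [:: x; y; z] -> I 1) ->
  grade_is I (Some 2) \/ grade_is I None.
Proof.
move=> Bn Icf [x Ix x0] no3.
have [I1|nI1] := pselect (I 1); first by right; apply: ideal_setT.
left; split; first by move=> IT; apply: nI1; rewrite IT.
have [y Iy Hy] : exists2 y, I y & forall u, ideal_gen [set` [:: x]] (y * u) ->
    ideal_gen [set` [:: x]] u.
  apply: nonzerodivisor_mod => //; first exact: ideal_gen_is_ideal.
  move=> u Hu; apply/ideal_gen1P; apply: Icf => // y Iy.
  by apply/ideal_gen1P; apply: Hu.
have [_ ID IM] := HI.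
exists [:: x; y]; split=> //; split.
- apply/regular_seq2P; split=> [u xu|u c e|].
  - by case: (B_domain xu).
  - by apply/ideal_gen1P; apply: Hy; apply/ideal_gen1P; exists c.
  - by move=> [c [d e]]; apply: nI1; rewrite e; apply: ID; rewrite mulrC; apply: IM.
- by move=> z /=; rewrite !inE => /orP[] /eqP ->.
- move=> z Iz reg; apply/nI1/(no3 x y z) => // w /=.
  by rewrite !inE => /or3P[] /eqP ->.
Qed.

End Grade.

(** * McCoy's theorem and Gauss's lemma *)

(** Induction on the size of w. If some w_j (f a)_i is outside T, take i largest for this a; then T
    contains (f a)_i times the leading coefficient of w. Hence (f a)_i w without its top term is
    shorter and still multiplies the family into T. Families are allowed so that the theorem can be
    iterated over two variables. *)
Lemma mccoy (A : comNzRingType) (T : set A) (Ix : Type) (f : Ix -> {poly A}) :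
  is_ideal T ->
  (forall c, (forall a i, T (c * (f a)`_i)) -> T c) ->
  forall w, (forall a i, T (w * f a)`_i) -> forall i, T w`_i.
Proof.
move=> HT Tf w; have [T0 TD TM] := HT.
have [n] := ubnP (size w); elim: n w => // n IHn w; rewrite ltnS => sw Tw.
case: (pselect (forall a i j, T (w`_j * (f a)`_i))) => [H j|].
  by apply: Tf => a i; apply: H.
move=> /existsNP[a /existsNP[i0 /existsNP[j0 nT]]]; exfalso.
pose P i := `[< exists j, ~ T (w`_j * (f a)`_i) >].
have Pi0 : exists i, P i by exists i0; apply/asboolP; exists j0.
have Pb i : P i -> (i <= size (f a))%N.
  move=> /asboolP[j]; apply: contra_notT; rewrite -ltnNge => si.
  by rewrite [(f a)`_i]nth_default ?mulr0 ?(ltnW si).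
have [i /asboolP[j nTj] imax] := ex_maxnP Pi0 Pb.
have TP k j' : (i < k)%N -> T (w`_j' * (f a)`_k).
  move=> ik; apply: contrapT => nTk.
  by have /imax : P k by [apply/asboolP; exists j']; rewrite leqNgt ik.
case: n IHn sw => [|m] IHn sw.
  by move: sw; rewrite leqn0 size_poly_eq0 => /eqP w0; apply: nTj; rewrite w0 coef0 mul0r.
have Tlead : T (w`_m * (f a)`_i).
  have := Tw a (m + i)%N; rewrite coefM.
  have mlt : (m < (m + i).+1)%N by lia.
  rewrite (bigD1 (Ordinal mlt)) //= addKn; set rest := (\sum_(_ | _) _) => H.
  rewrite -[_ * _](addrK rest); apply: (TD) => //; apply: ideal_opp => //.
  apply: ideal_sum => // k /eqP km.
  have {}km : (k : nat) <> m by move=> e; apply: km; apply: val_inj.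
  have [kltm|mltk] : (k < m \/ m < k)%N by lia.
    by apply: TP; lia.
  by rewrite [w`_k]nth_default ?mul0r ?(leq_trans sw).
pose w' := (f a)`_i *: w - ((f a)`_i * w`_m) *: 'X^m.
have w'E k : w'`_k = if k == m then 0 else (f a)`_i * w`_k.
  rewrite coefB !coefZ coefXn; case: eqVneq => [->|_]; first by rewrite mulr1 subrr.
  by rewrite mulr0 subr0.
apply: nTj; have [->//|jm] := eqVneq j m.
have -> : w`_j * (f a)`_i = w'`_j by rewrite w'E (negPf jm) mulrC.
apply: IHn.
  rewrite ltnS; apply/leq_sizeP => k mk; rewrite w'E; case: eqVneq => // km.
  by rewrite [w`_k]nth_default ?mulr0 ?(leq_trans sw) // ltn_neqAle eq_sym km mk.
move=> b k; rewrite mulrBl coefB -scalerAl coefZ; apply: TD.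
  by apply: TM; apply: Tw.
apply: ideal_opp => //; rewrite -scalerAl coefZ mulrC; apply: TM.
by rewrite mulrC.
Qed.

Section Divisibility.
Variables (A : idomainType) (W : set A).

(* Divisibility in the localization of [A] at the multiplicative set [W]. *)
Definition dvdW (x y : A) := exists2 w, W w & exists c, w * y = x * c.

Definition primeW (x : A) := [/\ x != 0, ~ dvdW x 1 &
  forall a b, dvdW x (a * b) -> dvdW x a \/ dvdW x b].

(* [mu] plays the role of a degree, which makes factorization terminate; the
   last clause then expresses that the localization of [A] at [W] is factorial. *)
Definition factorialW (mu : A -> nat) := [/\ W 1 /\ (forall a b, W a -> W b -> W (a * b)),
  forall w, W w -> w != 0 /\ mu w = 0%N,
  forall a b, a != 0 -> b != 0 -> mu (a * b) = (mu a + mu b)%N,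
  forall a, a != 0 -> mu a = 0%N -> dvdW a 1 &
  forall a, a != 0 -> (0 < mu a)%N -> exists2 x, primeW x & dvdW x a].

Hypothesis W1 : W 1.
Hypothesis WM : forall a b, W a -> W b -> W (a * b).

Lemma dvdW_mulr x c : dvdW x (x * c).
Proof. by exists 1 => //; exists c; rewrite mul1r. Qed.

Lemma dvdW_refl x : dvdW x x.
Proof. by rewrite -{2}[x]mulr1; apply: dvdW_mulr. Qed.

Lemma dvdW_trans y x z : dvdW x y -> dvdW y z -> dvdW x z.
Proof.
move=> [w Ww [c e]] [w' Ww' [c' e']]; exists (w * w'); first exact: WM.
by exists (c * c'); rewrite -mulrA e' mulrA e mulrA.
Qed.

Lemma dvdW_add x y z : dvdW x y -> dvdW x z -> dvdW x (y + z).
Proof.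
move=> [w Ww [c e]] [w' Ww' [c' e']]; exists (w * w'); first exact: WM.
exists (w' * c + w * c').
have -> : w * w' * (y + z) = w' * (w * y) + w * (w' * z) by ring.
by rewrite e e'; ring.
Qed.

Lemma dvdW_mull x y c : dvdW x y -> dvdW x (c * y).
Proof. by move=> xy; apply: dvdW_trans xy _; rewrite mulrC; apply: dvdW_mulr. Qed.

Lemma dvdW_elim w x y : W w -> dvdW x (w * y) -> dvdW x y.
Proof.
move=> Ww [w' Ww' [c e]]; exists (w' * w); first exact: WM.
by exists c; rewrite -mulrA.
Qed.

(** A prime factor of v divides u U and u V but not both U and V, so it divides u and can be
    cancelled from u and v, which lowers mu v. *)
Lemma dvdW_coprime mu U V : factorialW mu ->
  (forall x, primeW x -> dvdW x U -> dvdW x V -> False) ->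
  forall u v, v != 0 -> dvdW v (u * U) -> dvdW v (u * V) -> dvdW v u.
Proof.
move=> [_ W0 muM mu0 mupr] UV u v; have [n] := ubnP (mu v).
elim: n u v => // n IHn u v; rewrite ltnS => mun v0 vU vV.
have [muv|muv] := posnP (mu v).
  by have := dvdW_mull u (mu0 _ v0 muv); rewrite mulr1.
have [x xpr xv] := mupr _ v0 muv; have [x0 xn1 xM] := xpr.
have [w Ww [v' ev]] := xv.
have [w0 muw] := W0 _ Ww.
have xu : dvdW x u.
  have /xM[//|xU] := dvdW_trans xv vU; have /xM[//|xV] := dvdW_trans xv vV.
  by case: (UV x).
have [w' Ww' [u' eu]] := xu.
have v'0 : v' != 0.
  by apply: contra_eqN ev => /eqP ->; rewrite mulr0 mulf_neq0.
have lt_mu : (mu v' < n)%N.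
  have := muM _ _ w0 v0; rewrite ev muM // muw.
  suff : (0 < mu x)%N by lia.
  by rewrite lt0n; apply/eqP => mux; apply: xn1; apply: mu0.
have red Z : dvdW v (u * Z) -> dvdW v' (u' * Z).
  move=> [w2 Ww2 [c e]]; exists (w * w2); first exact: WM.
  exists (w' * c); apply: (mulfI x0).
  have -> : x * (w * w2 * (u' * Z)) = w * w2 * (x * u') * Z by ring.
  have -> : x * (v' * (w' * c)) = w' * (x * v') * c by ring.
  rewrite -eu -ev.
  have -> : w * w2 * (w' * u) * Z = w * w' * (w2 * (u * Z)) by ring.
  by rewrite e; ring.
have [w5 Ww5 [e He]] := IHn _ _ lt_mu v'0 (red _ vU) (red _ vV).
exists (w5 * w'); first exact: WM.
exists (w * e); have -> : w5 * w' * u = w5 * (w' * u) by ring.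
rewrite eu; have -> : w5 * (x * u') = x * (w5 * u') by ring.
by rewrite He mulrA -ev; ring.
Qed.

End Divisibility.

(** * Gauss's lemma up to denominators *)

Section GaussLemma.
Variables (A : idomainType) (W : set A) (mu : A -> nat).
Hypothesis AW : factorialW W mu.

Let W1 : W 1. Proof. by case: AW => -[]. Qed.
Let WM a b : W a -> W b -> W (a * b). Proof. by case: AW => -[_ H] *; apply: H. Qed.
Let W_neq0 w : W w -> w != 0. Proof. by case: AW => _ H _ _ _ /H[]. Qed.
Let muW w : W w -> mu w = 0%N. Proof. by case: AW => _ H _ _ _ /H[]. Qed.
Let muM (a b : A) : a != 0 -> b != 0 -> mu (a * b) = (mu a + mu b)%N.
Proof. by case: AW => _ _ H _ _; apply: H. Qed.
Let mu0 (a : A) : a != 0 -> mu a = 0%N -> dvdW W a 1.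
Proof. by case: AW => _ _ _ H _; apply: H. Qed.
Let mu_prime (a : A) : a != 0 -> (0 < mu a)%N -> exists2 x, primeW W x & dvdW W x a.
Proof. by case: AW => _ _ _ _ H; apply: H. Qed.
Let mu_prime_gt0 x : primeW W x -> (0 < mu x)%N.
Proof.
by move=> [x0 xn1 _]; rewrite lt0n; apply/eqP => mux; apply: xn1; apply: mu0.
Qed.

Let WX : set {poly A} := polyC @` W.

Let WX1 : WX 1. Proof. by exists 1. Qed.
Let WXM p q : WX p -> WX q -> WX (p * q).
Proof.
by move=> [a Wa <-] [b Wb <-]; exists (a * b); rewrite ?polyCM //; apply: WM.
Qed.
Let WXC w : W w -> WX w%:P. Proof. by exists w. Qed.
Hint Resolve WX1 WXM WXC : core.

Local Notation d := (dvdW W).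
Local Notation D := (dvdW WX).

Let dvdC (a : A) (p : {poly A}) : D a%:P p <-> forall i, d a p`_i.
Proof.
split=> [[_ [w Ww <-] [c e]] i|].
  by exists w => //; exists c`_i; rewrite -!coefCM e.
elim/poly_ind: p => [|p c IHp] H.
  by exists 1 => //; exists 0; rewrite !mulr0.
apply: dvdW_add => //.
  rewrite mulrC; apply: dvdW_mull => //; apply: IHp => i.
  by have := H i.+1; rewrite coefD coefMX coefC /= addr0.
have := H 0%N; rewrite coefD coefMX coefC /= add0r => -[w Ww [c' e]].
by exists w%:P; [exact: WXC | exists c'%:P; rewrite -!polyCM e].
Qed.

(** McCoy applies modulo the multiples of x: as x is prime, a coefficient of q not divisible by x is
    a nonzerodivisor there. *)
Let primeC x : primeW W x -> primeW WX x%:P.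
Proof.
move=> [x0 xn1 xM]; split; first by rewrite polyC_eq0.
  by move=> /dvdC/(_ 0%N); rewrite coefC.
move=> p q xpq; case: (pselect (D x%:P q)) => [|nxq]; first by right.
left; apply/dvdC; pose T := [set a | d x a].
apply: (@mccoy _ T unit (fun=> q)).
- split=> /= [|a b|a b]; first by exists 1 => //; exists 0; rewrite !mulr0.
    exact: dvdW_add.
  exact: dvdW_mull.
- move=> c Hc; have /existsNP[i nxi] : ~ forall i, d x q`_i by move/dvdC.
  by have /xM[] := Hc tt i.
- by move=> _; apply/dvdC.
Qed.

Let primitive (p : {poly A}) := forall x, primeW W x -> ~ D x%:P p.

(** By [primeC] each prime factor of c divides q or r, and dividing it out preserves sizes. *)
Let split_const (c : A) (p q r : {poly A}) : c != 0 -> p != 0 -> c%:P * p = q * r ->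
  exists w q' r', [/\ WX w, w * p = q' * r', D q' q, D r' r &
    size q' = size q /\ size r' = size r].
Proof.
have [n] := ubnP (mu c); elim: n c p q r => // n IHn c p q r; rewrite ltnS.
move=> mun c0 p0 e.
have [q0 r0] : q != 0 /\ r != 0.
  have : q * r != 0 by rewrite -e mulf_neq0 ?polyC_eq0.
  by rewrite mulf_eq0 negb_or => /andP.
have [muc|muc] := posnP (mu c).
  have [w Ww [z]] := mu0 c0 muc; rewrite mulr1 => ew.
  have z0 : z != 0 by apply: contraTneq (W_neq0 Ww) => z0; rewrite ew z0 mulr0 eqxx.
  exists w%:P, (z%:P * q), r; split; [exact: WXC| | |exact: dvdW_refl|].
  - by rewrite ew polyCM mulrAC e; ring.
  - by exists w%:P; [exact: WXC | exists c%:P; rewrite ew polyCM; ring].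
  - by rewrite mul_polyC size_scale.
have [x xpr [w Ww [c' ec]]] := mu_prime c0 muc.
have [x0 _ _] := xpr; have [_ _ xXM] := primeC xpr.
have c'0 : c' != 0.
  by apply: contra_eqN ec => /eqP ->; rewrite mulr0 mulf_neq0 // W_neq0.
have muc' : (mu c' < n)%N.
  have := muM (W_neq0 Ww) c0; rewrite ec muM // (muW Ww).
  by have := mu_prime_gt0 xpr; lia.
have step q1 r1 : c%:P * p = q1 * r1 -> q1 != 0 -> D x%:P q1 -> exists w q' r',
    [/\ WX w, w * p = q' * r', D q' q1, D r' r1 & size q' = size q1 /\ size r' = size r1].
  move=> e1 q10 [_ [w1 Ww1 <-] [q2 e2]].
  have w10 := W_neq0 Ww1.
  have [||||w' [q' [r' [Ww' ew' Dq' Dr' [sq sr]]]]] := IHn (w1 * c') p (w%:P * q2) r1.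
  - by rewrite muM // (muW Ww1).
  - by rewrite mulf_neq0.
  - by [].
  - apply: (@mulfI _ x%:P); first by rewrite polyC_eq0.
    have -> : x%:P * ((w1 * c')%:P * p) = w1%:P * ((x * c')%:P * p).
      by rewrite !polyCM; ring.
    have -> : x%:P * (w%:P * q2 * r1) = w%:P * (x%:P * q2) * r1 by ring.
    by rewrite -ec -e2 polyCM -mulrA e1; ring.
  exists w', q', r'; split=> //.
    apply: (dvdW_trans WXM) Dq' _; exists (w%:P * w1%:P).
      by apply: WXM; apply: WXC.
    exists x%:P; have -> : w%:P * w1%:P * q1 = w%:P * (w1%:P * q1) by ring.
    by rewrite e2; ring.
  split=> //; rewrite sq mul_polyC size_scale ?W_neq0 //.
  by rewrite -[RHS](size_scale _ w10) -[w1 *: q1]mul_polyC e2 mul_polyC size_scale.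
have /xXM[xq|xr] : D x%:P (q * r).
- exists w%:P; [exact: WXC|exists (c'%:P * p)].
  by rewrite -e !mulrA -!polyCM ec.
- exact: step.
- rewrite mulrC in e.
  have [w' [r' [q' [Ww' e' Dr Dq [sr sq]]]]] :=
    step r q (eq_trans (mulrC _ _) (eq_trans e (mulrC _ _))) r0 xr.
  by exists w', q', r'; split=> //; rewrite e' mulrC.
Qed.

(** In an equation w c b = x q a prime factor of c cannot divide the primitive x, so it divides q
    and cancels. *)
Let cancel_const (x : {poly A}) (c : A) (b : {poly A}) :
  primitive x -> c != 0 -> D x (c%:P * b) -> D x b.
Proof.
move=> xprim; have [n] := ubnP (mu c); elim: n c b => // n IHn c b; rewrite ltnS.
move=> mun c0 xcb; have [muc|muc] := posnP (mu c).
  have [w Ww [z]] := mu0 c0 muc; rewrite mulr1 => ew.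
  apply: (dvdW_elim WXM (WXC Ww)); rewrite ew mulrC polyCM mulrC mulrAC mulrC.
  exact: dvdW_mull.
have [y ypr [w Ww [c' ec]]] := mu_prime c0 muc.
have [y0 _ _] := ypr; have [_ _ yXM] := primeC ypr.
have c'0 : c' != 0.
  by apply: contra_eqN ec => /eqP ->; rewrite mulr0 mulf_neq0 // W_neq0.
have muc' : (mu c' < n)%N.
  have := muM (W_neq0 Ww) c0; rewrite ec muM // (muW Ww).
  by have := mu_prime_gt0 ypr; lia.
have [w2 Ww2 [q e2]] := xcb.
have /yXM[/(xprim _ ypr)//|[w3 Ww3 [q' e3]]] : D y%:P (x * q).
  rewrite -e2; exists w%:P; first exact: WXC.
  by exists (c'%:P * (w2 * b)); rewrite !mulrA mulrAC -polyCM mulrC mulrA mulrC -ec polyCM; ring.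
apply: (IHn c') => //; exists (w3 * w2); first exact: WXM.
exists (w%:P * q'); apply: (@mulfI _ y%:P); first by rewrite polyC_eq0.
have -> : y%:P * (x * (w%:P * q')) = w%:P * x * (y%:P * q') by ring.
rewrite -e3; have -> : w%:P * x * (w3 * q) = w%:P * w3 * (x * q) by ring.
rewrite -e2; have -> : y%:P * (w3 * w2 * (c'%:P * b)) = w3 * w2 * ((y * c')%:P * b).
  by rewrite polyCM; ring.
by rewrite -ec polyCM; ring.
Qed.

(** Both summands are additive on products, as [factorialW] requires. *)
Definition mu_poly (p : {poly A}) := ((size p).-1 + mu (lead_coef p))%N.

(** The prime is a divisor x of v of least size among the nonconstant ones; like v, it is
    primitive. *)
Let prime_divisor_primitive (v : {poly A}) : v != 0 -> (1 < size v)%N -> primitive v ->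
  exists2 x, primeW WX x & D x v.
Proof.
move=> v0 sv vprim.
pose P n := `[< exists x, [/\ D x v, size x = n & (1 < n)%N] >].
have exP : exists n, P n.
  by exists (size v); apply/asboolP; exists v; split=> //; apply: dvdW_refl.
have [n /asboolP[x [xv sx n1]] nmin] := ex_minnP exP.
have x0 : x != 0 by rewrite -size_poly_gt0 sx; lia.
have xmin g : D g x -> (1 < size g)%N -> (size x <= size g)%N.
  move=> gx sg; rewrite sx; apply: nmin; apply/asboolP; exists g; split=> //.
  exact: dvdW_trans gx xv.
have xprim : primitive x by move=> y ypr yx; apply: (vprim _ ypr); apply: dvdW_trans yx xv.
exists x => //; split=> //.
  move=> [_ [w Ww <-] [c e]]; rewrite mulr1 in e.
  have c0 : c != 0.
    by apply: contraTneq (W_neq0 Ww) => c0; move/eqP: e; rewrite c0 mulr0 polyC_eq0 => ->.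
  have := congr1 (fun p : {poly A} => size p) e; rewrite size_mul // size_polyC (W_neq0 Ww) /= sx.
  by rewrite (polySpred c0) addnS /=; lia.
move=> a b xab; case: (pselect (D x a)) => [|nxa]; [by left | right].
(* A nonzero element r of least size in the ideal (x, a) replaces a gcd: by pseudo-division it
   divides every member up to a nonzero constant factor. *)
pose I := [set f | exists y z, f = y * x + z * a].
pose Q n := `[< exists r, [/\ I r, r != 0 & size r = n] >].
have exQ : exists n, Q n.
  exists (size x); apply/asboolP; exists x; split=> //.
  by exists 1, 0; rewrite mul1r mul0r addr0.
have [m /asboolP[r [[y [z er]] r0 sr]] mmin] := ex_minnP exQ.
have Ir f : I f -> exists c q, c != 0 /\ c%:P * f = q * r.
  move=> [f1 [f2 ef]]; exists (lead_coef r ^+ scalp f r), (f %/ r)%R.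
  split; first by rewrite expf_neq0 // lead_coef_eq0.
  have e := Pdiv.Idomain.divp_eq f r; rewrite mul_polyC e.
  suff -> : f %% r = 0 by rewrite addr0.
  apply/eqP; apply: contraT => rem0.
  have : (size (f %% r)%R < m)%N by rewrite -sr ltn_modp.
  rewrite ltnNge => /negP[]; apply: mmin; apply/asboolP; exists (f %% r); split=> //.
  set k := lead_coef r ^+ _ in e; set q := (f %/ r)%R in e.
  exists (k%:P * f1 - q * y), (k%:P * f2 - q * z).
  have -> : f %% r = k%:P * f - q * r by rewrite mul_polyC e addrC addKr.
  have -> : k%:P * f = k%:P * (f1 * x + f2 * a) by rewrite -ef.
  have -> : q * r = q * (y * x + z * a) by rewrite -er.
  by ring.
(* A constant r = y x + z a makes x divide r b, and r cancels since x is primitive. *)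
have [r1|r1] := leqP (size r) 1.
  have rC := size1_polyC r1; set c := r`_0 in rC.
  have c0 : c != 0 by rewrite -polyC_eq0 -rC.
  apply: (cancel_const xprim c0); rewrite -rC er mulrDl; apply: dvdW_add => //.
    by rewrite mulrAC mulrC; apply: dvdW_mulr.
  by rewrite -mulrA; apply: dvdW_mull.
(* For nonconstant r, clearing c from c x = q r yields r' dividing both x and r. Minimality of x
   makes q' a constant, and primitivity makes it a unit. So x divides r', hence r and c' a, and
   finally a. *)
have [|c [q [c0 e]]] := Ir x; first by exists 1, 0; rewrite mul1r mul0r addr0.
have [w [q' [r' [Ww e' Dq Dr [sq' sr']]]]] := split_const c0 x0 e.
have w0 : w != 0 by case: Ww => w1 /W_neq0 w10 <-; rewrite polyC_eq0.
have q'0 : q' != 0 by apply: contra_eqN e' => /eqP ->; rewrite mul0r mulf_neq0.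
have r'0 : r' != 0 by apply: contra_eqN e' => /eqP ->; rewrite mulr0 mulf_neq0.
have r'x : D r' x by exists w => //; exists q'; rewrite e' mulrC.
have q'x : D q' x by exists w => //; exists r'.
have sx' : (size x <= size r')%N by apply: xmin => //; rewrite sr'.
have sw : size w = 1 by case: Ww => w1 /W_neq0 w10 <-; rewrite size_polyC w10.
have := congr1 (fun p : {poly A} => size p) e'.
rewrite !size_mul // sw => es.
have q'1 : size q' = 1.
  by move: es sx'; rewrite (polySpred q'0) (polySpred r'0) (polySpred x0) !addSn !addnS /=; lia.
have q'C : q' = (q'`_0)%:P by apply: size1_polyC; rewrite q'1.
set k := q'`_0 in q'C.
have k0 : k != 0 by rewrite -polyC_eq0 -q'C.
have muk : mu k = 0%N.
  apply/eqP; rewrite -leqn0 leqNgt; apply/negP => /(mu_prime k0)[t tpr tk].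
  apply: (xprim _ tpr); apply: dvdW_trans q'x => //; rewrite q'C; apply/dvdC => i.
  by rewrite coefC; case: eqP => // _; exists 1 => //; exists 0; rewrite !mulr0.
have [w2 Ww2 [f ek]] := mu0 k0 muk; rewrite mulr1 in ek.
have xr' : D x r'.
  exists w2%:P; first exact: WXC.
  exists (f%:P * w); have -> : x * (f%:P * w) = f%:P * (w * x) by ring.
  by rewrite e' q'C ek polyCM; ring.
have [|c' [q'' [c'0 ea]]] := Ir a; first by exists 0, 1; rewrite mul1r mul0r add0r.
case: nxa; apply: (cancel_const xprim c'0); rewrite ea; apply: dvdW_mull => //.
exact: dvdW_trans xr' Dr.
Qed.

Lemma factorial_poly : factorialW WX mu_poly.
Proof.
split=> //.
- move=> _ [w Ww <-]; rewrite polyC_eq0 W_neq0 // /mu_poly lead_coefC muW //.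
  by rewrite size_polyC W_neq0.
- move=> p q p0 q0; rewrite /mu_poly lead_coefM muM ?lead_coef_eq0 // size_mul //.
  by move: p0 q0; rewrite -!size_poly_gt0; lia.
- move=> p p0; rewrite /mu_poly => mup.
  have p1 : (size p <= 1)%N by lia.
  have pC := size1_polyC p1; set a := p`_0 in pC.
  have a0 : a != 0 by rewrite -polyC_eq0 -pC.
  have mua : mu a = 0%N by move: mup; rewrite pC lead_coefC; lia.
  rewrite pC; apply/dvdC => i; rewrite coefC; case: eqP => _; first exact: mu0.
  by exists 1 => //; exists 0; rewrite !mulr0.
move=> p p0 mup.
case: (pselect (exists2 x, primeW W x & D x%:P p)) => [[x xpr xp]|np].
  by exists x%:P => //; apply: primeC.
have pprim : primitive p by move=> x xpr xp; apply: np; exists x.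
apply: prime_divisor_primitive => //; rewrite ltnNge; apply/negP => p1.
have pC := size1_polyC p1; set a := p`_0 in pC.
have a0 : a != 0 by rewrite -polyC_eq0 -pC.
have mua : (0 < mu a)%N.
  by move: mup; rewrite /mu_poly pC lead_coefC size_polyC; case: (a != 0); lia.
have [x xpr xa] := mu_prime a0 mua; apply: (pprim _ xpr); rewrite pC.
apply/dvdC => i; rewrite coefC; case: eqP => // _.
by exists 1 => //; exists 0; rewrite !mulr0.
Qed.

End GaussLemma.

(** The base case K; two applications of [factorial_poly] give K[X, Y] without building
    fractions. *)
Lemma factorial_nonzero (R : idomainType) :
  factorialW [set a : R | a != 0] (fun=> 0%N).
Proof.
split=> //=.
- by split=> [|a b a0 b0]; rewrite ?oner_neq0 ?mulf_neq0.
- by move=> a a0 _; exists a => //; exists 1.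
Qed.

(** * Derivations of the affine plane *)

Section Derivations.
Variables (A : comPzRingType) (D : A -> A).
Hypothesis HD : derivation D.

Lemma der_add a b : D (a + b) = D a + D b. Proof. by case: HD => H _; apply: H. Qed.
Lemma der_mul a b : D (a * b) = D a * b + a * D b.
Proof. by case: HD => _ H; apply: H. Qed.
Lemma der0 : D 0 = 0.
Proof. by apply: (addrI (D 0)); rewrite -der_add !addr0. Qed.
Lemma der1 : D 1 = 0.
Proof.
have := der_mul 1 1; rewrite !mulr1 mul1r => /eqP.
by rewrite addrC -subr_eq subrr => /eqP. Qed.
Lemma der_opp a : D (- a) = - D a.
Proof. by apply/eqP; rewrite -addr_eq0 -der_add addNr der0. Qed.
Lemma der_sub a b : D (a - b) = D a - D b.
Proof. by rewrite der_add der_opp. Qed.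

Lemma iter_der_add n a b : iter n D (a + b) = iter n D a + iter n D b.
Proof. by elim: n => //= n ->; rewrite der_add. Qed.
Lemma iter_der0 n : iter n D 0 = 0.
Proof. by elim: n => //= n ->; rewrite der0. Qed.

(** The top term of the iterated Leibniz rule. Its factor is a binomial coefficient, of which only
    positivity is recorded. *)
Lemma iter_der_mul i j a b : iter i.+1 D a = 0 -> iter j.+1 D b = 0 ->
  iter (i + j).+1 D (a * b) = 0 /\
  exists k, iter (i + j) D (a * b) = k.+1%:R * (iter i D a * iter j D b).
Proof.
move En : (i + j)%N => n; elim: n i j a b En => [|n IHn] i j a b.
  move=> /eqP; rewrite addn_eq0 => /andP[/eqP -> /eqP ->] /= Da Db.
  by rewrite der_mul Da Db mul0r mulr0 addr0; split=> //; exists 0%N; rewrite mul1r.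
move=> En Da Db; rewrite !(iterSr _ _ (a * b)) der_mul !iter_der_add.
case: i En Da => [|i] En Da; case: j En Db => [|j] En Db //.
- have [e0 [k ek]] := IHn 0%N j a (D b) ltac:(lia) Da ltac:(by rewrite -iterSr).
  rewrite (_ : D a = 0) // !mul0r !iter_der0 !add0r e0; split=> //.
  by exists k; rewrite -iterSr in ek.
- have [e0 [k ek]] := IHn i 0%N (D a) b ltac:(lia) ltac:(by rewrite -iterSr) Db.
  rewrite (_ : D b = 0) // !mulr0 !iter_der0 !addr0 e0; split=> //.
  by exists k; rewrite -iterSr in ek.
have [e1 [k1 ek1]] := IHn i j.+1 (D a) b ltac:(lia) ltac:(by rewrite -iterSr) Db.
have [e2 [k2 ek2]] := IHn i.+1 j a (D b) ltac:(lia) Da ltac:(by rewrite -iterSr).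
rewrite e1 e2 addr0; split=> //; exists (k1 + k2).+1.
rewrite -!iterSr in ek1 ek2; rewrite ek1 ek2 -mulrDl -natrD.
by congr (_%:R * _); lia.
Qed.

End Derivations.

Lemma lnd_order (A : comPzRingType) (D : A -> A) (a : A) : locally_nilpotent D ->
  a <> 0 -> exists n, iter n D a <> 0 /\ iter n.+1 D a = 0.
Proof.
move=> Dl a0; have [n Dn] := Dl a; elim: n Dn => [/a0//|n IHn] Dn.
by case: (pselect (iter n D a = 0)) => [/IHn//|nz]; exists n.
Qed.

(** If g u were nonzero, additivity of orders would give it at least the order of u, while D u has a
    smaller one. *)
Lemma lnd_eigen (A : idomainType) (D : A -> A) (g u : A) :
  (forall n, n.+1%:R != 0 :> A) ->
  derivation D -> locally_nilpotent D -> D u = g * u -> g * u = 0.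
Proof.
move=> char0 HD Dl Du; apply/eqP; rewrite mulf_eq0; apply/norP => -[/eqP g0 /eqP u0].
have [i [Dg Dg']] := lnd_order Dl g0; have [j [Du1 Du2]] := lnd_order Dl u0.
have [_ [k]] := iter_der_mul HD Dg' Du2.
rewrite -Du -iterSr => /eqP.
rewrite (_ : iter _ _ _ = 0); last first.
  by rewrite -addnS iterD Du2 iter_der0.
by rewrite eq_sym !mulf_eq0 (negPf (char0 _)) /= => /orP[] /eqP.
Qed.

Section Evaluation.
Variables (R A : comNzRingType) (c : {rmorphism R -> A}) (x : A).

Definition ev (h : {poly R}) : A := (map_poly c h).[x].

Lemma ev_add h k : ev (h + k) = ev h + ev k.
Proof. by rewrite /ev rmorphD hornerD. Qed.
Lemma ev_sub h k : ev (h - k) = ev h - ev k.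
Proof. by rewrite /ev rmorphB hornerD hornerN. Qed.
Lemma ev_mul h k : ev (h * k) = ev h * ev k.
Proof. by rewrite /ev rmorphM hornerM. Qed.
Lemma ev_C a : ev a%:P = c a.
Proof. by rewrite /ev map_polyC hornerC. Qed.
Lemma ev_X : ev 'X = x.
Proof. by rewrite /ev map_polyX hornerX. Qed.

Lemma ev_der (D : A -> A) : derivation D -> (forall a, D (c a) = 0) ->
  forall h, D (ev h) = ev h^`() * D x.
Proof.
move=> HD Dc; elim/poly_ind => [|h a IHh].
  by rewrite deriv0 -polyC0 ev_C Dc rmorph0 mul0r.
rewrite ev_add ev_mul ev_X ev_C der_add // der_mul // IHh Dc addr0.
by rewrite derivMXaddC ev_add ev_mul ev_X; ring.
Qed.

End Evaluation.

Lemma rmorph_ev (R A B : comNzRingType) (c : {rmorphism R -> A}) (c' : {rmorphism R -> B})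
    (f : {rmorphism A -> B}) (x : A) h :
  (forall a, f (c a) = c' a) -> f (ev c x h) = ev c' (f x) h.
Proof.
move=> fc; elim/poly_ind: h => [|h a IHh]; first by rewrite -polyC0 !ev_C fc.
by rewrite !ev_add !ev_mul !ev_X !ev_C rmorphD rmorphM IHh fc.
Qed.

(** Clears a denominator of a kernel generator: a polynomial in F becomes, up to a power of t, one
    in t F. *)
Lemma ev_scale (R A : comNzRingType) (c : {rmorphism R -> A}) (t : R) h :
  exists n k, forall x, c t ^+ n * ev c x h = ev c (c t * x) k.
Proof.
elim/poly_ind: h => [|h a [n [k E]]].
  by exists 0%N, 0 => x; rewrite -polyC0 !ev_C rmorph0 mulr0.
exists n.+1, (k * 'X + (t ^+ n.+1 * a)%:P) => x.
rewrite !ev_add !ev_mul !ev_X !ev_C -E rmorphM rmorphXn exprS.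
by ring.
Qed.

Lemma ev_shift (R A : comNzRingType) (c : {rmorphism R -> A}) (x : A) e h :
  ev c (x + c e) h = ev c x (h \Po ('X + e%:P)).
Proof.
elim/poly_ind: h => [|h a IHh]; first by rewrite comp_poly0 -polyC0 !ev_C.
by rewrite comp_poly_MXaddC !ev_add !ev_mul !ev_add !ev_C !ev_X IHh.
Qed.

Lemma ev_size (R A : idomainType) (c : {rmorphism R -> A}) (q : {poly A}) h :
  injective c -> (size (ev (polyC \o c) q h)).-1 = ((size h).-1 * (size q).-1)%N.
Proof.
move=> c_inj; have -> : ev (polyC \o c) q h = map_poly c h \Po q.
  by rewrite /ev /comp_poly -map_poly_comp.
by rewrite size_comp_poly size_map_inj_poly // rmorph0.
Qed.

Lemma antiderivative (A : comNzRingType) : (forall n, exists c : A, n.+1%:R * c = 1) ->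
  forall p : {poly A}, exists q, q^`() = p /\ q`_0 = 0.
Proof.
move=> /choice[f Hf] p; exists (\poly_(i < (size p).+1) (if i is j.+1 then f j * p`_j else 0)).
split; last by rewrite coef_poly.
apply/polyP => i; rewrite coef_deriv coef_poly ltnS.
case: leqP => [pi|ip]; first by rewrite mul0rn nth_default.
by rewrite -mulr_natl mulrA Hf mul1r.
Qed.

(** * Divergence, potentials and kernels on R[X, Y] *)

Section Plane.
Variable R : idomainType.
Hypothesis natinv : forall n, exists c : R, n.+1%:R * c = 1.

Notation S := {poly {poly R}}.
(** In [S] the outer variable is X and the inner one is Y, so [dY] acts on coefficients. *)
Definition cst : {rmorphism R -> S} := polyC \o polyC.
Definition dX (p : S) : S := p^`().
Definition dY (p : S) : S := map_poly (@deriv R) p.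
Definition Yvar : S := 'X%:P.

Lemma natinvY n : exists c : {poly R}, n.+1%:R * c = 1.
Proof. by have [c e] := natinv n; exists c%:P; rewrite -polyC_natr -polyCM e. Qed.

Lemma natR_neq0 n : n.+1%:R != 0 :> R.
Proof. by have [c e] := natinv n; apply: contra_eq_neq e => ->; rewrite mul0r eq_sym oner_neq0. Qed.

Lemma natS_neq0 n : n.+1%:R != 0 :> S.
Proof. by rewrite -!polyC_natr !polyC_eq0 natR_neq0. Qed.

Lemma cst_eq0 a : (cst a == 0) = (a == 0).
Proof. by rewrite /= !polyC_eq0. Qed.

Lemma dX_der : derivation dX.
Proof. by split=> a b; rewrite /dX ?derivD ?derivM. Qed.

Lemma coef_dY p i : (dY p)`_i = (p`_i)^`().
Proof. by rewrite /dY coef_map_id0 ?deriv0. Qed.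

Lemma dY_der : derivation dY.
Proof.
split=> a b; apply/polyP => i; rewrite !(coefD, coef_dY) ?derivD //.
rewrite !coefM raddf_sum -big_split; apply: eq_bigr => j _ /=.
by rewrite derivM !coef_dY.
Qed.

Lemma dXY p : dX (dY p) = dY (dX p).
Proof. by apply/polyP => i; rewrite !(coef_deriv, coef_dY) derivMn. Qed.

Lemma dX_cst a : dX (cst a) = 0. Proof. exact: derivC. Qed.
Lemma dY_C (q : {poly R}) : dY q%:P = q^`()%:P.
Proof. by apply/polyP => i; rewrite coef_dY !coefC; case: eqP; rewrite ?deriv0. Qed.
Lemma dY_cst a : dY (cst a) = 0. Proof. by rewrite dY_C derivC. Qed.
Lemma dX_X : dX 'X = 1. Proof. exact: derivX. Qed.
Lemma dX_Y : dX Yvar = 0. Proof. exact: derivC. Qed.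
Lemma dY_Y : dY Yvar = 1. Proof. by rewrite dY_C derivX. Qed.
Lemma dY_X : dY 'X = 0.
Proof. by apply/polyP => i; rewrite coef_dY coefX coef0; case: (i == 1%N); rewrite ?derivC. Qed.

Definition plder (U V p : S) : S := U * dX p + V * dY p.

Lemma plder_der U V : derivation (plder U V).
Proof.
split=> a b; rewrite /plder ?(der_add dX_der, der_add dY_der); first by ring.
by rewrite !(der_mul dX_der, der_mul dY_der); ring.
Qed.

Lemma plder_cst U V a : plder U V (cst a) = 0.
Proof. by rewrite /plder dX_cst dY_cst !mulr0 addr0. Qed.

Lemma deriv_eq0 (A : idomainType) (q : {poly A}) :
  (forall n, n.+1%:R != 0 :> A) -> q^`() = 0 -> q = (q`_0)%:P.
Proof.
move=> char0 q0; apply/polyP => -[|i]; rewrite coefC //=.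
have /eqP := congr1 (fun p : {poly A} => p`_i) q0.
by rewrite coef_deriv coef0 -mulr_natr mulf_eq0 (negPf (char0 _)) orbF => /eqP.
Qed.

Lemma dX_eq0 p : dX p = 0 -> p = (p`_0)%:P.
Proof. by apply: deriv_eq0 => n; rewrite -polyC_natr polyC_eq0 natR_neq0. Qed.

Lemma dXY_eq0 p : dX p = 0 -> dY p = 0 -> exists a, p = cst a.
Proof.
move=> /dX_eq0 ->; rewrite dY_C => /eqP; rewrite polyC_eq0 => /eqP.
by move=> /(deriv_eq0 natR_neq0) ->; exists p`_0`_0.
Qed.

(** Integrate -V along X. By the hypothesis the error left in dY depends on Y alone and is
    integrated along Y. *)
Lemma poincare U V : dX U + dY V = 0 -> exists F, dY F = U /\ dX F = - V.
Proof.
move=> e; have [F0 [eF0 _]] := antiderivative natinvY (- V).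
have /dX_eq0 : dX (U - dY F0) = 0.
  by rewrite (der_sub dX_der) dXY {2}/dX eF0 (der_opp dY_der) opprK.
set q := (_`_0) => eq; have [q' [eq' _]] := antiderivative natinv q.
exists (F0 + q'%:P); rewrite (der_add dX_der) (der_add dY_der) dY_C eq' -eq.
by rewrite /dX eF0 derivC addr0 addrC subrK.
Qed.

Definition jac (a b : S) : S := dX a * dY b - dY a * dX b.

(* The Lie derivative along D = U dX + V dY of the 2-form [da db] is
   [E (jac a b)] where [E u = D u + div(D) u]. *)
Lemma lie_jac U V a b :
  plder U V (jac a b) + (dX U + dY V) * jac a b =
  jac (plder U V a) b + jac a (plder U V b).
Proof.
rewrite /plder /jac !(der_sub dX_der, der_sub dY_der, der_add dX_der,
  der_add dY_der, der_mul dX_der, der_mul dY_der) !dXY.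
by ring.
Qed.

(* 1 = jac X Y is killed by a power of E, but E is injective if div D <> 0. *)
Lemma plder_div0 U V : locally_nilpotent (plder U V) -> dX U + dY V = 0.
Proof.
move=> Dl; set D := plder U V in Dl *; set d := dX U + dY V.
have HD : derivation D := plder_der U V.
pose E u := D u + d * u.
have ED a b : E (a + b) = E a + E b by rewrite /E der_add //; ring.
have iterED n a b : iter n E (a + b) = iter n E a + iter n E b.
  by elim: n => //= n ->.
have E0 : E 0 = 0 by rewrite /E der0 // mulr0 addr0.
have iterE0 n : iter n E 0 = 0 by elim: n => //= n ->.
(* By [lie_jac], E obeys the Leibniz rule on Jacobians, so each application lowers one of the two
   orders. *)
have nilJ n : forall i j a b, (i + j <= n)%N -> iter i D a = 0 -> iter j D b = 0 ->
    iter n E (jac a b) = 0.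
  have J0l b : jac 0 b = 0 by rewrite /jac (der0 dX_der) (der0 dY_der) !mul0r subr0.
  have J0r a : jac a 0 = 0 by rewrite /jac (der0 dX_der) (der0 dY_der) !mulr0 subr0.
  elim: n => [|n IHn] i j a b ij.
    by case: i ij => // ij /= ->; rewrite J0l.
  case: i ij => [|i] ij Da Db; first by rewrite (_ : a = 0) // J0l iterE0.
  case: j ij Db => [|j] ij Db; first by rewrite (_ : b = 0) // J0r iterE0.
  rewrite iterSr {2}/E lie_jac iterED.
  rewrite (IHn i j.+1) ?(IHn i.+1 j) ?addr0 // -?iterSr //; lia.
have [n nil1] : exists n, iter n E 1 = 0.
  have [i Di] := Dl 'X; have [j Dj] := Dl Yvar.
  exists (i + j)%N; rewrite -(nilJ _ i j 'X Yvar (leqnn _) Di Dj); congr iter.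
  by rewrite /jac dX_X dX_Y dY_X dY_Y; ring.
apply/eqP; apply: contraT => d0.
(* E u = 0 makes u an eigenvector of D with eigenvalue -d, excluded by [lnd_eigen] unless u = 0. *)
have Einj u : E u = 0 -> u = 0.
  move=> /eqP; rewrite addr_eq0 -mulNr => /eqP Du; apply/eqP.
  have /eqP := lnd_eigen natS_neq0 HD Dl Du.
  by rewrite mulf_eq0 oppr_eq0 (negPf d0).
have : forall n, iter n E 1 != 0.
  by elim=> [|k IHk]; [exact: oner_neq0 | apply: contraNneq IHk => /Einj /eqP].
by move=> /(_ n); rewrite nil1 eqxx.
Qed.

Lemma evS_eq0 (F : S) (h : {poly R}) : (1 < size F)%N -> ev cst F h = 0 -> h = 0.
Proof.
move=> sF /eqP; have -> : ev cst F h = map_poly polyC h \Po F.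
  by rewrite /ev /comp_poly -map_poly_comp.
by rewrite comp_poly_eq0 // map_polyC_eq0 => /eqP.
Qed.

Variable W : set R.
Hypotheses (W1 : W 1) (WM : forall a b, W a -> W b -> W (a * b)).
Hypothesis W_neq0 : forall a, W a -> a != 0.

Section Kernel.
Variables (U V : S).
Hypotheses (V0 : V != 0) (Dl : locally_nilpotent (plder U V)).

(** This is [codivisor_free] for the ideal (U, V) after inverting W. *)
Definition plane_codivisor_free := forall u v, v != 0 ->
  (exists c, u * U = v * c) -> (exists c, u * V = v * c) ->
  exists2 t, W t & exists c, cst t * u = v * c.

(* For G in the kernel dG = P dF, where P is again in the kernel and has smaller
   degree; integrate its expression as a polynomial in F. *)
Lemma plane_kernel : plane_codivisor_free ->
  exists F, [/\ dY F = U, dX F = - V & forall G, plder U V G = 0 ->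
    exists2 t, W t & exists h, cst t * G = ev cst F h].
Proof.
move=> UV; have [F [FU FV]] := poincare (plder_div0 Dl).
have FX0 : dX F != 0 by rewrite FV oppr_eq0.
exists F; split=> // G; have [n] := ubnP (size G); elim: n G => // n IHn G.
rewrite ltnS => sG DG.
have [GX|GX] := eqVneq (dX G) 0.
  have GY : dY G = 0.
    by move/eqP: DG; rewrite /plder GX mulr0 add0r mulf_eq0 (negPf V0) => /eqP.
  have [a ->] := dXY_eq0 GX GY; exists 1 => //; exists a%:P.
  by rewrite ev_C rmorph1 mul1r.
have e1 : dX G * U = dX F * dY G.
  by move/eqP: DG; rewrite /plder addr_eq0 FV mulNr mulrC => /eqP.
have [t Wt [P eP]] : exists2 t, W t & exists c, cst t * dX G = dX F * c.
  by apply: UV => //; [exists (dY G) | exists (- dX G); rewrite FV; ring].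
have eQ : cst t * dY G = dY F * P.
  apply: (mulfI FX0); rewrite mulrCA -e1 mulrA eP FU; ring.
(* Equality of mixed derivatives, for G and for F, turns dG = P dF into proportionality of dP and
   dF. *)
have DP : plder U V P = 0.
  have := dXY (cst t * G); rewrite !(der_mul dX_der, der_mul dY_der) !dX_cst !dY_cst.
  rewrite !mul0r !add0r eP eQ !(der_mul dX_der, der_mul dY_der) dXY => e.
  have {e}e : dY F * dX P = dX F * dY P by apply: (addrI (dY (dX F) * P)); rewrite -e; ring.
  by rewrite /plder -FU e FV; ring.
have P0 : P != 0.
  by apply: contra_eqN eP => /eqP ->; rewrite mulr0 mulf_neq0 // cst_eq0 W_neq0.
(* Differentiation shortens G, and dividing dX G by dX F does not lengthen it. *)
have sP : (size P < n)%N.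
  have := congr1 (fun p : S => size p) eP; rewrite mul_polyC size_scale; last first.
    by rewrite polyC_eq0 W_neq0.
  rewrite size_mul // => es.
  have sGX : (size (dX G) < size G)%N.
    by apply: lt_size_deriv; apply: contraNneq GX => ->; rewrite /dX deriv0.
  have := size_poly_gt0 (dX F); rewrite FX0.
  by move: es sGX sG; move: (size _) (size _) (size _) (size _); lia.
have [t' Wt' [h eh]] := IHn P sP DP.
have [H [eH _]] := antiderivative natinv h.
have FcX : dX (ev cst F H) = ev cst F h * dX F.
  by rewrite (ev_der _ dX_der dX_cst) eH.
have FcY : dY (ev cst F H) = ev cst F h * dY F.
  by rewrite (ev_der _ dY_der dY_cst) eH.
have [a ea] : exists a, cst (t' * t) * G - ev cst F H = cst a.
  apply: dXY_eq0.
    rewrite (der_sub dX_der) (der_mul dX_der) dX_cst FcX -eh rmorphM -(mulrA (cst t')) eP.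
    by ring.
  rewrite (der_sub dY_der) (der_mul dY_der) dY_cst FcY -eh rmorphM -(mulrA (cst t')) eQ.
  by ring.
exists (t' * t); first exact: WM.
by exists (H + a%:P); rewrite ev_add ev_C -ea addrC subrK.
Qed.

End Kernel.
End Plane.

(** * From a kernel generator to divisibility *)

Section PlaneCodivisor.
Variable R : idomainType.
Hypothesis natinv : forall n, exists c : R, n.+1%:R * c = 1.
Notation S := {poly {poly R}}.

(** Integrate the quotients, first in X and then in Y: antiderivatives divide by integers only, so
    the factor a survives. *)
Lemma dX_dY_divisible (a : R) (p q r : S) :
  dX p = cst R a * q -> dY p = cst R a * r -> exists m c, p = cst R a * m + cst R c.
Proof.
move=> eq er; have [Q [eQ _]] := antiderivative (natinvY natinv) q.
have /(dX_eq0 natinv) : dX (p - cst R a * Q) = 0.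
  by rewrite (der_sub (dX_der R)) (der_mul (dX_der R)) dX_cst {2}/dX eQ eq; ring.
set s := (_`_0) => es.
have es' : s^`() = a%:P * (r - dY Q)`_0.
  have -> : s^`() = (dY (p - cst R a * Q))`_0 by rewrite es dY_C coefC.
  by rewrite (der_sub (dY_der R)) (der_mul (dY_der R)) dY_cst er mul0r add0r -mulrBr coefCM.
have [z [ez _]] := antiderivative natinv (r - dY Q)`_0.
have /(deriv_eq0 (natR_neq0 natinv)) : (s - a%:P * z)^`() = 0.
  by rewrite derivB derivM derivC mul0r add0r ez es' subrr.
set c := (_`_0) => ec.
exists (Q + z%:P), c.
have -> : p = cst R a * Q + s%:P by rewrite -es addrC subrK.
have -> : s = a%:P * z + c%:P by rewrite -ec addrC subrK.
by rewrite polyCD polyCM /=; ring.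
Qed.

Variable W : set R.
Hypotheses (W1 : W 1) (WM : forall a b, W a -> W b -> W (a * b)).
Hypothesis W_neq0 : forall a, W a -> a != 0.

Section Saturation.
Variable a : R.
(** The contraction to R of the ideal generated by a in R_W. *)
Let T : set R := [set r | exists2 t, W t & exists e, t * r = a * e].

Let T_ideal : is_ideal T.
Proof.
split=> [|r r' [t Wt [e et]] [t' Wt' [e' et']]|b r [t Wt [e et]]].
- by exists 1 => //; exists 0; rewrite !mulr0.
- exists (t * t'); first exact: WM.
  exists (t' * e + t * e').
  have -> : t * t' * (r + r') = t' * (t * r) + t * (t' * r') by ring.
  by rewrite et et'; ring.
- by exists t => //; exists (b * e); rewrite mulrCA et mulrCA.
Qed.

Let saturated1 (q : {poly R}) : (forall i, T q`_i) ->
  exists2 t, W t & exists q', t%:P * q = a%:P * q'.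
Proof.
elim/poly_ind: q => [|q c IHq] H.
  by exists 1 => //; exists 0; rewrite !mulr0.
have [|t Wt [q' e]] := IHq.
  by move=> i; have := H i.+1; rewrite coefD coefMX coefC addr0.
have := H 0%N; rewrite coefD coefMX coefC add0r /= => -[t' Wt' [e' et']].
exists (t * t'); first exact: WM.
exists (t'%:P * q' * 'X + (t * e')%:P).
have -> : (t * t')%:P * (q * 'X + c%:P) = t'%:P * (t%:P * q) * 'X + t%:P * (t' * c)%:P.
  by rewrite !polyCM; ring.
by rewrite e et' !polyCM; ring.
Qed.

Let saturated2 (q : S) : (forall i j, T q`_i`_j) ->
  exists2 t, W t & exists q', cst R t * q = cst R a * q'.
Proof.
elim/poly_ind: q => [|q c IHq] H.
  by exists 1 => //; exists 0; rewrite !mulr0.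
have [|t Wt [q' e]] := IHq.
  by move=> i j; have := H i.+1 j; rewrite coefD coefMX coefC addr0.
have [|t' Wt' [c' ec']] := @saturated1 c.
  by move=> j; have := H 0%N j; rewrite coefD coefMX coefC add0r.
exists (t * t'); first exact: WM.
exists (cst R t' * q' * 'X + (t%:P * c')%:P).
have -> : cst R (t * t') * (q * 'X + c%:P) =
    cst R t' * (cst R t * q) * 'X + cst R t * (t'%:P * c)%:P.
  by rewrite /= !polyCM; ring.
by rewrite e ec' /= !polyCM; ring.
Qed.

(* If F generates the kernel over R_W, its partial derivatives have no common
   zero-divisor modulo a: a constant c killing them modulo a makes
   (c F - c F(0)) / a a kernel element, so a divides c. *)
Lemma gradient_faithful (U V F : S) (w : S) :
  dX F != 0 -> plder U V F = 0 -> a != 0 ->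
  (forall G, plder U V G = 0 -> exists2 t, W t & exists h, cst R t * G = ev (cst R) F h) ->
  (exists e, w * dX F = cst R a * e) -> (exists e, w * dY F = cst R a * e) ->
  exists2 t, W t & exists w', cst R t * w = cst R a * w'.
Proof.
move=> FX0 DF a0 Fgen [eX wX] [eY wY]; apply: saturated2.
pose f (b : bool) := if b then dX F else dY F.
have sF : (1 < size F)%N.
  rewrite ltnNge; apply: contraNN FX0 => F1.
  by rewrite (size1_polyC F1) /dX derivC.
have Tcoef (b : S) e : b = cst R a * e -> forall i j, T b`_i`_j.
  move=> -> i j; exists 1 => //; exists e`_i`_j.
  by rewrite mul1r /= !coefCM.
pose T1 := [set q : {poly R} | forall i, T q`_i].
(* McCoy is used in X modulo the polynomials in Y with coefficients in T, then in Y for the family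
   of all X-coefficients of both derivatives. *)
apply: (@mccoy _ T1 bool f) => [|c Hc|b i j]; last first.
- by case: b; rewrite /f ?wX ?wY; apply: Tcoef.
- apply: (@mccoy _ T (bool * nat) (fun bi => (f bi.1)`_bi.2)) => // [c' Hc'|[b i] j]; last first.
    exact: Hc.
  have [t Wt [x ex]] := @saturated2 (cst R c' * dX F)
    (fun i j => ltac:(rewrite /= !coefCM; exact: (Hc' (true, i) j))).
  have [t' Wt' [y ey]] := @saturated2 (cst R c' * dY F)
    (fun i j => ltac:(rewrite /= !coefCM; exact: (Hc' (false, i) j))).
  pose k := t * t' * c'.
  have kX : dX (cst R k * F) = cst R a * (cst R t' * x).
    rewrite (der_mul (dX_der R)) dX_cst mul0r add0r mulrCA -ex /k !rmorphM; ring.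
  have kY : dY (cst R k * F) = cst R a * (cst R t * y).
    rewrite (der_mul (dY_der R)) dY_cst mul0r add0r mulrCA -ey /k !rmorphM; ring.
  have [m [c0 em]] := dX_dY_divisible kX kY.
  have Dm : plder U V m = 0.
    have H : cst R a * plder U V m = 0.
      have := congr1 (plder U V) em; have HD := plder_der U V.
      rewrite (der_add HD) !(der_mul HD) !plder_cst DF !mul0r !mulr0 !addr0 add0r.
      by move=> <-.
    by move/eqP: H; rewrite mulf_eq0 cst_eq0 (negPf a0) => /eqP.
  have [t3 Wt3 [h eh]] := Fgen _ Dm.
  (* In t3 k F = a h(F) + t3 c0 the element F is transcendental, so its linear coefficients agree: a
     divides t3 k. *)
  have : ev (cst R) F ((t3 * k)%:P * 'X - (a%:P * h + (t3 * c0)%:P)) = 0.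
    rewrite ev_sub ev_add !ev_mul !ev_C ev_X !(rmorphM (cst R) t3) -mulrA em -eh; ring.
  move=> /(evS_eq0 sF) /(congr1 (fun p : {poly R} => p`_1)).
  rewrite coefB coefD !coefCM coefX coefC coef0 mulr1 addr0 => /eqP.
  rewrite subr_eq0 => /eqP e.
  exists (t3 * (t * t')); first by do !apply: WM.
  by exists h`_1; rewrite -e /k; ring.
- have [T0 TD TM] := T_ideal.
  split=> [i|p q Hp Hq i|p q Hq i]; first by rewrite coef0.
    by rewrite coefD; apply: TD.
  by rewrite coefM; apply: ideal_sum => // j _; apply: TM.
Qed.

End Saturation.

(** The last two hypotheses are irreducibility over R_W and over K: common divisors of U and V are
    units there. *)
Lemma plane_codivisor (U V F : S) : V != 0 -> locally_nilpotent (plder U V) ->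
  plder U V F = 0 ->
  (forall G, plder U V G = 0 -> exists2 t, W t & exists h, cst R t * G = ev (cst R) F h) ->
  (forall g t, W t -> (exists c, cst R t * U = g * c) -> (exists c, cst R t * V = g * c) ->
     exists2 t', W t' & exists c, g * c = cst R t') ->
  (forall g t, t != 0 -> (exists c, cst R t * U = g * c) -> (exists c, cst R t * V = g * c) ->
     exists2 t', t' != 0 & exists c, g * c = cst R t') ->
  plane_codivisor_free W U V.
Proof.
move=> V0 Dl DF Fgen irrW irr0 u v v0 vU vV.
have [F1 [F1U F1V]] := poincare natinv (plder_div0 natinv Dl).
have [t Wt [h eh]] : exists2 t, W t & exists h, cst R t * F1 = ev (cst R) F h.
  by apply: Fgen; rewrite /plder F1U F1V; ring.
(* By the chain rule t (U, V) = g (dY F, - dX F), so g is a common divisor and hence a unit over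
   R_W. *)
pose g := ev (cst R) F h^`().
have gX : - (cst R t * V) = g * dX F.
  rewrite -mulrN -F1V -(ev_der _ (dX_der R) (@dX_cst R)) -eh.
  by rewrite (der_mul (dX_der R)) dX_cst mul0r add0r.
have gY : cst R t * U = g * dY F.
  rewrite -F1U -(ev_der _ (dY_der R) (@dY_cst R)) -eh.
  by rewrite (der_mul (dY_der R)) dY_cst mul0r add0r.
have [t' Wt' [c ec]] : exists2 t', W t' & exists c, g * c = cst R t'.
  apply: irrW Wt _ _; first by exists (dY F).
  by exists (- dX F); rewrite mulrN -gX opprK.
have FX0 : dX F != 0.
  have : - (cst R t * V) != 0 by rewrite oppr_eq0 mulf_neq0 // cst_eq0 W_neq0.
  by apply: contraNneq => FX; rewrite gX FX mulr0.
(* Over K the coefficients U and V are coprime in a factorial ring, so v divides u with a constant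
   denominator a. *)
have [a a0 [w ew]] : exists2 a, a != 0 & exists w, cst R a * u = v * w.
  pose W0 : set R := [set b | b != 0].
  pose WS : set S := polyC @` (polyC @` W0).
  have fS := factorial_poly (factorial_poly (factorial_nonzero R)).
  have [[WS1 WSM] _ _ _ _] := fS; rewrite -/W0 -/WS in fS WS1 WSM.
  have [x xpr|||] := @dvdW_coprime _ WS WS1 WSM _ U V fS _ u v v0.
  - move=> [_ [_ [b b0 <-] <-] [y ey]] [_ [_ [b' b'0 <-] <-] [y' ey']].
    have [|||r r0 [z ez]] := irr0 x (b * b').
    + by rewrite mulf_neq0.
    + by exists (cst R b' * y); rewrite rmorphM mulrAC ey; ring.
    + by exists (cst R b * y'); rewrite rmorphM -mulrA ey'; ring.
    case: xpr => _ nx1 _; apply: nx1; exists (cst R r).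
      by exists r%:P => //; exists r.
    by exists z; rewrite mulr1 ez.
  - by exists 1 => //; rewrite mul1r.
  - by exists 1 => //; rewrite mul1r.
  by move=> _ [_ [b b0 <-] <-] [w ew]; exists b => //; exists w.
have vt' (Z Z' : S) : v != 0 -> (exists c, u * Z = v * c) -> cst R t * Z = g * Z' ->
    exists e, cst R t' * w * Z' = cst R a * e.
  move=> _ [z ez] eZ; exists (cst R t * c * z); apply: (mulfI v0).
  have -> : v * (cst R a * (cst R t * c * z)) = cst R a * c * cst R t * (v * z) by ring.
  rewrite -ez; have -> : cst R a * c * cst R t * (u * Z) = cst R a * u * c * (cst R t * Z) by ring.
  by rewrite eZ ew -ec; ring.
have wY : exists e, cst R t' * w * dY F = cst R a * e by apply: vt' vU gY.
have wX : exists e, cst R t' * w * dX F = cst R a * e.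
  have [|e ee] := vt' V (- dX F) v0 vV; first by rewrite mulrN -gX opprK.
  by exists (- e); rewrite mulrN -ee; ring.
have [t2 Wt2 [w' ew']] := gradient_faithful FX0 DF a0 Fgen wX wY.
exists (t2 * t'); first exact: WM.
exists w'; apply: (@mulfI _ (cst R a)); first by rewrite cst_eq0.
have -> : cst R a * (cst R (t2 * t') * u) = cst R t2 * cst R t' * (cst R a * u).
  by rewrite rmorphM; ring.
rewrite ew; have -> : cst R t2 * cst R t' * (v * w) = v * (cst R t2 * (cst R t' * w)) by ring.
by rewrite ew'; ring.
Qed.

End PlaneCodivisor.

(** * Symmetric algebras and local bases *)

(** The scalars carrying x into N form an ideal, to which [ideal_unit_of_local] applies. *)
Lemma local_submodule (R : comNzRingType) (M : lmodType R) (N : set M) :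
  noetherian R -> N 0 -> (forall a x y, N x -> N y -> N (a *: x + y)) ->
  forall x, (forall p : prime_idealr R, exists2 t, t \notin p & N (t *: x)) -> N x.
Proof.
move=> Rn N0 NL x Hx; rewrite -[x]scale1r.
apply: (@ideal_unit_of_local R [set r | N (r *: x)]) => //.
split=> /= [|a b Na Nb|a b Nb]; first by rewrite scale0r.
  by rewrite scalerDl -[a *: x]scale1r; apply: NL.
by rewrite -scalerA -[_ *: _]addr0; apply: NL.
Qed.

Lemma local_eq0 (R : comNzRingType) (M : lmodType R) (x : M) : noetherian R ->
  (forall p : prime_idealr R, exists2 t, t \notin p & t *: x = 0) -> x = 0.
Proof.
move=> Rn; apply: (@local_submodule R M [set 0]) => // a _ _ -> -> /=.
by rewrite scaler0 addr0.
Qed.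

Section SymmetricAlgebraLift.
Variables (R : comNzRingType) (M : lmodType R).

Lemma sym_induction (P : Sym M -> Prop) :
  (forall a, P a%:A) -> (forall m, P (sym_gen m)) ->
  (forall x y, P x -> P y -> P (x + y)) -> (forall x y, P x -> P y -> P (x * y)) ->
  forall x, P x.
Proof.
move=> PC PG PD PM x; have [y ->] := sym_classE x.
elim: y => [a|m|y Py z Pz|y Py z Pz]; last 2 first.
- by have := PD _ _ Py Pz; rewrite -sym_addE.
- by have := PM _ _ Py Pz; rewrite -sym_mulE.
- suff -> : sym_class (sym_const_expr M a) = a%:A by apply: PC.
  by apply: esym (mulr1 (sym_const M a)).
- exact: PG.
Qed.

(** Unlike [sym_lift], the target is only a ring with a morphism from R, so R[X, Y] can be used
    through [cst]. *)
Lemma sym_ring_lift (A : comNzRingType) (c : {rmorphism R -> A}) (g : M -> A) :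
  (forall a m n, g (a *: m + n) = c a * g m + g n) ->
  exists f : {rmorphism Sym M -> A},
    (forall a, f a%:A = c a) /\ (forall m, f (sym_gen m) = g m).
Proof.
move=> gL.
have gD m n : g (m + n) = g m + g n by rewrite -{1}[m]scale1r gL rmorph1 mul1r.
have g0 : g 0 = 0 by apply: (addrI (g 0)); rewrite -gD !addr0.
have gZ a m : g (a *: m) = c a * g m by rewrite -[a *: m]addr0 gL g0 addr0.
pose f (x : Sym M) : A := sym_eval c g (repr x).
have fE x : f (sym_class x) = sym_eval c g x by apply: sym_eval_eqv (sym_repr x).
have fD x y : f (x + y) = f x + f y.
  have [[b ->] [b' ->]] := conj (sym_classE x) (sym_classE y).
  have -> : sym_class b + sym_class b' = sym_class (sym_add_expr b b') by rewrite -sym_addE.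
  by rewrite !fE.
have fM x y : f (x * y) = f x * f y.
  have [[b ->] [b' ->]] := conj (sym_classE x) (sym_classE y).
  have -> : sym_class b * sym_class b' = sym_class (sym_mul_expr b b') by rewrite -sym_mulE.
  by rewrite !fE.
have fC a : f a%:A = c a.
  have -> : a%:A = sym_class (sym_const_expr M a) by apply: (mulr1 (sym_const M a)).
  exact: fE.
have f_add : zmod_morphism f.
  have f0 : f 0 = 0 by apply: (addrI (f 0)); rewrite -fD !addr0.
  by move=> x y; apply: (addIr (f y)); rewrite subrK -fD subrK.
have f_mul : monoid_morphism f.
  by split=> //; rewrite -(scale1r 1) fC rmorph1.
pose fR : {rmorphism Sym M -> A} := HB.pack f
  (GRing.isZmodMorphism.Build _ _ f f_add) (GRing.isMonoidMorphism.Build _ _ f f_mul).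
by exists fR; split=> [//|m]; apply: fE.
Qed.

Lemma sym_rmorph_ext (A : comNzRingType) (f g : {rmorphism Sym M -> A}) :
  (forall a, f a%:A = g a%:A) -> (forall m, f (sym_gen m) = g (sym_gen m)) -> f =1 g.
Proof.
move=> fgC fgG; apply: sym_induction => // x y fx fy.
  by rewrite !rmorphD fx fy.
by rewrite !rmorphM fx fy.
Qed.

End SymmetricAlgebraLift.

(** * Local bases of modules with a rank *)

Section LocalBasis.
Variables (R : idomainType) (M : lmodType R) (n : nat) (p : prime_idealr R).
Hypothesis Mrank : has_rank M n.

Lemma denom_neq0 (t : R) : t \notin p -> t != 0.
Proof. by apply: contraNneq => ->; apply: idealr0. Qed.

Lemma notinM (s t : R) : s \notin p -> t \notin p -> s * t \notin p.
Proof. by move=> sp tp; rewrite prime_idealrM negb_or sp. Qed.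

Lemma notin1 : (1 : R) \notin p. Proof. by rewrite idealr1. Qed.

Lemma frac_sum (I : Type) (r : seq I) (f : I -> M) :
  \sum_(i <- r) frac (f i) (denom1 p) = frac (\sum_(i <- r) f i) (denom1 p).
Proof.
elim: r => [|i r IHr]; first by rewrite !big_nil.
by rewrite !big_cons IHr fracD /= !scale1r; apply: frac_eqW; rewrite /= mul1r.
Qed.

(** The x i are numerators of a basis of M_p; dropping the denominators rescales it by units of
    R_p. *)
Lemma rank_local_basis : exists x : 'I_n -> M,
  (forall m, exists2 t, t \notin p & exists c, t *: m = \sum_i c i *: x i) /\
  (forall c : 'I_n -> R, \sum_i c i *: x i = 0 -> forall i, c i = 0).
Proof.
have [f f_bij] := Mrank p; have [g fK gK] := f_bij.
have /choice[xs Hxs] : forall i : 'I_n, exists xs : M * loc_denom p,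
    f (delta_mx 0 i) = frac xs.1 xs.2.
  by move=> i; have [m [s e]] := fracE (f (delta_mx 0 i)); exists (m, s).
have fE v : f v = \sum_i v 0 i *: frac (xs i).1 (xs i).2.
  rewrite {1}[v]row_sum_delta linear_sum; apply: eq_bigr => i _.
  by rewrite linearZZ Hxs.
have sumE (r : seq 'I_n) (v : 'rV[loc_ring p]_n) : exists c t,
    \sum_(i <- r) v 0 i *: frac (xs i).1 (xs i).2 = frac (\sum_i c i *: (xs i).1) t.
  elim: r => [|i r [c [t IHr]]].
    exists (fun=> 0), (denom1 p); rewrite big_nil; congr frac.
    by rewrite big1 // => i _; rewrite scale0r.
  have [a [w ea]] := fracE (v 0 i).
  rewrite big_cons IHr ea fracZ fracD /=.
  exists (fun j => (if j == i then denom_val t * a else 0) +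
    denom_val w * denom_val (xs i).2 * c j).
  eexists; congr frac; under [RHS]eq_bigr do rewrite scalerDl.
  rewrite big_split scaler_sumr /=; congr (_ + _); last first.
    by apply: eq_bigr => j _; rewrite scalerA.
  rewrite (bigD1 i) //= eqxx scalerA big1 ?addr0 // => j /negPf ->.
  by rewrite scale0r.
exists (fun i => (xs i).1); split=> [m|c e i].
  have := gK (frac m (denom1 p)); rewrite fE.
  have [c [t ->]] := sumE (index_enum _) (g (frac m (denom1 p))).
  move=> /frac_eq[u]; rewrite /= scale1r => e.
  exists (denom_val u * denom_val t); first by apply: notinM; apply: denomP.
  exists (fun i => denom_val u * c i); rewrite -scalerA -e scaler_sumr.
  by apply: eq_bigr => i _; rewrite scalerA.
pose v : 'rV[loc_ring p]_n :=
  \row_i (frac (c i * denom_val (xs i).2 : R^o) (denom1 p) : loc_ring p).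
have v0 : v = 0.
  apply: (can_inj fK); rewrite linear0 fE.
  transitivity (\sum_i frac (c i *: (xs i).1) (denom1 p)); last by rewrite frac_sum e.
  apply: eq_bigr => j _; rewrite mxE fracZ; apply: frac_eqW.
  by rewrite /= !mul1r !scale1r scalerA mulrC.
have := congr1 (fun v : 'rV[loc_ring p]_n => v 0 i) v0; rewrite !mxE.
move=> /frac_eq[u]; rewrite /GRing.scale /= !mul1r mulr0 => /eqP.
by rewrite !mulf_eq0 !(negPf (denom_neq0 (denomP _))) orbF /= => /eqP.
Qed.

Hypothesis Mfg : finitely_generated M.

(** Finite generation yields one denominator s for all of M, and uniqueness of coordinates makes the
    scaled coordinates linear. *)
Lemma rank_coordinates : exists s (x : 'I_n -> M) (phi : 'I_n -> M -> R),
  [/\ s \notin p, forall i a m m', phi i (a *: m + m') = a * phi i m + phi i m',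
      forall m, s *: m = \sum_i phi i m *: x i &
      forall i j, phi i (x j) = if i == j then s else 0].
Proof.
have [x [xgen xfree]] := rank_local_basis.
have [k [e egen]] := Mfg.
have /choice[tc Htc] : forall i : 'I_k, exists tc : R * ('I_n -> R),
    tc.1 \notin p /\ tc.1 *: e i = \sum_j tc.2 j *: x j.
  by move=> i; have [t tp [c ec]] := xgen (e i); exists (t, c).
pose s := \prod_i (tc i).1.
have sp : s \notin p.
  rewrite /s; elim/big_ind: _ => [|a b|i _]; [exact: notin1|exact: notinM|by case: (Htc i)].
have span m : exists c : 'I_n -> R, s *: m = \sum_j c j *: x j.
  have [a ->] := egen m.
  exists (fun j => \sum_i a i * (\prod_(i' | i' != i) (tc i').1 * (tc i).2 j)).
  under [RHS]eq_bigr do rewrite scaler_suml.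
  rewrite exchange_big scaler_sumr; apply: eq_bigr => i _ /=.
  transitivity (a i *: (\prod_(i' | i' != i) (tc i').1 *: ((tc i).1 *: e i))).
    by rewrite !scalerA; congr (_ *: _); rewrite /s (bigD1 i) //=; ring.
  by rewrite (Htc i).2 !scaler_sumr; apply: eq_bigr => j _; rewrite !scalerA mulrA.
have /choice[phi Hphi] := span.
have uniq_c (c c' : 'I_n -> R) : \sum_j c j *: x j = \sum_j c' j *: x j -> c =1 c'.
  move=> ecc j; apply/eqP; rewrite -subr_eq0; apply/eqP; move: j.
  apply: (xfree (fun j => c j - c' j)).
  by under eq_bigr do rewrite scalerBl; rewrite sumrB ecc subrr.
exists s, x, (fun i m => phi m i); split=> // [i a m m'|i j].
  apply: (uniq_c (phi _) (fun i => a * phi m i + phi m' i)).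
  rewrite -Hphi; under eq_bigr do rewrite scalerDl -scalerA.
  by rewrite big_split /= -scaler_sumr -!Hphi scalerDr !scalerA mulrC.
apply: (uniq_c (phi _) (fun i => if i == j then s else 0)).
rewrite -Hphi (bigD1 j) //= eqxx big1 ?addr0 // => i' /negPf ->.
by rewrite scale0r.
Qed.

End LocalBasis.

Lemma plane_induction (R : idomainType) (P : {poly {poly R}} -> Prop) :
  (forall a, P (cst R a)) -> P 'X -> P (Yvar R) ->
  (forall x y, P x -> P y -> P (x + y)) -> (forall x y, P x -> P y -> P (x * y)) ->
  forall x, P x.
Proof.
move=> PC PX PY PD PM.
have PC1 q : P q%:P.
  elim/poly_ind: q => [|q a IHq]; first exact: (PC 0).
  by rewrite polyCD polyCM; apply: PD; [apply: PM | apply: PC].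
elim/poly_ind => [|q a IHq]; first exact: (PC 0).
by apply: PD; [apply: PM | apply: PC1].
Qed.

(** Here f multiplies the coefficient of X^i Y^j by s^(i+j). *)
Lemma dilation_eq0 (R : idomainType) (s : R) (f : {rmorphism {poly {poly R}} -> {poly {poly R}}}) :
  s != 0 -> (forall a, f (cst R a) = cst R a) -> f 'X = cst R s * 'X ->
  f (Yvar R) = cst R s * Yvar R -> forall q, f q = 0 -> q = 0.
Proof.
move=> s0 fC fX fY.
have f1 (q : {poly R}) i j : (f q%:P)`_i`_j = if i == 0%N then s ^+ j * q`_j else 0.
  elim/poly_ind: q i j => [|q a IHq] i j.
    by rewrite polyC0 rmorph0 !coef0 mulr0 if_same.
  rewrite polyCD polyCM rmorphD rmorphM (fY) (fC) !coefD.
  have -> : f q%:P * (cst R s * Yvar R) = f q%:P * (s *: 'X)%:P.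
    by rewrite /Yvar /= -polyCM mul_polyC.
  rewrite coefMC coefC /= coefC; case: eqP => [->|/eqP i0]; last first.
    rewrite coef0 addr0 -scalerAr coefZ coefMX; case: j => [|j]; first by rewrite mulr0.
    by rewrite IHq (negPf i0) mulr0.
  rewrite -scalerAr coefZ !coefMX !coefC /=; case: j => [|j] /=.
    by rewrite mulr0 expr0 mul1r.
  by rewrite IHq eqxx exprS; ring.
have f2 q i j : (f q)`_i`_j = s ^+ (i + j) * q`_i`_j.
  elim/poly_ind: q i j => [|q a IHq] i j; first by rewrite rmorph0 !coef0 mulr0.
  rewrite rmorphD rmorphM fX mulrCA !coefD f1 /= coefCM coefCM coefMX coefMX coefC.
  have c0 : forall k, nth 0 (polyseq (0 : {poly R})) k = 0 by move=> k; rewrite coef0.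
  by case: i => [|i] /=; rewrite ?IHq !c0 ?mulr0 ?add0r ?addr0 // addSn exprS mulrA.
move=> q fq; apply/polyP => i; apply/polyP => j.
have := f2 q i j; rewrite fq !coef0 => /esym/eqP.
by rewrite mulf_eq0 expf_eq0 (negPf s0) andbF => /eqP.
Qed.

(** * Charts R[X, Y] -> Sym M *)

Section Charts.
Variables (R : idomainType) (M : lmodType R).
Implicit Types (p : prime_idealr R).
Notation S := {poly {poly R}}.
Notation B := (Sym M).

(* After inverting s, the module M is free on x, y with coordinates f / s, g / s. *)
Definition coordinates p s (x y : M) (f g : M -> R) :=
  [/\ s \notin p,
      (forall a m n, f (a *: m + n) = a * f m + f n) /\
      (forall a m n, g (a *: m + n) = a * g m + g n),
      forall m, s *: m = f m *: x + g m *: y,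
      f x = s /\ f y = 0 & g x = 0 /\ g y = s].

Lemma coordinates_swap p s x y f g :
  coordinates p s x y f g -> coordinates p s y x g f.
Proof. by move=> [sp [? ?] E [? ?] [? ?]]; split=> // m; rewrite addrC. Qed.

Lemma coordinates_exist p : has_rank M 2 -> finitely_generated M ->
  exists s x y f g, coordinates p s x y f g.
Proof.
move=> Mr Mf; have [s [x [phi [sp lin E phix]]]] := rank_coordinates p Mr Mf.
exists s, (x 0), (x 1), (phi 0), (phi 1); split=> //.
  move=> m; rewrite E !big_ord_recl big_ord0 addr0.
  by congr (_ + _ *: x _); [congr (phi _ _)|]; apply: val_inj.
Qed.

Lemma comm_in_sym (x : M) (A : nzRingType) (f : A -> B) : commr_rmorph f (sym_gen x).
Proof. by move=> a; apply: mulrC. Qed.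

Definition chart (x y : M) : {rmorphism S -> B} :=
  horner_morph (comm_in_sym x (horner_alg (sym_gen y))).

Lemma chartC x y a : chart x y (cst R a) = a%:A.
Proof. by rewrite /chart /= horner_morphC; apply: (horner_algC (sym_gen y)). Qed.
Lemma chartX x y : chart x y 'X = sym_gen x.
Proof. by rewrite /chart /= horner_morphX. Qed.
Lemma chartY x y : chart x y (Yvar R) = sym_gen y.
Proof. by rewrite /chart /= horner_morphC; apply: (horner_algX (sym_gen y)). Qed.
Lemma chartZ x y a q : chart x y (cst R a * q) = a *: chart x y q.
Proof. by rewrite rmorphM chartC mulr_algl. Qed.

Lemma chart_local_surj p s x y f g : coordinates p s x y f g ->
  forall b, exists2 t, t \notin p & exists q, t *: b = chart x y q.
Proof.
move=> [sp _ E _ _]; apply: sym_induction => [a|m|b c|b c].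
- by exists 1; [exact: notin1 | exists (cst R a); rewrite chartC scale1r].
- exists s => //; exists (cst R (f m) * 'X + cst R (g m) * Yvar R).
  by rewrite rmorphD !chartZ chartX chartY -!linearZ -linearD -E.
- move=> [t tp [q e]] [t' tp' [q' e']]; exists (t * t'); first exact: notinM.
  exists (cst R t' * q + cst R t * q'); rewrite rmorphD !chartZ -e -e' scalerDr.
  by rewrite !scalerA (mulrC t').
- move=> [t tp [q e]] [t' tp' [q' e']]; exists (t * t'); first exact: notinM.
  exists (q * q'); rewrite rmorphM -e -e' -scalerAl -scalerAr scalerA //.
Qed.

(** To avoid dividing by s, [r] inverts the chart only up to the dilation of X and Y by s, which is
    injective. *)
Lemma chart_retraction p s x y f g : coordinates p s x y f g ->
  exists r : {rmorphism B -> S}, [/\ forall a, r a%:A = cst R a,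
    forall m, r (sym_gen m) = cst R (f m) * 'X + cst R (g m) * Yvar R &
    forall q, r (chart x y q) = 0 -> q = 0].
Proof.
move=> [sp [fL gL] E [fx fy] [gx gy]].
have [|r [rC rG]] := @sym_ring_lift _ M _ (cst R)
    (fun m => cst R (f m) * 'X + cst R (g m) * Yvar R).
  by move=> a m n; rewrite fL gL !rmorphD !rmorphM; ring.
exists r; split=> // q.
apply: (@dilation_eq0 _ s (r \o chart x y)) => [||/=|/=] //.
- exact: denom_neq0 sp.
- by move=> a /=; rewrite chartC.
- by rewrite chartX rG fx gx rmorph0 mul0r addr0.
- by rewrite chartY rG fy gy rmorph0 mul0r add0r.
Qed.

Hypothesis Rn : noetherian R.
Hypotheses (Mr : has_rank M 2) (Mf : finitely_generated M).

Lemma sym_torsion_free a (b : B) : a != 0 -> a *: b = 0 -> b = 0.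
Proof.
move=> a0 ab; apply: local_eq0 => // p.
have [s [x [y [f [g C]]]]] := coordinates_exist p Mr Mf.
have [r [rC rG rE]] := chart_retraction C.
have [t tp [q e]] := chart_local_surj C b; exists t => //.
rewrite e (rE q) ?rmorph0 // -e -mulr_algl rmorphM.
suff -> : r b = 0 by rewrite mulr0.
have /eqP := congr1 r ab; rewrite -mulr_algl rmorphM rC rmorph0 mulf_eq0 cst_eq0 (negPf a0).
by move=> /eqP.
Qed.

Lemma retraction_eq0 p s x y f g (r : {rmorphism B -> S}) :
  coordinates p s x y f g -> (forall a, r a%:A = cst R a) ->
  (forall q, r (chart x y q) = 0 -> q = 0) -> forall b, r b = 0 -> b = 0.
Proof.
move=> C rC rE b rb; have [t tp [q e]] := chart_local_surj C b.
apply: (sym_torsion_free (denom_neq0 tp)); rewrite e (rE q) ?rmorph0 //.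
by rewrite -e -mulr_algl rmorphM rb mulr0.
Qed.

Lemma chart_inj p s x y f g : coordinates p s x y f g -> injective (chart x y).
Proof.
move=> C q q' e; have [r [_ _ rE]] := chart_retraction C.
by apply/eqP; rewrite -subr_eq0; apply/eqP/rE; rewrite rmorphB e subrr rmorph0.
Qed.

(** The morphism [r] of a single chart embeds [Sym M] in the domain R[X, Y]. *)
Lemma sym_domain (b c : B) : b * c = 0 -> b = 0 \/ c = 0.
Proof.
have [p _] := zero_prime_idealr R.
have [s [x [y [f [g C]]]]] := coordinates_exist p Mr Mf.
have [r [rC rG rE]] := chart_retraction C => /(congr1 r)/eqP.
rewrite rmorphM rmorph0 mulf_eq0.
by move=> /orP[] /eqP /(retraction_eq0 C rC rE); [left | right].
Qed.

Lemma sym_scale_inj a (b c : B) : a != 0 -> a *: b = a *: c -> b = c.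
Proof.
move=> a0 e; apply/eqP; rewrite -subr_eq0; apply/eqP/(sym_torsion_free a0).
by rewrite scalerBr e subrr.
Qed.

(* L is the homogenization m |-> m T; the size of L b is one more than the degree of b. *)
Lemma sym_degree : exists (L : {rmorphism B -> {poly S}}) (eps : {rmorphism B -> R}),
  [/\ forall a, L a%:A = (cst R a)%:P, forall a, eps a%:A = a,
      forall m, eps (sym_gen m) = 0, forall b, L b = 0 -> b = 0 &
      forall b, (size (L b) <= 1)%N -> b = (eps b)%:A].
Proof.
have [p _] := zero_prime_idealr R.
have [s [x [y [f [g C]]]]] := coordinates_exist p Mr Mf.
have [r [rC rG rE]] := chart_retraction C.
have r0 := retraction_eq0 C rC rE.
have rL a m n : r (sym_gen (a *: m + n)) = cst R a * r (sym_gen m) + r (sym_gen n).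
  by rewrite linearP /= rmorphD -mulr_algl rmorphM rC.
have [|L [LC LG]] := @sym_ring_lift _ M _ (polyC \o cst R) (fun m => (r (sym_gen m))%:P * 'X).
  by move=> a m n; rewrite rL polyCD polyCM /=; ring.
have [|eps [eC eG]] := @sym_ring_lift _ M _ idfun (fun=> 0).
  by move=> a m n; rewrite mulr0 addr0.
(* Setting T = 1 in L gives r and T = 0 gives eps; where L b is constant in T they agree, so b is a
   constant. *)
have L1 b : (L b).[1] = r b.
  apply: (sym_rmorph_ext (f := horner_eval 1 \o L) (g := r)) => [a|m] /=.
    by rewrite LC /horner_eval hornerC rC.
  by rewrite LG /horner_eval hornerM hornerC hornerX mulr1.
have L0 b : (L b).[0] = cst R (eps b).
  apply: (sym_rmorph_ext (f := horner_eval 0 \o L) (g := cst R \o eps)) => [a|m] /=.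
    by rewrite LC eC /horner_eval hornerC.
  by rewrite LG eG /horner_eval hornerM hornerX mulr0 !polyC0.
exists L, eps; split=> // b.
  by move=> Lb; apply: r0; rewrite -L1 Lb horner0.
move=> /size1_polyC Lb; apply/eqP; rewrite -subr_eq0; apply/eqP/r0.
by rewrite rmorphB rC -L1 -L0 Lb !hornerC subrr.
Qed.

End Charts.

(** * The kernel of D locally and the ideal D(B)B *)

Lemma codivisor_free_range (B : comPzRingType) (D : B -> B) :
  codivisor_free (ideal_gen (range D)) <->
  forall u v : B, v <> 0 -> (forall x, exists c, u * D x = v * c) -> exists c, u = v * c.
Proof.
split=> H u v v0 uv; apply: (H) => //; last first.
  by move=> x; apply: uv; apply: mem_ideal_gen; exists x.
apply: (@ideal_gen_sub _ (range D) [set y | exists c, u * y = v * c]).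
  split=> /= [|a b [c e] [c' e']|a b [c e]].
  - by exists 0; rewrite !mulr0.
  - by exists (c + c'); rewrite mulrDr e e' mulrDr.
  - by exists (a * c); rewrite mulrCA e mulrCA.
by move=> _ [x _ <-].
Qed.

Section LocalKernel.
Variables (R : idomainType) (M : lmodType R).
Hypothesis Rn : noetherian R.
Hypothesis natinv : forall n, exists c : R, n.+1%:R * c = 1.
Hypotheses (Mr : has_rank M 2) (Mf : finitely_generated M).
Notation S := {poly {poly R}}.
Notation B := (Sym M).
Variable D : {linear B -> B}.
Hypotheses (HD : derivation D) (Dl : locally_nilpotent D).
Implicit Types p : prime_idealr R.

(* Up to denominators outside p, the kernel is R[F]. *)
Definition local_kernel p := exists2 F, D F = 0 & forall G, D G = 0 ->
  exists2 t, t \notin p & exists h, t *: G = ev (in_alg B) F h.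

Lemma D_const a : D a%:A = 0.
Proof. by rewrite linearZZ (der1 HD) scaler0. Qed.

(* Up to denominators outside p, the algebra Sym M is R[X, Y] and D is the
   derivation U dX + V dY. *)
Record plane_model p := PlaneModel {
  pm_map : {rmorphism S -> B};
  pm_U : S; pm_V : S; pm_s : R; pm_t : R;
  pm_mapC : forall a, pm_map (cst R a) = a%:A;
  pm_inj : injective pm_map;
  pm_surj : forall b, exists2 t, t \notin p & exists q, t *: b = pm_map q;
  pm_s_notin : pm_s \notin p;
  pm_t_notin : pm_t \notin p;
  pm_V_neq0 : pm_V != 0;
  pm_der : forall q, pm_map (plder pm_U pm_V q) = pm_s *: D (pm_map q);
  pm_lnd : locally_nilpotent (plder pm_U pm_V);
  pm_image : forall b, exists c d, pm_t *: D b = pm_map pm_U * c + pm_map pm_V * d;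
  pm_UV : (exists x, pm_map pm_U = pm_s *: D x) /\ (exists x, pm_map pm_V = pm_s *: D x)
}.

(** The coordinates are swapped if necessary so that D y, and hence V, is nonzero; a derivation
    killing both x and y would vanish. *)
Lemma plane_model_exists p : (exists b, D b <> 0) -> inhabited (plane_model p).
Proof.
move=> [b0 Db0].
have [s [x [y [f [g [C Dy]]]]]] : exists s x y f g,
    coordinates p s x y f g /\ D (sym_gen y) <> 0.
  have [s [x [y [f [g C]]]]] := coordinates_exist p Mr Mf.
  case: (pselect (D (sym_gen y) = 0)) => [Dy|Dy]; last by exists s, x, y, f, g.
  case: (pselect (D (sym_gen x) = 0)) => [Dx|Dx]; last first.
    by exists s, y, x, g, f; split=> //; apply: coordinates_swap.
  case: Db0; elim/sym_induction: b0 => [a|m|b c Db Dc|b c Db Dc].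
  - exact: D_const.
  - have [sp _ E _ _] := C.
    apply: (sym_torsion_free Rn Mr Mf (denom_neq0 sp)).
    by rewrite -linearZZ -linearZ E /= linearD !linearZ /= linearD !linearZ /= Dx Dy !scaler0 addr0.
  - by rewrite linearD Db Dc addr0.
  - by rewrite (der_mul HD) Db Dc mul0r mulr0 addr0.
have [tx txp [U0 eU]] := chart_local_surj C (D (sym_gen x)).
have [ty typ [V0 eV]] := chart_local_surj C (D (sym_gen y)).
have [sp _ E _ _] := C.
pose U := cst R ty * U0; pose V := cst R tx * V0; pose t0 := tx * ty.
have EU : chart x y U = t0 *: D (sym_gen x).
  by rewrite chartZ -eU scalerA mulrC.
have EV : chart x y V = t0 *: D (sym_gen y).
  by rewrite chartZ -eV scalerA.
have t0p : t0 \notin p by apply: notinM.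
have Edef q : chart x y (plder U V q) = t0 *: D (chart x y q).
  have HP := plder_der U V.
  elim/plane_induction: q => [a|||q r Hq Hr|q r Hq Hr].
  - by rewrite plder_cst rmorph0 chartC D_const scaler0.
  - by rewrite /plder dX_X dY_X mulr1 mulr0 addr0 EU chartX.
  - by rewrite /plder dX_Y dY_Y mulr1 mulr0 add0r EV chartY.
  - by rewrite (der_add HP) rmorphD Hq Hr rmorphD linearD scalerDr.
  - rewrite (der_mul HP) rmorphD [chart x y (plder _ _ _ * r)]rmorphM.
    rewrite [chart x y (q * plder _ _ _)]rmorphM.
    by rewrite Hq Hr rmorphM (der_mul HD) scalerDr scalerAl scalerAr.
constructor; apply: (@PlaneModel p (chart x y) U V t0 (s * t0)) => //.
- exact: chartC.
- exact: (chart_inj C).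
- exact: (chart_local_surj C).
- exact: notinM.
- apply/eqP => V00; apply: Dy; apply: (sym_torsion_free Rn Mr Mf (denom_neq0 t0p)).
  by rewrite -EV V00 rmorph0.
- move=> q; have [n Dn] := Dl (chart x y q); exists n; apply: (chart_inj C).
  have Hn k : chart x y (iter k (plder U V) q) = t0 ^+ k *: iter k D (chart x y q).
    elim: k => [|k IHk]; first by rewrite scale1r.
    by rewrite iterS Edef IHk linearZZ scalerA -exprS.
  by rewrite Hn Dn scaler0 rmorph0.
- elim/sym_induction => [a|m|b c [b1 [b2 Hb]] [c1 [c2 Hc]]|b c [b1 [b2 Hb]] [c1 [c2 Hc]]].
  + by exists 0, 0; rewrite D_const !mulr0 addr0 scaler0.
  + exists (f m)%:A, (g m)%:A; rewrite !mulr_algr EU EV.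
    have e : s *: D (sym_gen m) = f m *: D (sym_gen x) + g m *: D (sym_gen y).
      by rewrite -linearZZ -linearZ E /= linearD !linearZ /= linearD !linearZ.
    by rewrite (mulrC s) -scalerA e scalerDr !scalerA ![t0 * _]mulrC.
  + by exists (b1 + c1), (b2 + c2); rewrite linearD scalerDr Hb Hc; ring.
  + exists (b1 * c + c1 * b), (b2 * c + c2 * b).
    rewrite (der_mul HD) scalerDr scalerAl Hb (mulrC b) scalerAl Hc; ring.
- by split; [exists (sym_gen x) | exists (sym_gen y)].
Qed.

Lemma pm_mapZ p (C : plane_model p) a q : pm_map C (cst R a * q) = a *: pm_map C q.
Proof. by rewrite rmorphM pm_mapC mulr_algl. Qed.

Lemma pm_ker p (C : plane_model p) q :
  plder (pm_U C) (pm_V C) q = 0 <-> D (pm_map C q) = 0.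
Proof.
split=> [H|H].
  apply: (sym_torsion_free Rn Mr Mf (denom_neq0 (pm_s_notin C))).
  by rewrite -pm_der H rmorph0.
by apply: (@pm_inj _ C); rewrite pm_der H scaler0 rmorph0.
Qed.

Lemma codivisor_local_kernel p : (exists b, D b <> 0) ->
  codivisor_free (ideal_gen (range D)) ->
  local_kernel p /\ exists2 G, D G = 0 & forall a, G <> a%:A.
Proof.
move=> Dn0 /codivisor_free_range cf; have [C] := plane_model_exists p Dn0.
have W_neq0 := @denom_neq0 _ p.
have [|F [FU FV Fgen]] := plane_kernel natinv (W := [set t | t \notin p]) (notin1 p)
    (@notinM _ p) W_neq0 (pm_V_neq0 C) (@pm_lnd _ C).
  move=> u v v0 [c1 e1] [c2 e2].
  have [||c ec] := cf (pm_t C *: pm_map C u) (pm_map C v).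
  - by move=> /eqP; rewrite -(rmorph0 (pm_map C)) (inj_eq (@pm_inj _ C)) (negPf v0).
  - move=> b; have [c [d E]] := pm_image C b.
    exists (pm_map C c1 * c + pm_map C c2 * d).
    rewrite -scalerAl scalerAr E mulrDr !mulrA -!rmorphM e1 e2 !rmorphM; ring.
  have [t tp [q eq]] := pm_surj C c.
  exists (t * pm_t C) => /=; first by apply: notinM => //; apply: pm_t_notin.
  exists q; apply: (@pm_inj _ C).
  by rewrite pm_mapZ rmorphM -eq -scalerA ec scalerAr.
have DF : D (pm_map C F) = 0.
  by apply/pm_ker; rewrite /plder FU FV; ring.
split; last first.
  exists (pm_map C F) => // a; rewrite -(pm_mapC C) => /(@pm_inj _ C) Fa.
  have := pm_V_neq0 C; rewrite -oppr_eq0 -FV Fa dX_cst.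
  by rewrite eqxx.
exists (pm_map C F) => // G DG; have [t tp [q eq]] := pm_surj C G.
have /Fgen[t' tp' [h eh]] : plder (pm_U C) (pm_V C) q = 0.
  by apply/pm_ker; rewrite -eq linearZZ DG scaler0.
exists (t' * t); first exact: notinM.
exists h; rewrite -scalerA eq -pm_mapZ eh; apply: rmorph_ev.
exact: pm_mapC.
Qed.

(** With p0 = p or p0 = 0 one chart serves both R_p and K. By [pm_image] a common divisor of U and V
    divides all values of D up to units. *)
Lemma pm_irreducible p (C : plane_model p) (p0 : prime_idealr R) g t :
  (forall x, x \notin p -> x \notin p0) -> irreducible (loc_map p0 D) -> t \notin p0 ->
  (exists c, cst R t * pm_U C = g * c) -> (exists c, cst R t * pm_V C = g * c) ->
  exists2 t', t' \notin p0 & exists c, g * c = cst R t'.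
Proof.
move=> pp0 irr tp [c1 e1] [c2 e2]; apply: contrapT => ng; apply: irr.
exists (frac (pm_map C g) (denom1 p0)); split.
  move=> [z]; have [c [w ->]] := fracE z; rewrite fracM => /frac_eq[u].
  rewrite /= scale1r mul1r => e; apply: ng.
  have [t1 t1p [q eq]] := pm_surj C (denom_val u *: c).
  exists (t1 * (denom_val u * denom_val w)).
    by apply: notinM; [apply: pp0 | apply: notinM; apply: denomP].
  exists q; apply: (@pm_inj _ C); rewrite rmorphM -eq pm_mapC -!scalerA -e.
  by rewrite -!scalerAr.
move=> z; have [b [w ->]] := fracE z.
have stp : pm_t C * t \notin p0 by apply: notinM => //; apply/pp0/pm_t_notin.
have [c [d E]] := pm_image C b.
exists (frac (pm_map C c1 * c + pm_map C c2 * d) (denomM w (LocDenom stp))).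
rewrite loc_mapE fracM; apply: frac_eqW => /=.
rewrite mul1r; have -> : pm_map C g * (pm_map C c1 * c + pm_map C c2 * d) =
    pm_map C (g * c1) * c + pm_map C (g * c2) * d by rewrite !rmorphM; ring.
by rewrite -e1 -e2 !pm_mapZ -!scalerAl -scalerDr -E !scalerA; congr (_ *: _); ring.
Qed.

Lemma local_kernel_codivisor : (exists b, D b <> 0) ->
  (forall p, irreducible (loc_map p D)) -> (forall p, local_kernel p) ->
  codivisor_free (ideal_gen (range D)).
Proof.
move=> Dn0 irr lk; apply/codivisor_free_range => u v v0 uv.
have : [set b | exists c, b = v * c] u; last by [].
apply: (@local_submodule R) => // [|a b b' [c ->] [c' ->]|p].
- by exists 0; rewrite mulr0.
- by exists (a *: c + c'); rewrite mulrDr scalerAr.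
have [C] := plane_model_exists p Dn0; have [F DF Fgen] := lk p.
have [tF tFp [F' eF]] := pm_surj C F.
have [tu tup [u0 eu]] := pm_surj C u; have [tv tvp [v1 ev1]] := pm_surj C v.
have v10 : v1 != 0.
  apply: contra_notN v0 => /eqP v10.
  by apply: (sym_torsion_free Rn Mr Mf (denom_neq0 tvp)); rewrite ev1 v10 rmorph0.
have [[xU eU] [xV eV]] := pm_UV C.
have [cU ecU] := uv xU; have [cV ecV] := uv xV.
have [tU tUp [qU eqU]] := pm_surj C cU; have [tV tVp [qV eqV]] := pm_surj C cV.
(* F need not come from the chart; its multiple tF F does, and [ev_scale] rewrites polynomials
   accordingly. *)
have Fgen' G : plder (pm_U C) (pm_V C) G = 0 ->
    exists2 t, t \notin p & exists h, cst R t * G = ev (cst R) F' h.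
  move=> /pm_ker/Fgen[t tp [h eh]]; have [n [k E]] := ev_scale (in_alg B) tF h.
  exists (tF ^+ n * t).
    by apply: notinM => //; elim: (n) => [|m IHm]; rewrite ?exprS; [apply: notin1|apply: notinM].
  exists k; apply: (@pm_inj _ C).
  rewrite pm_mapZ (rmorph_ev (c' := in_alg B) _ _ (pm_mapC C)) -eF -scalerA eh.
  by rewrite -[tF *: F]mulr_algl -E -rmorphXn mulr_algl.
have [p0 Hp0] := zero_prime_idealr R.
have neq0_p0 x : x != 0 <-> x \notin p0.
  split; apply: contraNN; first by move=> /Hp0 ->.
  by move=> /eqP/Hp0.
have DF' : plder (pm_U C) (pm_V C) F' = 0.
  by apply/pm_ker; rewrite -eF linearZZ DF scaler0.
have pcf : plane_codivisor_free [set t | t \notin p] (pm_U C) (pm_V C).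
  apply: (plane_codivisor natinv) DF' Fgen' _ _.
  - exact: notin1.
  - exact: notinM.
  - exact: denom_neq0.
  - exact: pm_V_neq0.
  - exact: pm_lnd.
  - by move=> g t tp; apply: pm_irreducible.
  - move=> g t /neq0_p0 t0 H1 H2.
    have [t' t'p H] : exists2 t', t' \notin p0 & exists c, g * c = cst R t'.
      apply: (pm_irreducible (C := C) (t := t)) => // x xp; apply/neq0_p0.
      exact: denom_neq0 xp.
    by exists t' => //; apply/neq0_p0.
(* The extra factors clear the denominators of v, cU and cV, so that v1 divides u1 U and u1 V in
   R[X, Y]. *)
pose u1 := cst R (tv * tU * tV) * u0.
have [||t tp [c ec]] := pcf u1 v1 v10.
- exists (cst R (tu * pm_s C * tV) * qU); apply: (@pm_inj _ C).
  rewrite !rmorphM !pm_mapC -eu -ev1 eU -eqU !mulr_algl.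
  rewrite !(=^~ scalerAl, =^~ scalerAr) ecU !scalerA.
  by congr (_ *: _); ring.
- exists (cst R (tu * pm_s C * tU) * qV); apply: (@pm_inj _ C).
  rewrite !rmorphM !pm_mapC -eu -ev1 eV -eqV !mulr_algl.
  rewrite !(=^~ scalerAl, =^~ scalerAr) ecV !scalerA.
  by congr (_ *: _); ring.
exists (t * (tv * tU * tV * tu)).
  by do !apply: notinM.
exists (tv *: pm_map C c).
rewrite -scalerAr scalerAl ev1 -rmorphM -ec /u1 !pm_mapZ -eu !scalerA.
by congr (_ *: _); ring.
Qed.

End LocalKernel.

(** * Invertible modules and the global kernel *)

Section Submodule.
Variables (R : pzRingType) (V : lmodType R) (P : set V).
Hypotheses (P0 : P 0) (PL : forall a x y, P x -> P y -> P (a *: x + y)).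

Definition submodule_pred : {pred V} := fun x => `[< P x >].

Lemma submodule_pred_closed : submod_closed submodule_pred.
Proof.
split; first by apply/asboolP.
by move=> a x y /asboolP Px /asboolP Py; apply/asboolP/PL.
Qed.

HB.instance Definition _ :=
  GRing.isSubmodClosed.Build R V submodule_pred submodule_pred_closed.

Definition submodule := {x : V | x \in submodule_pred}.
HB.instance Definition _ := SubChoice.on submodule.
HB.instance Definition _ := [SubChoice_isSubLmodule of submodule by <:].

Lemma submodule_exists : exists (N : lmodType R) (i : {linear N -> V}),
  injective i /\ range i = P.
Proof.
exists submodule, (val : {linear submodule -> V}); split; first exact: val_inj.
apply/seteqP; split=> [_ [x _ <-]|x Px]; first exact/asboolP/(valP x).
have xP : x \in submodule_pred by apply/asboolP.
by exists (Sub x xP : submodule) => //; apply: SubK.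
Qed.

End Submodule.

(** * Locally cyclic ideals are projective of rank one *)

Section Invertible.
Variables (R : idomainType) (N : lmodType R) (k : N -> R).
Hypothesis Rn : noetherian R.
Hypotheses (k_lin : forall a x y, k (a *: x + y) = a * k x + k y) (k_inj : injective k).
Hypothesis N_local : forall p : prime_idealr R, exists2 e : N, e <> 0 &
  forall x, exists2 t, t \notin p & exists r, t *: x = r *: e.

Let kD x y : k (x + y) = k x + k y.
Proof. by rewrite -{1}[x]scale1r k_lin mul1r. Qed.
Let k0 : k 0 = 0. Proof. by apply: (addrI (k 0)); rewrite -kD !addr0. Qed.
Let kZ a x : k (a *: x) = a * k x. Proof. by rewrite -[a *: x]addr0 k_lin k0 addr0. Qed.
Let k_sum (I : Type) (r : seq I) (f : I -> N) :
  k (\sum_(i <- r) f i) = \sum_(i <- r) k (f i).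
Proof. by elim/big_rec2: _ => // i x y _ <-; rewrite kD. Qed.

Let N_torsion_free a (x : N) : a *: x = 0 -> a = 0 \/ x = 0.
Proof.
move=> /(congr1 k)/eqP; rewrite kZ k0 mulf_eq0 => /orP[] /eqP H; [by left | right].
by apply: k_inj; rewrite k0.
Qed.

Lemma invertible_fg : finitely_generated N.
Proof.
have [s Js] : exists s : seq R, range k = ideal_gen [set` s].
  apply: Rn; split; first by exists 0.
    by move=> _ _ [x _ <-] [y _ <-]; exists (x + y).
  by move=> a _ [x _ <-]; exists (a *: x).
have /choice[g Hg] : forall i : 'I_(size s), exists x, k x = s`_i.
  move=> i; have : range k s`_i by rewrite Js; apply: mem_ideal_gen; apply: mem_nth.
  by move=> [x _ <-]; exists x.
exists (size s), g => x.
have : ideal_gen [set` s] (k x) by rewrite -Js; exists x.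
move=> /(@ideal_gen_sub _ _ [set r | exists a : 'I_(size s) -> R, r = \sum_i a i * s`_i]).
case=> [|r rs|a ea].
- split=> [|_ _ [a ->] [b ->]|c _ [a ->]].
  + by exists (fun=> 0); rewrite big1 // => i _; rewrite mul0r.
  + exists (fun i => a i + b i); rewrite -big_split.
    by apply: eq_bigr => i _; rewrite mulrDl.
  + by exists (fun i => c * a i); rewrite mulr_sumr; apply: eq_bigr => i _; rewrite mulrA.
- have rs' : (index r s < size s)%N by rewrite index_mem.
  exists (fun i => if i == Ordinal rs' then 1 else 0).
  rewrite (bigD1 (Ordinal rs')) //= eqxx mul1r nth_index // big1 ?addr0 // => i /negPf ->.
  by rewrite mul0r.
exists a; apply: k_inj; rewrite ea k_sum; apply: eq_bigr => i _.
by rewrite kZ Hg.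
Qed.

Let functional (f : N -> R) := forall a x y, f (a *: x + y) = a * f x + f y.

Let functionalZ f a x : functional f -> f (a *: x) = a * f x.
Proof.
move=> fL; have f0 : f 0 = 0.
  by have := fL 1 0 0; rewrite scaler0 addr0 mul1r -{1}[f 0]addr0 => /addrI <-.
by rewrite -[a *: x]addr0 fL f0 addr0.
Qed.

(** The coordinate along the local generator e, times a common denominator s, is a functional on N
    with value s at e. *)
Let local_functional (p : prime_idealr R) :
  exists f x, functional f /\ f x \notin p.
Proof.
have [e e0 He] := N_local p; have [m [g gspan]] := invertible_fg.
have /choice[tr Htr] : forall i, exists tr : R * R,
    tr.1 \notin p /\ tr.1 *: g i = tr.2 *: e.
  by move=> i; have [t tp [r er]] := He (g i); exists (t, r).
pose s := \prod_i (tr i).1.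
have sp : s \notin p.
  rewrite /s; elim/big_ind: _ => [|a b|i _]; [exact: notin1|exact: notinM|by case: (Htr i)].
have /choice[f Hf] : forall x, exists r, s *: x = r *: e.
  move=> x; have [a ->] := gspan x.
  exists (\sum_i a i * (\prod_(j | j != i) (tr j).1 * (tr i).2)).
  rewrite scaler_sumr scaler_suml; apply: eq_bigr => i _.
  transitivity (a i *: (\prod_(j | j != i) (tr j).1 *: ((tr i).1 *: g i))).
    by rewrite !scalerA; congr (_ *: _); rewrite /s (bigD1 i) //=; ring.
  by rewrite (Htr i).2 !scalerA mulrA.
have e_inj a b : a *: e = b *: e -> a = b.
  move=> ab; have : (a - b) *: e = 0 by rewrite scalerBl ab subrr.
  by move=> /N_torsion_free[/eqP|//]; rewrite subr_eq0 => /eqP.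
exists f, e; split; last by rewrite -(e_inj _ _ (Hf e)).
move=> a x y; apply: e_inj; rewrite -Hf scalerDl -scalerA -!Hf.
by rewrite scalerDr !scalerA mulrC.
Qed.

(** The trace ideal, generated by the values of functionals, is locally and hence globally R. In
    rank one f(g) x = f(x) g, so 1 = sum f_i(g_i) expands every x. *)
Lemma dual_basis : exists m (f : 'I_m -> N -> R) (g : 'I_m -> N),
  (forall i, functional (f i)) /\ forall x, x = \sum_i f i x *: g i.
Proof.
have [m [f [g [fL fg]]]] : exists m (f : 'I_m -> N -> R) (g : 'I_m -> N),
    (forall i, functional (f i)) /\ 1 = \sum_i f i (g i).
  apply: (@ideal_unit_of_local R [set r | exists m (f : 'I_m -> N -> R) (g : 'I_m -> N),
    (forall i, functional (f i)) /\ r = \sum_i f i (g i)]) => // [|p].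
    split.
    - by exists 0%N, (fun _ _ => 0), (fun=> 0); split; [case | rewrite big_ord0].
    - move=> _ _ [m [f [g [fL ->]]]] [m' [f' [g' [fL' ->]]]].
      exists (m + m')%N, (fun i => match split i with inl j => f j | inr j => f' j end),
        (fun i => match split i with inl j => g j | inr j => g' j end).
      split; first by move=> i; case: (split i).
      rewrite big_split_ord; congr (_ + _); apply: eq_bigr => i _.
        by have := unsplitK (inl i : 'I_m + 'I_m'); rewrite /unsplit => ->.
      by have := unsplitK (inr i : 'I_m + 'I_m'); rewrite /unsplit => ->.
    - move=> a _ [m [f [g [fL ->]]]]; exists m, f, (fun i => a *: g i); split=> //.
      by rewrite mulr_sumr; apply: eq_bigr => i _; rewrite functionalZ.
  have [f [x [fL fx]]] := local_functional p; exists (f x) => //.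
  by exists 1%N, (fun=> f), (fun=> x); rewrite big_ord_recl big_ord0 addr0.
exists m, f, g; split=> // x; rewrite -{1}[x]scale1r fg scaler_suml.
apply: eq_bigr => i _; apply: k_inj; rewrite !kZ.
have e : k x *: g i = k (g i) *: x by apply: k_inj; rewrite !kZ mulrC.
by have := congr1 (f i) e; rewrite !functionalZ // mulrC => ->; rewrite mulrC.
Qed.

Lemma invertible_projective : projective N.
Proof.
have [m [f [g [fL fg]]]] := dual_basis.
move=> U V a b a_surj; have /choice[u Hu] : forall i, exists u, a u = b (g i).
  by move=> i; apply: a_surj.
pose h x : U := \sum_i f i x *: u i.
have h_lin : linear h.
  move=> c x y; rewrite /h scaler_sumr -big_split; apply: eq_bigr => i _.
  by rewrite fL scalerDl scalerA.
pose hL : {linear N -> U} := HB.pack h (GRing.isLinear.Build _ _ _ _ h h_lin).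
exists hL => x; rewrite /= /h linear_sum {2}[x]fg linear_sum.
by apply: eq_bigr => i _; rewrite !linearZ /= Hu.
Qed.

Lemma invertible_rank1 : has_rank N 1.
Proof.
move=> p; have [e e0 He] := N_local p.
pose f (v : 'rV[loc_ring p]_1) : loc p N := v 0 0 *: frac e (denom1 p).
have f_lin : linear f by move=> c x y; rewrite /f !mxE scalerDl scalerA.
pose fL : {linear 'rV[loc_ring p]_1 -> loc p N} :=
  HB.pack f (GRing.isLinear.Build _ _ _ _ f f_lin).
have f_inj : injective fL.
  move=> v w; rewrite /= /f => vw; apply/rowP => i; rewrite ord1.
  apply/eqP; rewrite -subr_eq0; apply/eqP.
  have : (v 0 0 - w 0 0) *: frac e (denom1 p) = 0 by rewrite scalerBl vw subrr.
  have [r [t ->]] := fracE (v 0 0 - w 0 0).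
  rewrite fracZ => /frac_eq[u]; rewrite /= scale1r !scaler0 scalerA => /N_torsion_free[|//].
  move/eqP; rewrite mulf_eq0 (negPf (denom_neq0 (denomP u))) => /eqP r0.
  by apply: frac_eqW; rewrite r0 !scaler0.
have /choice[g gK] : forall y, exists v, fL v = y.
  move=> y; have [x [w ->]] := fracE y; have [t tp [r er]] := He x.
  exists (const_mx (frac (r : R^o) (denomM w (LocDenom tp)))); rewrite /= /f mxE.
  by rewrite fracZ; apply: frac_eqW => /=; rewrite -er !scalerA; congr (_ *: _); ring.
by exists fL; exists g => // v; apply: f_inj; rewrite gK.
Qed.

End Invertible.

(** * The kernel as a symmetric algebra *)

Section KernelSym.
Variables (R : idomainType) (M : lmodType R).
Hypothesis Rn : noetherian R.
Hypotheses (Mr : has_rank M 2) (Mf : finitely_generated M).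
Notation S := {poly {poly R}}.
Notation B := (Sym M).
Variable D : {linear B -> B}.
Hypothesis HD : derivation D.
Implicit Types p : prime_idealr R.

Lemma sym_local_generation (N : lmodType R) p (n : N) :
  (forall m, exists2 t, t \notin p & exists r, t *: m = r *: n) ->
  forall z : Sym N, exists2 t, t \notin p &
    exists h, t *: z = ev (in_alg (Sym N)) (sym_gen n) h.
Proof.
move=> nspan; elim/sym_induction =>
  [a|m|z w [t tp [h e]] [t' tp' [h' e']]|z w [t tp [h e]] [t' tp' [h' e']]].
- by exists 1; [exact: notin1 | exists a%:P; rewrite ev_C scale1r].
- have [t tp [r e]] := nspan m; exists t => //; exists (r%:P * 'X).
  by rewrite ev_mul ev_C ev_X mulr_algl -[RHS]linearZZ -[LHS]linearZZ e.
- exists (t * t'); first exact: notinM.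
  exists (t'%:P * h + t%:P * h'); rewrite ev_add !ev_mul !ev_C -e -e' !mulr_algl.
  by rewrite scalerDr !scalerA (mulrC t').
- exists (t * t'); first exact: notinM.
  by exists (h * h'); rewrite ev_mul -e -e' -scalerAl -scalerAr scalerA.
Qed.

Lemma sym_kernel_local (N : lmodType R) (f : {lrmorphism Sym N -> B}) :
  projective_of_rank N 1 -> range f = Ker D -> forall p, local_kernel D p.
Proof.
move=> [Nf _ Nr] fK p; have [s [x [phi [sp _ E _]]]] := rank_coordinates p Nr Nf.
have /sym_local_generation Hn m : exists2 t, t \notin p & exists r, t *: m = r *: x 0.
  by exists s => //; exists (phi 0 m); rewrite E big_ord_recl big_ord0 addr0.
set n := x 0 in Hn.
exists (f (sym_gen n)) => [|G DG].
  by have : Ker D (f (sym_gen n)) by rewrite -fK; exists (sym_gen n).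
have [z _ <-] : range f G by rewrite fK.
have [t tp [h e]] := Hn z; exists t => //; exists h.
rewrite -linearZZ e; apply: (rmorph_ev (c' := in_alg B)) => a.
exact: rmorph_alg.
Qed.

Section FromLocal.
Variable G0 : B.
Hypotheses (DG0 : D G0 = 0) (G0_nc : forall a, G0 <> a%:A).
Hypothesis lk : forall p, local_kernel D p.

Variables (L : {rmorphism B -> {poly S}}) (eps : {rmorphism B -> R}).
Hypotheses (LC : forall a, L a%:A = (cst R a)%:P) (epsC : forall a, eps a%:A = a).
Hypothesis L_const : forall b, (size (L b) <= 1)%N -> b = (eps b)%:A.

Let deg b := (size (L b)).-1.

Let cst_inj : injective (cst R).
Proof. by move=> a b /polyC_inj/polyC_inj. Qed.

Let epsZ a b : eps (a *: b) = a * eps b.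
Proof. by rewrite -mulr_algl rmorphM epsC. Qed.

Let degZ a b : a != 0 -> deg (a *: b) = deg b.
Proof.
move=> a0; rewrite /deg -mulr_algl rmorphM LC mul_polyC size_scale //.
by rewrite cst_eq0.
Qed.

Let deg_ev F h : deg (ev (in_alg B) F h) = ((size h).-1 * deg F)%N.
Proof.
rewrite /deg -(ev_size _ _ cst_inj); congr (_.-1); congr (size (polyseq _)).
exact: rmorph_ev.
Qed.

Let generator p F := [/\ D F = 0, eps F = 0, (0 < deg F)%N & forall G, D G = 0 ->
  exists2 t, t \notin p & exists h, t *: G = ev (in_alg B) F h].

Let generator_exists p : exists F, generator p F.
Proof.
have [F DF Fgen] := lk p; exists (F - (eps F)%:A); split.
- by rewrite linearB DF (D_const HD) subrr.
- by rewrite rmorphB epsC subrr.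
(* Were F constant, some t G0 with t outside p, and then G0 itself, would be constant. *)
- rewrite lt0n; apply/eqP => dF.
  have /L_const : (size (L (F - (eps F)%:A)%R) <= 1)%N by move: dF; rewrite /deg; lia.
  rewrite rmorphB epsC subrr scale0r => /eqP; rewrite subr_eq0 => /eqP eF.
  have [t tp [h e]] := Fgen _ DG0.
  move: e; rewrite eF -(rmorph_ev (c := idfun) (c' := in_alg B) (f := in_alg B)) // => e.
  have := congr1 eps e; rewrite epsZ epsC => er.
  apply: (G0_nc (a := eps G0)); apply: (sym_scale_inj Rn Mr Mf (denom_neq0 tp)).
  by rewrite e -er scalerA.
- move=> G /Fgen[t tp [h e]]; exists t => //.
  by exists (h \Po ('X + (eps F)%:P)); rewrite -ev_shift /= subrK.
Qed.

(** Comparing degrees bounds the degree of h by one, and applying eps removes its constant term. *)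
Let linear_part p F b t h : generator p F -> t != 0 -> eps b = 0 ->
  b = 0 \/ deg b = deg F -> t *: b = ev (in_alg B) F h -> exists r, t *: b = r *: F.
Proof.
move=> [DF eF dF Fgen] t0 eb [->|db] e; first by exists 0; rewrite scaler0 scale0r.
have sh : (size h <= 2)%N.
  have := deg_ev F h; rewrite -e degZ // db => H.
  suff : (size h).-1 = 1%N by lia.
  by apply/eqP; rewrite -(eqn_pmul2r dF) mul1n -H.
have eh : h = (h`_1)%:P * 'X + (h`_0)%:P.
  apply/polyP => i; rewrite coefD coefCM coefX coefC.
  case: i => [|[|i]] /=; rewrite ?mulr0n ?mulr1n ?mulr0 ?mulr1 ?add0r ?addr0 //.
  by rewrite nth_default // (leq_trans sh).
have h0 : h`_0 = 0.
  have := congr1 eps e; rewrite epsZ eb mulr0 {1}eh ev_add ev_mul !ev_C ev_X mulr_algl.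
  by rewrite rmorphD epsZ eF mulr0 add0r /= epsC => <-.
by exists h`_1; rewrite e {1}eh h0 ev_add ev_mul !ev_C ev_X rmorph0 addr0 mulr_algl.
Qed.

(* Two generators, over two primes, are proportional over the fraction field:
   each is a polynomial in the other, so both have the same degree. *)
Let generator_deg p p' F F' : generator p F -> generator p' F' -> deg F = deg F'.
Proof.
move=> [DF _ dF Fgen] [DF' _ dF' Fgen'].
have [t tp [h e]] := Fgen _ DF'; have [t' tp' [h' e']] := Fgen' _ DF.
have := deg_ev F h; rewrite -e degZ ?(denom_neq0 tp) // => d1.
have := deg_ev F' h'; rewrite -e' degZ ?(denom_neq0 tp') // => d2.
have h0 : (0 < (size h).-1)%N by move: dF'; rewrite d1 muln_gt0 => /andP[].
have h0' : (0 < (size h').-1)%N by move: dF; rewrite d2 muln_gt0 => /andP[].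
by apply/eqP; rewrite eqn_leq; apply/andP; split; [rewrite d1 | rewrite d2]; apply: leq_pmull.
Qed.

Lemma kernel_sym_of_local : exists N : lmodType R, projective_of_rank N 1 /\
  exists f : {lrmorphism Sym N -> B}, injective f /\ range f = Ker D.
Proof.
have [p0 Hp0] := zero_prime_idealr R.
have [F0 HF0] := generator_exists p0; have [DF0 eF0 dF0 F0gen] := HF0.
(* Proportionality to a single F0 over K makes P a module of rank one; by [generator_deg] it
   contains the generators at every prime. *)
pose P : set B := [set n | [/\ D n = 0, eps n = 0 &
  exists2 a, a != 0 & exists r, a *: n = r *: F0]].
have P0 : P 0.
  split; rewrite ?linear0 ?rmorph0 //; exists 1; first exact: oner_neq0.
  by exists 0; rewrite scaler0 scale0r.
have PL a x y : P x -> P y -> P (a *: x + y).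
  move=> [Dx ex [b b0 [r er]]] [Dy ey [c c0 [r' er']]]; split.
  - by rewrite linearP Dx Dy scaler0 addr0.
  - by rewrite rmorphD epsZ ex ey mulr0 addr0.
  - exists (b * c); first exact: mulf_neq0.
    exists (c * a * r + b * r'); rewrite scalerDl -!scalerA -er -er' !scalerDr.
    by rewrite !scalerA; congr (_ *: _ + _ *: _); ring.
have [N [i [i_inj iP]]] := submodule_exists P0 PL.
have iN n : P (i n) by rewrite -iP; exists n.
have P_lin p F t n h : generator p F -> t != 0 -> P n -> t *: n = ev (in_alg B) F h ->
    exists r, t *: n = r *: F.
  move=> HF t0 [Dn en [a a0 [r er]]]; apply: (linear_part HF t0 en).
  case: (eqVneq r 0) er => [->|r0] er.
    by left; apply: (sym_torsion_free Rn Mr Mf a0); rewrite er scale0r.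
  by right; rewrite -(degZ _ a0) er degZ // (generator_deg HF0 HF).
have gen_P p F : generator p F -> P F.
  move=> HF; have [DF eF dF Fgen] := HF; split=> //.
  have [a ap [h e]] := F0gen _ DF; exists a; first exact: denom_neq0 ap.
  apply: (linear_part HF0 (denom_neq0 ap) eF _ e).
  by right; apply: generator_deg HF HF0.
have gen_N p : exists2 e : N, generator p (i e) &
    forall x, exists2 t, t \notin p & exists r, t *: x = r *: e.
  have [F HF] := generator_exists p; have [_ _ _ Fgen] := HF.
  have [e _ ei] : range i F by rewrite iP; apply: gen_P HF.
  exists e; first by rewrite ei.
  move=> x; have Px := iN x; have [Dx _ _] := Px.
  have [t tp [h eh]] := Fgen _ Dx; exists t => //.
  have [r er] := P_lin _ _ _ _ _ HF (denom_neq0 tp) Px eh.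
  by exists r; apply: i_inj; rewrite !linearZZ er ei.
have i0 x : i x = 0 -> x = 0 by move=> ix; apply: i_inj; rewrite ix linear0.
(* A nonzero coefficient of [L F0] embeds N in R as an ideal. *)
have [a [b [c Labc]]] : exists a b c, (L F0)`_a`_b`_c != 0.
  have LF0 : L F0 != 0.
    by apply: contraTneq dF0 => LF; rewrite /deg LF size_poly0.
  exists (size (L F0)).-1; move: LF0; rewrite -lead_coef_eq0 lead_coefE.
  set q := (_`_ _) => q0; exists (size q).-1; move: q0; rewrite -lead_coef_eq0 lead_coefE.
  by set q' := (_`_ _) => q0'; exists (size q').-1; rewrite -lead_coefE lead_coef_eq0.
pose k (n : N) : R := (L (i n))`_a`_b`_c.
have LZ d z : (L (d *: z))`_a`_b`_c = d * (L z)`_a`_b`_c.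
  by rewrite -mulr_algl rmorphM LC /= !coefCM.
have k_lin d x y : k (d *: x + y) = d * k x + k y.
  by rewrite /k linearP /= rmorphD !coefD LZ.
have k_inj : injective k.
  move=> x y kxy; apply/eqP; rewrite -subr_eq0; apply/eqP; set z := x - y.
  have kz : k z = 0 by rewrite /z -scaleN1r addrC k_lin kxy mulN1r addNr.
  have [_ _ [d d0 [r er]]] := iN z; apply: i0.
  have r0 : r = 0.
    have := LZ d (i z); rewrite er LZ -/(k z) kz mulr0 => /eqP.
    by rewrite mulf_eq0 (negPf Labc) orbF => /eqP.
  by apply: (sym_torsion_free Rn Mr Mf d0); rewrite er r0 scale0r.
have N_local p : exists2 e : N, e <> 0 &
    forall x, exists2 t, t \notin p & exists r, t *: x = r *: e.
  have [e [_ _ de _] He] := gen_N p; exists e => // e0.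
  by move: de; rewrite e0 linear0 /deg rmorph0 size_poly0.
exists N; split.
  split; first exact: (invertible_fg Rn k_lin k_inj).
    exact: (invertible_projective Rn k_lin k_inj N_local).
  exact: (invertible_rank1 k_lin k_inj N_local).
have [f f_gen] : exists f : {lrmorphism Sym N -> B}, forall n, f (sym_gen n) = i n.
  by exists (sym_lift i) => n; apply: sym_lift_gen.
have f_ev n h : f (ev (in_alg (Sym N)) (sym_gen n) h) = ev (in_alg B) (i n) h.
  rewrite -f_gen; apply: (rmorph_ev (c' := in_alg B)) => d.
  exact: rmorph_alg.
have sym_local p : exists n, generator p (i n) /\ forall z : Sym N, exists2 t, t \notin p &
    exists h, t *: z = ev (in_alg (Sym N)) (sym_gen n) h.
  have [n Hn nspan] := gen_N p; exists n; split=> //.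
  exact: sym_local_generation.
exists f; split.
  suff f_eq0 z : f z = 0 -> z = 0.
    move=> z w zw; apply/eqP; rewrite -subr_eq0; apply/eqP/f_eq0.
    by apply: (etrans (raddfB f z w)); apply/eqP; rewrite subr_eq0; apply/eqP.
  move=> fz; apply: local_eq0 => // p; have [n [[_ _ dn _] Hn]] := sym_local p.
  have [t tp [h e]] := Hn z; exists t => //.
  have evh : t *: f z = f (ev (in_alg (Sym N)) (sym_gen n) h).
    by rewrite -e; apply/esym/linearZZ.
  rewrite fz scaler0 f_ev in evh; move/esym: evh => evh.
  suff h0 : h = 0 by rewrite e h0 -polyC0 ev_C rmorph0.
  (* As i n has positive degree, h must be constant, and its value is zero. *)
  have := deg_ev (i n) h; rewrite evh /deg rmorph0 size_poly0 /= => /esym/eqP.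
  rewrite muln_eq0 [X in _ || X]eqn0Ngt dn orbF => sh.
  have hC : h = (h`_0)%:P by apply: size1_polyC; case: (size h) sh => [|[]].
  rewrite hC in evh *; move: evh; rewrite ev_C => /(congr1 eps).
  by rewrite epsC rmorph0 => ->.
apply/seteqP; split=> [_ [z _ <-]|G DG].
  elim/sym_induction: z => [d|m|z w Dz Dw|z w Dz Dw]; rewrite /Ker /=.
  - by rewrite linearZZ rmorph1 (D_const HD).
  - by rewrite f_gen; have [] := iN m.
  - by rewrite rmorphD linearD Dz Dw addr0.
  - by rewrite rmorphM (der_mul HD) Dz Dw mul0r mulr0 addr0.
apply: (@local_submodule R) => // [|d x y [z _ <-] [w _ <-]|p].
- by exists 0 => //; rewrite rmorph0.
- by exists (d *: z + w) => //; rewrite linearP.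
have [n [[_ _ _ Hn] _]] := sym_local p; have [t tp [h e]] := Hn _ DG.
by exists t => //; exists (ev (in_alg (Sym N)) (sym_gen n) h) => //; rewrite f_ev e.
Qed.

End FromLocal.
End KernelSym.

Theorem theoremA2 (R : idomainType)
    (R_noetherian : noetherian R)
    (R_contains_Q : exists f : {rmorphism rat -> R}, injective f)
    (M : lmodType R) (M_rank2 : projective_of_rank M 2)
    (D : {linear Sym M -> Sym M}) (D_derivation : derivation D)
    (D_lnd : locally_nilpotent D)
    (D_irreducible : forall p : prime_idealr R, irreducible (loc_map p D)) :
  (exists N : lmodType R, projective_of_rank N 1 /\
     exists f : {lrmorphism Sym N -> Sym M},
       injective f /\ range f = Ker D)
  <->
  (grade_is (ideal_gen (range D)) (Some 2) \/
   grade_is (ideal_gen (range D)) None).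
Proof.
have [Mf _ Mr] := M_rank2.
have natinv n : exists c : R, n.+1%:R * c = 1.
  have [f _] := R_contains_Q; exists (f (n.+1%:R^-1)).
  by rewrite -(rmorph_nat f) -rmorphM mulfV ?rmorph1 // Num.Theory.pnatr_eq0.
have B1 : (1 : Sym M) <> 0 by apply/eqP; apply: oner_neq0.
have Bdom := sym_domain R_noetherian Mr Mf.
pose I := ideal_gen (range D); have HI : is_ideal I := ideal_gen_is_ideal _.
have ID x : I (D x) by apply: mem_ideal_gen; exists x.
have [p0 _] := zero_prime_idealr R.
(* The zero derivation is reducible, being divisible by the non-unit 0. *)
have Dn0 : exists b, D b <> 0.
  apply: contrapT => D0; apply: (D_irreducible p0); exists 0; split.
    move=> [c]; rewrite mul0r => /esym/frac_eq[u].
    rewrite /= !scale1r scaler0 => /(sym_torsion_free R_noetherian Mr Mf).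
    by move=> /(_ (denom_neq0 (denomP u))).
  move=> x; exists 0; have [b [s ->]] := fracE x; rewrite mulr0 loc_mapE.
  rewrite (_ : D b = 0); last by apply: contrapT => Db; apply: D0; exists b.
  by apply: frac_eqW; rewrite !scaler0.
split=> [[N [HN [f [_ fK]]]]|/(grade_codivisor_free Bdom B1) cf].
- have lk := sym_kernel_local HN fK.
  have cf := local_kernel_codivisor R_noetherian natinv Mr Mf D_derivation D_lnd Dn0
    D_irreducible lk.
  apply: (codivisor_free_grade Bdom HI) => //.
  + exact: sym_noetherian.
  + by have [b Db] := Dn0; exists (D b).
  move=> x y z sI reg.
  suff : [set b | I b] 1 by [].
  apply: (@local_submodule R) => // [|a b c Ib Ic|p].
  + by case: HI.
  + by case: HI => _ IA IM; rewrite /= -mulr_algl; apply: (IA) => //; apply: (IM).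
  have [C] := plane_model_exists R_noetherian Mr Mf D_derivation D_lnd p Dn0.
  have [I0 IA IM] := HI.
  (* By [pm_image] the scalar [pm_t C] multiplies I into (U, V). The Koszul lemma then puts its cube
     in (U, V), and U, V lie in I by [pm_UV]. *)
  have [c [d e]] : exists c d,
      (pm_t C)%:A ^+ 3 = pm_map C (pm_U C) * c + pm_map C (pm_V C) * d.
    apply: (koszul_two_generators reg) => w /sI.
    apply: (@ideal_gen_sub _ (range D) [set w | exists c d,
      (pm_t C)%:A * w = pm_map C (pm_U C) * c + pm_map C (pm_V C) * d]).
      split=> /= [|b b' [c [d e]] [c' [d' e']]|b b' [c [d e]]].
      - by exists 0, 0; rewrite !mulr0 addr0.
      - by exists (c + c'), (d + d'); rewrite mulrDr e e'; ring.
      - by exists (b * c), (b * d); rewrite mulrCA e; ring.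
    move=> _ [b _ <-] /=; have [c [d e]] := pm_image C b.
    by exists c, d; rewrite mulr_algl.
  exists (pm_t C ^+ 3); first by rewrite !exprS expr0 mulr1; do !apply: notinM; apply: pm_t_notin.
  have [[xU eU] [xV eV]] := pm_UV C.
  have e3 : (pm_t C ^+ 3)%:A = (pm_t C)%:A ^+ 3 :> Sym M.
    exact: (rmorphXn (in_alg (Sym M)) 3 (pm_t C)).
  have Iscale a b b' : I (a *: D b * b').
    by rewrite -scalerAl -mulr_algl; apply: (IM); rewrite mulrC; apply: (IM); apply: ID.
  by rewrite /= e3 e eU eV; apply: (IA).
- have lk p : local_kernel D p.
    by have [] := codivisor_local_kernel R_noetherian natinv Mr Mf D_derivation D_lnd
      p Dn0 cf.
  have [_ [G DG G_nc]] := codivisor_local_kernel R_noetherian natinv Mr Mf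
    D_derivation D_lnd p0 Dn0 cf.
  have [L [eps [LC epsC _ L_inj L_const]]] := sym_degree R_noetherian Mr Mf.
  exact: (kernel_sym_of_local R_noetherian Mr Mf D_derivation DG G_nc lk LC epsC L_const).
Qed.
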